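(* Let $\mathbf c:(0,1)\to(0,1)$ be a function with the finite restricted invertibility property (see context). Let $\epsilon\in(0,1)$ and $\delta>0$. Let $\varphi\in S_0(\mathbb R^d)$, let $\Lambda\subseteq\mathbb R^{2d}$ be discrete with $D^-(\Lambda)>0$, and let the Gabor system $(\varphi,\Lambda)$ have Bessel bound $B<\infty$. Then there exists a set $\Lambda_{\epsilon\delta}\subseteq\Lambda$ of uniform Beurling density such that (1) $\displaystyle\frac{D(\Lambda_{\epsilon\delta})}{D^-(\Lambda)}\ge\frac{1-\epsilon}{B}\|\varphi\|^2$; (2) for all $\{b_\lambda\}_{\lambda\in\Lambda}\in\ell_2(\Lambda)$, $$\Big\|\sum_{\lambda\in\Lambda_{\epsilon\delta}}b_\lambda\pi(\lambda)\varphi\Big\|^2\ge\mathbf c(\epsilon)(1-\delta)\|\varphi\|^2\sum_{\lambda\in\Lambda_{\epsilon\delta}}|b_\lambda|^2 .$$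
   Context: Finite restricted invertibility property of $\mathbf c$: $\mathbf c:(0,1)\to(0,1)$ is continuous and monotone, and for every $\epsilon\in(0,1)$, $n\in\mathbb N$, $u>0$, orthonormal basis $\{e_i\}_{i=1}^n$ of $\ell_2^n$ and linear operator $T:\ell_2^n\to\ell_2^n$ with $\|Te_i\|\ge u$ for all $i$, there is $J_\epsilon\subseteq\{1,\dots,n\}$ with $|J_\epsilon|/n\ge(1-\epsilon)u^2/\|T\|^2$ and $\|\sum_{j\in J_\epsilon}b_jTe_j\|^2\ge\mathbf c(\epsilon)u^2\sum_{j\in J_\epsilon}|b_j|^2$ for all scalars $b_j$. (Such a function exists.) For $\lambda=(x,\omega)\in\mathbb R^{2d}$, $\pi(\lambda)=M_\omega T_x$ on $L^2(\mathbb R^d)$, where $(M_\omega f)(t)=e^{2\pi i\omega\cdot t}f(t)$ and $(T_xf)(t)=f(t-x)$. The Gabor system is $(\varphi,\Lambda)=\{\pi(\lambda)\varphi\}_{\lambda\in\Lambda}$; it has Bessel bound $B$ if $\sum_{\lambda\in\Lambda}|\langle f,\pi(\lambda)\varphi\rangle|^2\le B\|f\|^2$ for all $f\in L^2(\mathbb R^d)$. The norm $\|\cdot\|$ is the $L^2$ norm. The Feichtinger algebra is $S_0(\mathbb R^d)=\{f\in L^2(\mathbb R^d):\ \lambda\mapsto\langle f,\pi(\lambda)\varphi_0\rangle\in L^1(\mathbb R^{2d})\}$ with $\varphi_0$ a Gaussian. Beurling densities of $\Lambda\subseteq\mathbb R^{2d}$: $D^-(\Lambda)=\liminf_{R\to\infty}\inf_{x\in\mathbb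 R^{2d}}|\Lambda\cap(x+[-R,R]^{2d})|/(2R)^{2d}$ and $D^+(\Lambda)=\limsup_{R\to\infty}\sup_{x\in\mathbb R^{2d}}|\Lambda\cap(x+[-R,R]^{2d})|/(2R)^{2d}$; $\Lambda$ has uniform density $D(\Lambda)$ if both agree, $D(\Lambda)$ being the common value. *)

(* Defs.v *)
From HB Require Import structures.
From mathcomp Require Import all_boot all_order all_algebra finmap.
From mathcomp Require Import complex.
From mathcomp Require Import all_classical all_reals all_analysis.

Set Implicit Arguments.
Unset Strict Implicit.
Unset Printing Implicit Defensive.

Import Order.TTheory GRing.Theory Num.Theory.
Import numFieldNormedType.Exports.

Local Open Scope classical_set_scope.
Local Open Scope ring_scope.

(* The product sigma-algebra on T^n; for T = R it is the Borel sigma-algebra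
   of R^n. *)
Section measurable_rV.
Context {d : measure_display} {T : measurableType d}.
Variable n : nat.

Let coord (i : 'I_n) (x : 'rV[T]_n) : T := x ord0 i.

Let rV_set0 : g_sigma_preimage coord set0.
Proof. exact: sigma_algebra0. Qed.

Let rV_setC A : g_sigma_preimage coord A -> g_sigma_preimage coord (~` A).
Proof. exact: sigma_algebraC. Qed.

Let rV_bigcup (F : _^nat) : (forall i, g_sigma_preimage coord (F i)) ->
  g_sigma_preimage coord (\bigcup_i (F i)).
Proof. exact: sigma_algebra_bigcup. Qed.

HB.instance Definition _ := @isMeasurable.Build (measure_tuple_display d)
  'rV[T]_n (g_sigma_preimage coord) rV_set0 rV_setC rV_bigcup.

End measurable_rV.

Lemma measurable_coord (d : measure_display) (T : measurableType d) n
    (i : 'I_n) : measurable_fun [set: 'rV[T]_n] (fun x => x ord0 i).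
Proof.
move=> _ Y mY; rewrite setTI; apply: sub_sigma_algebra => /=.
rewrite -bigcup_seq/=; exists i => /=; first by rewrite mem_index_enum.
by exists Y => //; rewrite setTI.
Qed.

Lemma measurable_fun_coordP (d1 d2 : measure_display) (T1 : measurableType d1)
    (T2 : measurableType d2) n (f : T1 -> 'rV[T2]_n) :
  measurable_fun setT f <->
  forall i, measurable_fun setT (fun x => f x ord0 i).
Proof.
split=> [mf i|mf].
  exact: (measurableT_comp (measurable_coord i) mf).
suff: g_sigma_preimage (fun (i : 'I_n) (x : T1) => f x ord0 i) `<=` measurable.
  rewrite (g_sigma_preimage_comp (fun (i : 'I_n) (x : 'rV[T2]_n) => x ord0 i)).
  by move=> prefS _ A mA; apply: prefS; exists A.
apply: smallest_sub; first exact: sigma_algebra_measurable.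
move=> A; rewrite -bigcup_seq => -[i _ [B mB <-]].
exact: (mf i).
Qed.

Lemma measurable_box_rV (d : measure_display) (T : measurableType d) n
    (A : 'I_n -> set T) : (forall i, measurable (A i)) ->
  measurable [set x : 'rV[T]_n | forall i, A i (x ord0 i)].
Proof.
move=> mA; rewrite (_ : [set x | _] =
    \bigcap_(i in [set: 'I_n]) ((fun x : 'rV[T]_n => x ord0 i) @^-1` A i)).
  apply: fin_bigcap_measurable => // i _.
  by rewrite -[X in measurable X]setTI; exact: measurable_coord.
by apply/seteqP; split => x /= xA i => [_|]; exact: xA.
Qed.

Section lebesgue_rV.
Context (R : realType).
Local Open Scope ereal_scope.

Definition cons_rV n (p : R * 'rV[R]_n) : 'rV[R]_n.+1 :=
  row_mx (const_mx p.1 : 'rV[R]_1) p.2.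

Definition uncons_rV n (v : 'rV[R]_n.+1) : R * 'rV[R]_n :=
  (v ord0 ord0, \row_i v ord0 (lift ord0 i)).

Lemma cons_rV0 n x (v : 'rV[R]_n) : cons_rV (x, v) ord0 ord0 = x.
Proof.
rewrite (_ : ord0 = @lshift 1 n ord0); last exact/val_inj.
by rewrite /cons_rV mxE (unsplitK (inl _)) mxE.
Qed.

Lemma cons_rV_lift n x (v : 'rV[R]_n) i :
  cons_rV (x, v) ord0 (lift ord0 i) = v ord0 i.
Proof.
rewrite (_ : lift ord0 i = @rshift 1 n i); last exact/val_inj.
by rewrite /cons_rV mxE (unsplitK (inr _)).
Qed.

Lemma cons_rVK n : cancel (@cons_rV n) (@uncons_rV n).
Proof.
move=> [x v]; rewrite /uncons_rV cons_rV0; congr (_, _).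
by apply/rowP => i; rewrite mxE cons_rV_lift.
Qed.

Lemma measurable_cons_rV n : measurable_fun setT (@cons_rV n).
Proof.
apply/measurable_fun_coordP => i.
case: (unliftP ord0 i) => [j|] ->; last first.
  rewrite (_ : (fun x => _) = fst)//.
  by apply/funext => -[x v]; rewrite cons_rV0.
rewrite (_ : (fun x => _) = (fun v : 'rV[R]_n => v ord0 j) \o snd).
  by apply: measurableT_comp; [exact: measurable_coord|].
by apply/funext => -[x v]; rewrite cons_rV_lift.
Qed.

Lemma measurable_uncons_rV n : measurable_fun setT (@uncons_rV n).
Proof.
apply/measurable_fun_pairP; split; first exact: measurable_coord.
apply/measurable_fun_coordP => i.
rewrite (_ : (fun x => _) = (fun v : 'rV[R]_n.+1 => v ord0 (lift ord0 i))).
  exact: measurable_coord.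
by apply/funext => v; rewrite mxE.
Qed.

Section lebesgue_rVS.
Variables (n : nat) (m : {sigma_finite_measure set 'rV[R]_n -> \bar R}).

Definition lebesgue_rVS : set 'rV[R]_n.+1 -> \bar R :=
  pushforward (@lebesgue_measure R \x m) (@cons_rV n).

Let mcons (A : set 'rV[R]_n.+1) :
  measurable A -> measurable (@cons_rV n @^-1` A).
Proof.
by move=> mA; rewrite -[X in measurable X]setTI; exact: measurable_cons_rV.
Qed.

Let lebesgue_rVS0 : lebesgue_rVS set0 = 0.
Proof. by rewrite /lebesgue_rVS /pushforward preimage_set0 measure0. Qed.

Let lebesgue_rVS_ge0 A : 0 <= lebesgue_rVS A.
Proof. by rewrite /lebesgue_rVS /pushforward; exact: measure_ge0. Qed.

Let lebesgue_rVS_sigma_additive : semi_sigma_additive lebesgue_rVS.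
Proof.
move=> F mF tF mUF; rewrite /lebesgue_rVS /pushforward preimage_bigcup.
apply: measure_semi_sigma_additive.
- by move=> k; exact: mcons.
- apply/trivIsetP => /= i j _ _ ij; rewrite -preimage_setI.
  by move/trivIsetP : tF => /(_ _ _ _ _ ij) ->//; rewrite preimage_set0.
- by rewrite -preimage_bigcup; exact: mcons.
Qed.

HB.instance Definition _ := isMeasure.Build _ _ _ lebesgue_rVS
  lebesgue_rVS0 lebesgue_rVS_ge0 lebesgue_rVS_sigma_additive.

Let lebesgue_rVS_sigma_finite : sigma_finite setT lebesgue_rVS.
Proof.
have /sigma_finiteP[F [FT ndF Foo]] := sigma_finiteT (@lebesgue_measure R).
have /sigma_finiteP[G [GT ndG Goo]] := sigma_finiteT m.
exists (fun k => @uncons_rV n @^-1` (F k `*` G k)).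
  rewrite -preimage_bigcup (_ : \bigcup_k _ = setT) ?preimage_setT//.
  rewrite -subTset => -[x y] _.
  have [i _ Fx] : (\bigcup_i F i) x by rewrite -FT.
  have [j _ Gy] : (\bigcup_i G i) y by rewrite -GT.
  exists (maxn i j) => //; split => /=.
  - by move: x Fx; exact/subsetPset/ndF/leq_maxl.
  - by move: y Gy; exact/subsetPset/ndG/leq_maxr.
move=> k; have [mF Fk] := Foo k; have [mG Gk] := Goo k.
split.
  rewrite -[X in measurable X]setTI.
  by apply: measurable_uncons_rV => //; exact: measurableX.
rewrite /lebesgue_rVS /pushforward -comp_preimage (_ : _ \o _ = id)//.
  by rewrite preimage_id product_measure1E// lte_mul_pinfty// ge0_fin_numE.
exact/funext/cons_rVK.
Qed.

HB.instance Definition _ := Measure_isSigmaFinite.Build _ _ _ lebesgue_rVS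
  lebesgue_rVS_sigma_finite.

End lebesgue_rVS.

(* Iterated product of the one-dimensional Lebesgue measure (on Borel sets);
   lebesgue_rV_box below characterizes it. *)
Fixpoint lebesgue_rV n : {sigma_finite_measure set 'rV[R]_n -> \bar R} :=
  match n with
  | 0%N => @dirac _ _ (0%R : 'rV[R]_0) R
  | m.+1 => lebesgue_rVS (lebesgue_rV m)
  end.

Lemma lebesgue_rV_box n (A : 'I_n -> set R) :
  (forall i, measurable (A i)) ->
  lebesgue_rV n [set x | forall i, A i (x ord0 i)] =
  \prod_(i < n) lebesgue_measure (A i).
Proof.
elim: n => [|n IHn] in A *.
  by move=> _; rewrite big_ord0 /= diracE mem_set// => -[].
move=> mA; rewrite big_ord_recl -IHn => [|i]; last exact: mA.
pose B := [set x : 'rV[R]_n | forall i, A (lift ord0 i) (x ord0 i)].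
have mB : measurable B.
  apply: (@measurable_box_rV _ R n (fun i => A (lift ord0 i))) => i.
  exact: mA.
transitivity ((@lebesgue_measure R \x lebesgue_rV n) (A ord0 `*` B)); last first.
  by rewrite (@product_measure1E _ _ _ _ R (@lebesgue_measure R)
    (lebesgue_rV n) (A ord0) B (mA ord0) mB).
apply: (congr1 (@lebesgue_measure R \x lebesgue_rV n)).
apply/seteqP; split => -[x v] /=.
  move=> xA; split => [|i]; first by have := xA ord0; rewrite cons_rV0.
  by have := xA (lift ord0 i); rewrite cons_rV_lift.
move=> [Ax Bv] i; case: (unliftP ord0 i) => [j|] ->.
  by rewrite cons_rV_lift; exact: Bv.
by rewrite cons_rV0.
Qed.

End lebesgue_rV.

(* Elements of L^p(R^n) are represented by Borel functions, not by almost
   everywhere classes: every quantity below only depends on the class. *)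
Section gabor.
Context (R : realType).
Implicit Types n d : nat.

Definition complex_measurable n (f : 'rV[R]_n -> R[i]) : Prop :=
  measurable_fun setT (fun x => complex.Re (f x)) /\
  measurable_fun setT (fun x => complex.Im (f x)).

Definition complex_Lnorm n (p : R) (f : 'rV[R]_n -> R[i]) : \bar R :=
  'N[lebesgue_rV R n]_p%:E[EFin \o (@Normc.normc R \o f)].

Definition in_Lp n (p : R) (f : 'rV[R]_n -> R[i]) : Prop :=
  complex_measurable f /\ (complex_Lnorm p f < +oo)%E.

Definition L2norm n (f : 'rV[R]_n -> R[i]) : \bar R := complex_Lnorm 2 f.

Definition complex_integral n (f : 'rV[R]_n -> R[i]) : R[i] :=
  Complex (\int[lebesgue_rV R n]_x complex.Re (f x))
          (\int[lebesgue_rV R n]_x complex.Im (f x)).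

(* Linear in the first argument. *)
Definition L2inner n (f g : 'rV[R]_n -> R[i]) : R[i] :=
  complex_integral (fun t => f t * conjc (g t)).

Definition dotrV n (x y : 'rV[R]_n) : R := \sum_(i < n) x ord0 i * y ord0 i.

Definition modulation n (w : 'rV[R]_n) (f : 'rV[R]_n -> R[i]) :
    'rV[R]_n -> R[i] :=
  fun t => Complex (cos (2 * pi * dotrV w t)) (sin (2 * pi * dotrV w t)) * f t.

Definition translation n (x : 'rV[R]_n) (f : 'rV[R]_n -> R[i]) :
    'rV[R]_n -> R[i] :=
  fun t => f (t - x).

(* pi(lambda) = M_omega T_x, with lambda = row_mx x omega. *)
Definition tfshift d (l : 'rV[R]_(d + d)) (f : 'rV[R]_d -> R[i]) :
    'rV[R]_d -> R[i] :=
  modulation (rsubmx l) (translation (lsubmx l) f).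

Definition gaussian d (t : 'rV[R]_d) : R[i] := Complex (expR (- pi * dotrV t t)) 0.

(* S_0(R^d); it does not depend on the choice of the Gaussian. *)
Definition feichtinger d (f : 'rV[R]_d -> R[i]) : Prop :=
  in_Lp 2 f /\ in_Lp 1 (fun l => L2inner f (tfshift l (@gaussian d))).

Definition bessel_bound d (phi : 'rV[R]_d -> R[i]) (L : set 'rV[R]_(d + d))
    (B : R) : Prop :=
  forall f : 'rV[R]_d -> R[i], in_Lp 2 f ->
    ((\esum_(l in L) (Normc.normc (L2inner f (tfshift l phi)) ^+ 2)%:E)
     <= B%:E * L2norm f ^+ 2)%E.

Definition cube n (x : 'rV[R]_n) (r : R) : set 'rV[R]_n :=
  [set y | forall i, x ord0 i - r <= y ord0 i <= x ord0 i + r].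

Definition cube_density n (L : set 'rV[R]_n) (r : R) (x : 'rV[R]_n) : \bar R :=
  (counting (L `&` cube x r) / ((2 * r) ^+ n)%:E)%E.

Definition lower_density n (L : set 'rV[R]_n) : \bar R :=
  limf_einf (fun r : R => ereal_inf (range (cube_density L r))) +oo%R.

Definition upper_density n (L : set 'rV[R]_n) : \bar R :=
  limf_esup (fun r : R => ereal_sup (range (cube_density L r))) +oo%R.

Definition uniform_density n (L : set 'rV[R]_n) (D : \bar R) : Prop :=
  lower_density L = D /\ upper_density L = D.

Definition square_summable (T : choiceType) (S : set T) (b : T -> R[i]) : Prop :=
  ((\esum_(l in S) (Normc.normc (b l) ^+ 2)%:E) < +oo)%E.

(* g is the sum in L^2 of the u l for l in S, in the sense of the net of finite
   partial sums (unconditional convergence). *)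
Definition L2_has_sum n (T : choiceType) (S : set T)
    (u : T -> 'rV[R]_n -> R[i]) (g : 'rV[R]_n -> R[i]) : Prop :=
  in_Lp 2 g /\
  forall e : R, 0 < e -> exists2 F0 : {fset T}, [set` F0] `<=` S &
    forall F : {fset T}, [set` F0] `<=` [set` F] -> [set` F] `<=` S ->
      (L2norm (fun t => (g t - \sum_(l <- F) u l t)%R) < e%:E)%E.

Definition l2inner n (x y : 'cV[R[i]]_n) : R[i] :=
  \sum_(i < n) x i ord0 * conjc (y i ord0).

Definition l2norm n (x : 'cV[R[i]]_n) : R :=
  Num.sqrt (\sum_(i < n) Normc.normc (x i ord0) ^+ 2).

Definition opnorm n (T : {linear 'cV[R[i]]_n -> 'cV[R[i]]_n}) : R :=
  sup [set l2norm (T x) | x in [set x | l2norm x <= 1]].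

(* n orthonormal vectors of an n-dimensional space form a basis. *)
Definition orthonormal_basis n (e : 'I_n -> 'cV[R[i]]_n) : Prop :=
  forall i j, l2inner (e i) (e j) = (i == j)%:R.

(* c is a map (0,1) -> (0,1); its values outside of this interval are not
   constrained, and monotone means nondecreasing or nonincreasing. *)
Definition finite_restricted_invertibility (c : R -> R) : Prop :=
  [/\ (forall eps, 0 < eps < 1 -> 0 < c eps < 1),
      {in `]0, 1[%R, continuous c},
      ({in `]0, 1[ &, {homo c : x y / x <= y}} \/
       {in `]0, 1[ &, {homo c : x y /~ x <= y}}) &
      forall (eps : R) (n : nat) (u : R) (e : 'I_n -> 'cV[R[i]]_n)
        (T : {linear 'cV[R[i]]_n -> 'cV[R[i]]_n}),
        0 < eps < 1 -> (0 < n)%N -> 0 < u -> orthonormal_basis e ->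
        (forall i, u <= l2norm (T (e i))) ->
        exists2 J : {set 'I_n},
          (1 - eps) * u ^+ 2 / opnorm T ^+ 2 <= #|J|%:R / n%:R &
          forall b : 'I_n -> R[i],
            c eps * u ^+ 2 * (\sum_(j in J) Normc.normc (b j) ^+ 2)
            <= l2norm (\sum_(j in J) b j *: T (e j)) ^+ 2].

End gabor.

(* Main.v *)
Require Import Defs.
From HB Require Import structures.
From mathcomp Require Import all_boot all_order all_algebra finmap.
From mathcomp Require Import complex spectral.
From mathcomp Require Import all_classical all_reals all_analysis.
From mathcomp Require Import measurable_realfun ring lra.

Set Implicit Arguments.
Unset Strict Implicit.
Unset Printing Implicit Defensive.

Import Order.TTheory GRing.Theory Num.Theory.
Import numFieldNormedType.Exports.

Local Open Scope classical_set_scope.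
Local Open Scope ring_scope.

(* The V z = <phi, pi(z) phi0> form an integrable function, and phi is almost
   everywhere a multiple of the integral of V z pi(z) phi0.  Hence
   |<pi(l) phi, pi(m) phi>| is at most the integral over the unit cube around
   l - m of a fixed integrable function.  The Bessel bound makes Lambda
   relatively separated, so the sums of these inner products over
   |l - m| > M tend to 0 uniformly as M grows.
   Tile R^(2d) by cells of side N and keep, in each cell, only the points of
   Lambda at distance (M + 1) / 2 from its boundary.  Finite restricted
   invertibility, applied with eps' < eps to a square root of the Gram matrix of
   these finitely many atoms (of operator norm at most sqrt B by duality), lets
   us choose the same number m of points in every cell, so that the union has
   uniform density m / N^(2d); N large makes it as dense as required.
   Different cells interact through a Gram matrix of small norm, which is
   absorbed by c(eps') > c(eps) (1 - delta). *)

(** Restricted invertibility treats each cell separately and says nothing about how chosen atoms of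
    different cells interact; the decay of the Gram matrix supplies this. The tail bound is uniform
    in the centre, so M is fixed by the coupling that can be afforded, before N is chosen. The
    discarded boundary layers then cost only the factor ((N - M - 1) / N)^(2d), which tends to 1 as
    N grows. The gap between eps' and eps pays for this factor and for replacing D^-(Lambda) by a
    slightly smaller density that every large cube really attains. Equal numbers of points can be
    imposed because the lower bound passes to subsets of a chosen set: surplus points are thrown
    away. The inversion formula is tested against Gaussians only: all integrals are then explicit,
    and these tests determine a function almost everywhere. It reduces the Gram matrix of phi to
    that of the Gaussian window, whose entries decay like a Gaussian. *)

Local Notation Re := complex.Re.
Local Notation Im := complex.Im.
Local Notation normc := Normc.normc.

(** * Integration of complex functions *)

Section complex_numbers.
Context {R : rcfType}.
Implicit Types z w : R[i].

Lemma ReD z w : Re (z + w) = Re z + Re w. Proof. by case: z w => [? ?] []. Qed.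
Lemma ImD z w : Im (z + w) = Im z + Im w. Proof. by case: z w => [? ?] []. Qed.
Lemma ReM z w : Re (z * w) = Re z * Re w - Im z * Im w.
Proof. by case: z w => [? ?] []. Qed.
Lemma ImM z w : Im (z * w) = Re z * Im w + Im z * Re w.
Proof. by case: z w => [? ?] []. Qed.
Lemma Re_conjc z : Re (conjc z) = Re z. Proof. by case: z. Qed.
Lemma Im_conjc z : Im (conjc z) = - Im z. Proof. by case: z. Qed.

Lemma conjcM z w : conjc (z * w) = conjc z * conjc w.
Proof. exact: rmorphM. Qed.

Lemma conjc_sum I (r : seq I) (P : pred I) (F : I -> R[i]) :
  conjc (\sum_(i <- r | P i) F i) = \sum_(i <- r | P i) conjc (F i).
Proof. exact: rmorph_sum. Qed.

Lemma complex_eqP z w : Re z = Re w -> Im z = Im w -> z = w.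
Proof. by case: z w => [a b] [c d] /= -> ->. Qed.

Lemma normcE z : normc z = Num.sqrt (Re z ^+ 2 + Im z ^+ 2).
Proof. by case: z. Qed.

Lemma sqr_normc z : normc z ^+ 2 = Re z ^+ 2 + Im z ^+ 2.
Proof. by rewrite normcE sqr_sqrtr// addr_ge0 ?sqr_ge0. Qed.

Lemma normc_ge0 z : 0 <= normc z.
Proof. by rewrite normcE sqrtr_ge0. Qed.

Lemma normc_real (x : R) : normc x%:C%C = `|x|.
Proof. by rewrite normcE/= expr0n/= addr0 sqrtr_sqr. Qed.

Lemma normcJ z : normc (conjc z) = normc z.
Proof. by rewrite !normcE Re_conjc Im_conjc sqrrN. Qed.

Lemma mulc_conj z : z * conjc z = (normc z ^+ 2)%:C%C.
Proof.
by apply: complex_eqP; rewrite ?ReM ?ImM Re_conjc Im_conjc/= ?sqr_normc; ring.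
Qed.

Lemma ler_normcD z w : normc (z + w) <= normc z + normc w.
Proof. exact: le_normcD. Qed.

Lemma ler_normc_sum I (r : seq I) (P : pred I) (F : I -> R[i]) :
  normc (\sum_(i <- r | P i) F i) <= \sum_(i <- r | P i) normc (F i).
Proof.
elim/big_rec2: _ => [|i x y _ h]; first by rewrite Normc.normc0.
by rewrite (le_trans (ler_normcD _ _))// lerD2l.
Qed.

Lemma ler_Re_normc z : `|Re z| <= normc z.
Proof.
by rewrite normcE -sqrtr_sqr ler_wsqrtr// lerDl sqr_ge0.
Qed.

Lemma ler_Im_normc z : `|Im z| <= normc z.
Proof.
by rewrite normcE -sqrtr_sqr ler_wsqrtr// lerDr sqr_ge0.
Qed.

Lemma Re_le_normc z : Re z <= normc z.
Proof. exact: le_trans (ler_norm _) (ler_Re_normc z). Qed.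

Lemma normc_le_ReIm z : normc z <= `|Re z| + `|Im z|.
Proof.
rewrite -(@ler_pXn2r _ 2) ?nnegrE ?normc_ge0 ?addr_ge0//.
rewrite sqr_normc -[Re z ^+ 2]real_normK ?num_real// -[Im z ^+ 2]real_normK ?num_real//.
have := mulr_ge0 (normr_ge0 (Re z)) (normr_ge0 (Im z)); nra.
Qed.

(** Multiplying by this phase turns a modulus into a real part; this reduces the triangle inequality
    for complex integrals to the real one. *)
Lemma unimodular_rotation z : exists2 u, normc u = 1 & u * z = (normc z)%:C%C.
Proof.
have [->|z0] := eqVneq z 0; first by exists 1; rewrite ?Normc.normc1// Normc.normc0 mulr0.
have nz0 : normc z != 0 by apply: contra z0 => /eqP/Normc.eq0_normc ->.
exists (conjc z * ((normc z)^-1)%:C%C).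
  by rewrite Normc.normcM normcJ normc_real ger0_norm ?invr_ge0 ?normc_ge0// mulfV.
rewrite mulrC mulrA mulc_conj -rmorphM/= expr2 mulfK//.
Qed.

Lemma Re_sum I (r : seq I) (P : pred I) (F : I -> R[i]) :
  Re (\sum_(i <- r | P i) F i) = \sum_(i <- r | P i) Re (F i).
Proof. by elim/big_rec2: _ => [//|i x y _ <-]; rewrite ReD. Qed.

End complex_numbers.

Section complex_measurable_functions.
Context d (T : measurableType d) (R : realType).
Implicit Types f g : T -> R[i].

(** The condition [complex_measurable] over an arbitrary measurable space, so that it also covers
    functions on products. *)
Definition cmeas f := measurable_fun setT (fun x => Re (f x)) /\
  measurable_fun setT (fun x => Im (f x)).

Lemma eq_cmeas f g : f =1 g -> cmeas f -> cmeas g.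
Proof. by move=> /funext ->. Qed.

Lemma cmeas_cst (c : R[i]) : cmeas (fun=> c).
Proof. by split; exact: measurable_cst. Qed.

Lemma cmeas_real (u : T -> R) : measurable_fun setT u ->
  cmeas (fun x => (u x)%:C%C).
Proof. by move=> mu; split => //; exact: measurable_cst. Qed.

Lemma cmeasD f g : cmeas f -> cmeas g -> cmeas (fun x => f x + g x).
Proof.
move=> [f1 f2] [g1 g2]; split.
  by under eq_fun do rewrite ReD; exact: measurable_funD.
by under eq_fun do rewrite ImD; exact: measurable_funD.
Qed.

Lemma cmeasM f g : cmeas f -> cmeas g -> cmeas (fun x => f x * g x).
Proof.
move=> [f1 f2] [g1 g2]; split.
  under eq_fun do rewrite ReM.
  by apply: measurable_funB; exact: measurable_funM.
under eq_fun do rewrite ImM.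
by apply: measurable_funD; exact: measurable_funM.
Qed.

Lemma cmeas_conj f : cmeas f -> cmeas (fun x => conjc (f x)).
Proof.
move=> [f1 f2]; split; first by under eq_fun do rewrite Re_conjc.
under eq_fun do rewrite Im_conjc.
exact: measurableT_comp.
Qed.

Lemma measurable_normc f : cmeas f -> measurable_fun setT (fun x => normc (f x)).
Proof.
move=> [f1 f2]; under eq_fun do rewrite normcE.
apply: (measurableT_comp (f := fun x : R => Num.sqrt x)) => //.
  apply: continuous_measurable_fun; exact: sqrt_continuous.
by apply: measurable_funD; exact: measurable_funX.
Qed.

End complex_measurable_functions.

Lemma cmeas_comp d d' (T : measurableType d) (T' : measurableType d')
    (R : realType) (f : T' -> R[i]) (h : T -> T') :
  measurable_fun setT h -> cmeas f -> cmeas (f \o h).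
Proof.
move=> mh [f1 f2]; split.
  exact: (measurableT_comp f1 mh).
exact: (measurableT_comp f2 mh).
Qed.

Section complex_integration.
Context d (T : measurableType d) (R : realType) (mu : {measure set T -> \bar R}).
Implicit Types f g : T -> R[i].

Definition cintegrable f := mu.-integrable setT (EFin \o (fun x => Re (f x))) /\
  mu.-integrable setT (EFin \o (fun x => Im (f x))).

(** Over [lebesgue_rV] this is convertible to [complex_integral], so an [L2inner] can be read as a
    [cint]. *)
Definition cint f : R[i] :=
  Complex (\int[mu]_x Re (f x)) (\int[mu]_x Im (f x)).

Lemma eq_cint f g : f =1 g -> cint f = cint g.
Proof. by move=> /funext ->. Qed.

Lemma eq_cintegrable f g : f =1 g -> cintegrable f -> cintegrable g.
Proof. by move=> /funext ->. Qed.

Lemma cintegrable_cmeas f : cintegrable f -> cmeas f.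
Proof. by move=> [/measurable_int/measurable_EFinP ? /measurable_int/measurable_EFinP ?]. Qed.

Lemma cintegrable_normc f : cintegrable f ->
  mu.-integrable setT (fun x => (normc (f x))%:E).
Proof.
move=> cf; have mf := cintegrable_cmeas cf; case: cf => fi1 fi2.
apply: (@le_integrable _ _ _ _ _ measurableT _
    (fun x => (`|Re (f x)| + `|Im (f x)|)%:E)).
- exact/measurable_EFinP/measurable_normc.
- move=> x _; rewrite /= lee_fin ger0_norm ?normc_ge0//.
  by rewrite (le_trans (normc_le_ReIm _))// ler_norm.
- under eq_fun do rewrite EFinD.
  by apply: integrableD => //; exact: integrable_norm.
Qed.

Lemma le_cintegrable f (g : T -> R) : cmeas f ->
  (forall x, normc (f x) <= g x) -> mu.-integrable setT (EFin \o g) ->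
  cintegrable f.
Proof.
move=> [mf1 mf2] fg ig; split; apply: (le_integrable measurableT _ _ ig).
- exact/measurable_EFinP.
- move=> x _ /=; rewrite lee_fin (le_trans (ler_Re_normc _))//.
  by rewrite (le_trans (fg x))// ler_norm.
- exact/measurable_EFinP.
- move=> x _ /=; rewrite lee_fin (le_trans (ler_Im_normc _))//.
  by rewrite (le_trans (fg x))// ler_norm.
Qed.

Lemma cintegrableP f : cmeas f -> (\int[mu]_x (normc (f x))%:E < +oo)%E ->
  cintegrable f.
Proof.
move=> mf fi; apply: (@le_cintegrable _ (fun x => normc (f x))) => //.
apply/integrableP; split; first exact/measurable_EFinP/measurable_normc.
by under eq_integral do rewrite /= ger0_norm ?normc_ge0//.
Qed.

Lemma cintegrable_lty f : cintegrable f -> (\int[mu]_x (normc (f x))%:E < +oo)%E.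
Proof.
move=> /cintegrable_normc/integrableP[_].
by under eq_integral do rewrite /= ger0_norm ?normc_ge0//.
Qed.

Lemma cintegrableZ (c : R[i]) f : cintegrable f -> cintegrable (fun x => c * f x).
Proof.
move=> cf; apply: (@le_cintegrable _ (fun x => normc c * normc (f x))).
- by apply: cmeasM; [exact: cmeas_cst|exact: cintegrable_cmeas].
- by move=> x; rewrite Normc.normcM.
- exact: (integrableZl measurableT _ (cintegrable_normc cf)).
Qed.

Lemma cintZ (c : R[i]) f : cintegrable f ->
  cint (fun x => c * f x) = c * cint f.
Proof.
move=> [fi1 fi2]; apply: complex_eqP; rewrite ?ReM ?ImM /=.
  under eq_Rintegral do rewrite ReM.
  rewrite RintegralB//; last 2 first.
  - exact: (integrableZl measurableT _ fi1).
  - exact: (integrableZl measurableT _ fi2).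
  by rewrite !RintegralZl.
under eq_Rintegral do rewrite ImM.
rewrite RintegralD//; last 2 first.
- exact: (integrableZl measurableT _ fi2).
- exact: (integrableZl measurableT _ fi1).
by rewrite !RintegralZl.
Qed.

Lemma cintegrableD f g : cintegrable f -> cintegrable g ->
  cintegrable (fun x => f x + g x).
Proof.
move=> [f1 f2] [g1 g2]; split.
  under [X in EFin \o X]eq_fun do rewrite ReD.
  exact: (integrableD measurableT f1 g1).
under [X in EFin \o X]eq_fun do rewrite ImD.
exact: (integrableD measurableT f2 g2).
Qed.

Lemma cintD f g : cintegrable f -> cintegrable g ->
  cint (fun x => f x + g x) = cint f + cint g.
Proof.
move=> [f1 f2] [g1 g2]; apply: complex_eqP; rewrite ?ReD ?ImD /=.
  by under eq_Rintegral do rewrite ReD; rewrite RintegralD.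
by under eq_Rintegral do rewrite ImD; rewrite RintegralD.
Qed.

Lemma cintegrable0 : cintegrable (fun=> 0).
Proof. by split; exact: integrable0. Qed.

Lemma cint0 : cint (fun=> 0) = 0.
Proof. by apply: complex_eqP => /=; rewrite /Rintegral integral0. Qed.

Lemma cintegrable_sum I (r : seq I) (F : I -> T -> R[i]) :
  (forall i, cintegrable (F i)) -> cintegrable (fun x => \sum_(i <- r) F i x).
Proof.
move=> mF; elim: r => [|i r IH].
  by under eq_fun do rewrite big_nil; exact: cintegrable0.
by under eq_fun do rewrite big_cons; exact: cintegrableD.
Qed.

Lemma cint_sum I (r : seq I) (F : I -> T -> R[i]) :
  (forall i, cintegrable (F i)) ->
  cint (fun x => \sum_(i <- r) F i x) = \sum_(i <- r) cint (F i).
Proof.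
move=> mF; elim: r => [|i r IH].
  by under eq_fun do rewrite big_nil; rewrite cint0 big_nil.
under eq_fun do rewrite big_cons; rewrite cintD//; last exact: cintegrable_sum.
by rewrite IH big_cons.
Qed.

Lemma cintegrable_conj f : cintegrable f -> cintegrable (fun x => conjc (f x)).
Proof.
move=> cf; apply: (le_cintegrable _ _ (cintegrable_normc cf)).
  exact/cmeas_conj/cintegrable_cmeas.
by move=> x; rewrite normcJ.
Qed.

Lemma cint_conj f : cintegrable f -> cint (fun x => conjc (f x)) = conjc (cint f).
Proof.
move=> [f1 f2]; apply: complex_eqP; rewrite ?Re_conjc ?Im_conjc /=.
  by under eq_Rintegral do rewrite Re_conjc.
under eq_Rintegral do rewrite Im_conjc -mulN1r.
by rewrite RintegralZl// mulN1r.
Qed.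

(** After rotation by a unimodular constant the integral is real, hence the integral of a real part,
    which is pointwise at most the modulus. *)
Lemma le_normc_cint f : cintegrable f ->
  ((normc (cint f))%:E <= \int[mu]_x (normc (f x))%:E)%E.
Proof.
move=> cf; have [u u1 uf] := unimodular_rotation (cint f).
have -> : normc (cint f) = Re (cint (fun x => u * f x)) by rewrite cintZ// uf.
have cuf := cintegrableZ u cf.
have fin : (\int[mu]_x (normc (f x))%:E)%E \is a fin_num.
  by rewrite ge0_fin_numE ?cintegrable_lty// integral_ge0// => x _; rewrite lee_fin normc_ge0.
rewrite -(fineK fin) lee_fin; apply: le_Rintegral => //.
- by case: cuf.
- exact: cintegrable_normc.
- by move=> x _; rewrite (le_trans (Re_le_normc _))// Normc.normcM u1 mul1r.
Qed.

Lemma cint_real (u : T -> R) : cint (fun x => (u x)%:C%C) = (\int[mu]_x u x)%:C%C.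
Proof. by apply: complex_eqP => //=; rewrite /Rintegral integral0. Qed.

End complex_integration.

(** * Measure-preserving changes of variables *)

Section pushforward_measures.
Context d d' (T : measurableType d) (T' : measurableType d') (R : realType).
Variables (mu : {measure set T -> \bar R}) (h : T -> T').
Hypothesis mh : measurable_fun setT h.

(** The pushforward bundled with its measure structure, the form expected by the uniqueness results
    for Lebesgue measure. *)
Definition pushm : {measure set T' -> \bar R} :=
  measure_function_pushforward__canonical__measure_function_Measure mu mh.

End pushforward_measures.

Section measure_preserving_maps.
Context d d' (T : measurableType d) (T' : measurableType d') (R : realType).
Variables (mu : {measure set T -> \bar R}) (mu' : {measure set T' -> \bar R}).
Variable h : T -> T'.

Definition measure_preserving := measurable_fun setT h /\
  forall A, measurable A -> mu (h @^-1` A) = mu' A.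

Hypothesis hmp : measure_preserving.

Let mp_ge0_integral (f : T' -> \bar R) : measurable_fun setT f ->
  (forall x, 0 <= f x)%E -> (\int[mu]_x f (h x) = \int[mu']_y f y)%E.
Proof.
case: hmp => mh hE mf f0.
transitivity (\int[pushforward mu h]_y f y)%E.
  by rewrite ge0_integral_pushforward.
by apply: eq_measure_integral => A mA _; exact: hE.
Qed.

(** Positive and negative parts are nonnegative functions, each transported through the pushforward
    measure. *)
Lemma mp_integral (f : T' -> \bar R) : measurable_fun setT f ->
  (\int[mu]_x f (h x) = \int[mu']_y f y)%E.
Proof.
move=> mf; rewrite integralE [RHS]integralE; congr (_ - _)%E.
  rewrite -(@mp_ge0_integral (funepos f)).
  - by apply: eq_integral => x _; rewrite !funeposE.
  - exact: measurable_funepos.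
  - by move=> x; exact: funepos_ge0.
rewrite -(@mp_ge0_integral (funeneg f)).
- by apply: eq_integral => x _; rewrite !funenegE.
- exact: measurable_funeneg.
- by move=> x; exact: funeneg_ge0.
Qed.

Lemma mp_cint (f : T' -> R[i]) : cmeas f ->
  cint mu (fun x => f (h x)) = cint mu' f.
Proof.
move=> [mf1 mf2]; apply: complex_eqP => /=; congr fine.
  by rewrite -(mp_integral (f := EFin \o (fun x => Re (f x))))//; exact/measurable_EFinP.
by rewrite -(mp_integral (f := EFin \o (fun x => Im (f x))))//; exact/measurable_EFinP.
Qed.

Lemma mp_integrable (f : T' -> \bar R) : mu'.-integrable setT f ->
  mu.-integrable setT (fun x => f (h x)).
Proof.
case: (hmp) => mh _ /integrableP[mf fi]; apply/integrableP; split.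
  exact: (measurableT_comp mf mh).
rewrite (mp_integral (f := fun x => `|f x|%E))//.
exact: measurableT_comp.
Qed.

Lemma mp_cintegrable (f : T' -> R[i]) : cintegrable mu' f ->
  cintegrable mu (fun x => f (h x)).
Proof. by move=> [f1 f2]; split; [apply: (mp_integrable f1)|apply: (mp_integrable f2)]. Qed.

Lemma mp_ae (P : T' -> Prop) : {ae mu', forall y, P y} -> {ae mu, forall x, P (h x)}.
Proof.
case: hmp => mh hE [N [mN N0 sN]]; exists (h @^-1` N); split.
- by rewrite -[X in measurable X]setTI; exact: mh.
- by rewrite hE.
- by move=> x /= nP; apply: sN.
Qed.

End measure_preserving_maps.

Section ae_complex.
Context d (T : measurableType d) (R : realType) (mu : {measure set T -> \bar R}).

Lemma ae_eq_cint (f g : T -> R[i]) : cmeas f -> cmeas g ->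
  {ae mu, forall x, f x = g x} -> cint mu f = cint mu g.
Proof.
move=> [f1 f2] [g1 g2] fg; apply: complex_eqP => /=; congr fine.
  apply: ae_eq_integral => //; [exact/measurable_EFinP|exact/measurable_EFinP|].
  by apply: filterS fg => x /= ->.
apply: ae_eq_integral => //; [exact/measurable_EFinP|exact/measurable_EFinP|].
by apply: filterS fg => x /= ->.
Qed.

End ae_complex.

(** * Fubini's theorem for complex integrals *)

Section complex_Fubini.
Context d d' (T : measurableType d) (T' : measurableType d') (R : realType).
Variables (m1 : {sigma_finite_measure set T -> \bar R}).
Variables (m2 : {sigma_finite_measure set T' -> \bar R}).
Variable f : T * T' -> R[i].
Hypothesis mf : cmeas f.
Hypothesis fi : (\int[m1]_x \int[m2]_y (normc (f (x, y)))%:E < +oo)%E.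
Hypothesis f1 : forall x, cintegrable m2 (fun y => f (x, y)).

Lemma cintegrable_prod : cintegrable (m1 \x m2)%E f.
Proof.
apply: cintegrableP => //.
rewrite (fubini_tonelli1 (fun z => (normc (f z))%:E))//.
- exact/measurable_EFinP/measurable_normc.
- by move=> x; rewrite lee_fin normc_ge0.
Qed.

(** [Rintegral] applies [fine] to an extended integral. Since every slice is integrable, [fine]
    loses nothing at any point and the integrands agree pointwise. *)
Let R12 (u : T * T' -> R) : (m1 \x m2)%E.-integrable setT (EFin \o u) ->
  (forall x, m2.-integrable setT (fun y => (u (x, y))%:E)) ->
  \int[m1]_x \int[m2]_y u (x, y) = \int[(m1 \x m2)%E]_z u z.
Proof.
move=> iu u1; rewrite /Rintegral -(integral12_prod_meas1 iu); congr fine.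
apply: eq_integral => x _; rewrite /fubini_F fineK//.
by apply: integrable_fin_num => //; exact: u1.
Qed.

Lemma cint_prod1 : cint m1 (fun x => cint m2 (fun y => f (x, y))) =
  cint (m1 \x m2)%E f.
Proof.
have [i1 i2] := cintegrable_prod.
apply: complex_eqP => /=.
  by rewrite (R12 (u := fun z => Re (f z)))// => x; case: (f1 x).
by rewrite (R12 (u := fun z => Im (f z)))// => x; case: (f1 x).
Qed.

Lemma cmeas_cint2 : cmeas (fun x => cint m2 (fun y => f (x, y))).
Proof.
have [i1 i2] := cintegrable_prod.
split; apply/measurable_EFinP.
  apply: eq_measurable_fun (measurable_fubini_F i1) => x _.
  by rewrite /fubini_F /= /Rintegral fineK//; apply: integrable_fin_num => //; case: (f1 x).
apply: eq_measurable_fun (measurable_fubini_F i2) => x _.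
by rewrite /fubini_F /= /Rintegral fineK//; apply: integrable_fin_num => //; case: (f1 x).
Qed.

Hypothesis f2 : forall y, cintegrable m1 (fun x => f (x, y)).

Let R21 (u : T * T' -> R) : (m1 \x m2)%E.-integrable setT (EFin \o u) ->
  (forall y, m1.-integrable setT (fun x => (u (x, y))%:E)) ->
  \int[m2]_y \int[m1]_x u (x, y) = \int[(m1 \x m2)%E]_z u z.
Proof.
move=> iu u2; rewrite /Rintegral -(integral21_prod_meas1 iu); congr fine.
apply: eq_integral => x _; rewrite /fubini_G fineK//.
by apply: integrable_fin_num => //; exact: u2.
Qed.

Lemma cint_Fubini : cint m1 (fun x => cint m2 (fun y => f (x, y))) =
  cint m2 (fun y => cint m1 (fun x => f (x, y))).
Proof.
rewrite cint_prod1; have [i1 i2] := cintegrable_prod.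
apply: complex_eqP => /=.
  by rewrite (R21 (u := fun z => Re (f z)))// => x; case: (f2 x).
by rewrite (R21 (u := fun z => Im (f z)))// => x; case: (f2 x).
Qed.

End complex_Fubini.

(** * Lebesgue measure on R^n *)

Section lebesgue_rV_properties.
Context (R : realType).
Local Notation mu := (@lebesgue_measure R).
Local Notation leb := (@lebesgue_rV R).

Definition rVbox n (A : 'I_n -> set R) : set 'rV[R]_n :=
  [set x | forall i, A i (x ord0 i)].

Lemma lebesgue_rVbox n (A : 'I_n -> set R) : (forall i, measurable (A i)) ->
  leb n (rVbox A) = (\prod_(i < n) mu (A i))%E.
Proof. exact: lebesgue_rV_box. Qed.

Lemma measurable_rVbox n (A : 'I_n -> set R) : (forall i, measurable (A i)) ->
  measurable (rVbox A).
Proof. exact: measurable_box_rV. Qed.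

Lemma measurable_rV_generated n (G : set (set 'rV[R]_n)) :
  (forall i (B : set R), measurable B ->
    <<s G >> ((fun x : 'rV[R]_n => x ord0 i) @^-1` B)) ->
  @measurable _ 'rV[R]_n `<=` <<s G >>.
Proof.
move=> GB; apply: smallest_sub; first exact: smallest_sigma_algebra.
move=> A; rewrite -bigcup_seq => -[i _ [B mB <-]]; rewrite setTI; exact: GB.
Qed.

(** Boxes are closed under intersection and generate the sigma-algebra, and the boxes with all sides
    [-k, k] exhaust the space with finite measure; so measures that agree on boxes coincide. *)
Lemma lebesgue_rV_unique n (m : {measure set 'rV[R]_n -> \bar R}) :
  (forall A : 'I_n -> set R, (forall i, measurable (A i)) ->
    m (rVbox A) = (\prod_(i < n) mu (A i))%E) ->
  forall E, measurable E -> m E = leb n E.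
Proof.
move=> mE; pose G := [set B | exists2 A : 'I_n -> set R,
  (forall i, measurable (A i)) & B = rVbox A].
pose I (k : nat) : set R := `[- k%:R, k%:R]%classic.
pose g (k : nat) : set 'rV[R]_n := rVbox (fun=> I k).
have Gm : G `<=` measurable.
  by move=> _ [A mA ->]; exact: measurable_box_rV.
apply: (measure_unique G g).
- apply/seteqP; split; last first.
    by apply: smallest_sub; [exact: sigma_algebra_measurable|exact: Gm].
  (* A cylinder over one coordinate is a box whose other sides are full lines. *)
  apply: measurable_rV_generated => i B mB; apply: sub_sigma_algebra.
  exists (fun j => if j == i then B else setT).
    by move=> j; case: ifP.
  apply/seteqP; split => x /= xB; last by have := xB i; rewrite eqxx.
  by move=> j; case: eqP => // ->.
- move=> _ _ [A mA ->] [B mB ->]; exists (fun i => A i `&` B i).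
    by move=> i; exact: measurableI.
  apply/seteqP; split => x /= => [[xA xB] i|xAB]; first by split.
  by split => i; case: (xAB i).
- by move=> k; exists (fun=> I k) => // i; exact: measurable_itv.
- rewrite -subTset => x _.
  (* Rounding up the sum of the moduli bounds all coordinates at once; this witness recurs below. *)
  exists (Num.truncn (\sum_i `|x ord0 i|)).+1 => // i; rewrite /I /= in_itv /= -ler_norml.
  rewrite (@le_trans _ _ (\sum_i `|x ord0 i|))//.
    by rewrite (bigD1 i)//= lerDl sumr_ge0.
  by rewrite ltW// truncnS_gt.
- by move=> _ [A mA ->]; rewrite mE//; exact/esym/lebesgue_rVbox.
- move=> k; rewrite mE; last by move=> i; exact: measurable_itv.
  suff : (\prod_(i < n) mu (I k))%E \is a fin_num.
    by move=> /fin_numPlt/andP[].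
  apply: (big_ind (fun x : \bar R => x \is a fin_num)) => // [x y|i _]; first exact: fin_numM.
  by rewrite /I lebesgue_measure_itv /=; case: ifP.
Qed.

Lemma lebesgue_measure_shift (x : R) (A : set R) : measurable A ->
  mu ((fun t => t + x) @^-1` A) = mu A.
Proof.
move=> mA; have mh : measurable_fun setT (fun t : measurableTypeR R => (t + x : measurableTypeR R)).
  by apply: measurable_funD.
rewrite -[LHS]/(pushm mu mh A).
apply/esym/lebesgue_measure_unique => // _ [[a b] ab <-] /=.
rewrite /pushforward (_ : _ @^-1` _ = `]a - x, b - x]%classic); last first.
  by apply/seteqP; split => t /=; rewrite !in_itv/= ltrBlDr lerBrDr.
rewrite !lebesgue_measure_itv/= !lte_fin ltrD2r; case: ifP => // _.
by rewrite -!EFinB; congr EFin; ring.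
Qed.

Lemma mp_shift n (x : 'rV[R]_n) :
  measure_preserving (leb n) (leb n) (fun t => t + x).
Proof.
have mh : measurable_fun setT (fun t : 'rV[R]_n => t + x).
  apply/measurable_fun_coordP => i.
  under eq_fun do rewrite mxE.
  by apply: measurable_funD => //; exact: measurable_coord.
split => // A mA.
apply: (lebesgue_rV_unique (m := pushm (leb n) mh)) => // B mB.
rewrite /= /pushforward (_ : _ @^-1` _ = rVbox (fun i => (fun t => t + x ord0 i) @^-1` B i)).
  rewrite lebesgue_rVbox => [|i].
    by apply: eq_bigr => i _; rewrite lebesgue_measure_shift.
  by rewrite -[X in measurable X]setTI; apply: measurable_funD.
by apply/seteqP; split => t /= tB i; have := tB i; rewrite mxE.
Qed.

Lemma measurable_row_mx m n : measurable_fun setT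
  (fun p : 'rV[R]_m * 'rV[R]_n => row_mx p.1 p.2).
Proof.
apply/measurable_fun_coordP => i.
case: (split_ordP i) => j ->.
  under eq_fun do rewrite row_mxEl.
  exact: (measurableT_comp (measurable_coord j) measurable_fst).
under eq_fun do rewrite row_mxEr.
exact: (measurableT_comp (measurable_coord j) measurable_snd).
Qed.

Lemma mp_row_mx m n : measure_preserving (leb m \x leb n)%E (leb (m + n))
  (fun p => row_mx p.1 p.2).
Proof.
have mh := @measurable_row_mx m n.
split => // A mA.
apply: (lebesgue_rV_unique (m := pushm (leb m \x leb n)%E mh)) => // B mB.
rewrite /= /pushforward (_ : _ @^-1` _ =
    rVbox (fun i => B (lshift n i)) `*` rVbox (fun i => B (rshift m i))).
  rewrite product_measure1E//; [|exact: measurable_rVbox|exact: measurable_rVbox].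
  by rewrite big_split_ord/= !lebesgue_rV_box.
apply/seteqP; split => -[x y] /=.
  move=> xyB; split => i; first by have := xyB (lshift n i); rewrite row_mxEl.
  by have := xyB (rshift m i); rewrite row_mxEr.
move=> [xB yB] i; case: (split_ordP i) => j ->; first by rewrite row_mxEl; exact: xB.
by rewrite row_mxEr; exact: yB.
Qed.

Lemma mp_cons_rV n : measure_preserving (mu \x leb n)%E (leb n.+1) (@cons_rV R n).
Proof. by split; [exact: measurable_cons_rV|]. Qed.

End lebesgue_rV_properties.

Section improper_FTC.
Context (R : realType).
Local Notation mu := (@lebesgue_measure R).

(** The fundamental theorem of calculus on [-n, n] leaves boundary values that vanish in the limit,
    and dominated convergence identifies the limit of the truncated integrals. *)
Lemma integral_derivative_eq0 (G g : R -> R) :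
  (forall x : R, is_derive x (1 : R) G (g x)) -> continuous g ->
  mu.-integrable setT (EFin \o g) ->
  G n%:R @[n --> \oo] --> 0 -> G (- n%:R) @[n --> \oo] --> 0 ->
  \int[mu]_x g x = 0.
Proof.
move=> Gg cg ig G1 G2.
have cG : continuous G.
  move=> x; apply: differentiable_continuous; apply/derivable1_diffP.
  by case: (Gg x).
pose I (n : nat) : set R := `[- n%:R, n%:R]%classic.
have IE n : (0 < n)%N -> (\int[mu]_(x in I n) (g x)%:E)%E = (G n%:R - G (- n%:R))%:E.
  move=> n0; rewrite EFinB; apply: continuous_FTC2.
  - by rewrite gtrN// ltr0n.
  - exact: continuous_subspaceT.
  - split.
    + by move=> x _; case: (Gg x).
    + by apply: cvg_at_right_filter; exact: cG.
    + by apply: cvg_at_left_filter; exact: cG.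
  - by move=> x _; rewrite derive1E; apply: derive_val.
have mI n : measurable (I n) by exact: measurable_itv.
have cvI : (\int[mu]_(x in I n) (g x)%:E)%E @[n --> \oo] --> (\int[mu]_x (g x)%:E)%E.
  under eq_fun do rewrite integral_mkcond.
  apply: (@dominated_cvg _ _ _ mu setT measurableT
    (fun n => (EFin \o g) \_ (I n)) (EFin \o g) (fun x => `|g x|%:E)).
  - move=> n; apply/(measurable_restrictT _ _).1; first exact: mI.
    by apply: measurable_funTS; exact: measurable_int ig.
  - move=> x _; apply: cvg_near_cst; near=> n.
    rewrite patchE mem_set// /I /= in_itv/= -ler_norml.
    near: n; exact: nbhs_infty_ger.
  - by [].
  - exact: integrable_norm.
  - move=> n x _; rewrite patchE; case: ifPn => _ //=.
    by rewrite normr0 lee_fin.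
have cv0 : (\int[mu]_(x in I n) (g x)%:E)%E @[n --> \oo] --> 0%E.
  have : (G n%:R - G (- n%:R))%:E @[n --> \oo] --> 0%E.
    apply: cvg_EFin; first exact: nearW.
    by rewrite -[X in _ --> X](subrr (0:R)); exact: cvgB.
  apply: cvg_trans; apply: near_eq_cvg; near=> n; rewrite IE//.
  near: n; exact: nbhs_infty_gt.
by rewrite /Rintegral (cvg_unique _ cvI cv0).
Unshelve. all: by end_near.
Qed.

End improper_FTC.

(** * Gaussians and their Fourier transforms *)

Section gaussian_1d.
Context (R : realType).
Local Notation mu := (@lebesgue_measure R).

Definition expi (x : R) : R[i] := Complex (cos x) (sin x).

Lemma expiD x y : expi (x + y) = expi x * expi y.
Proof. by apply: complex_eqP; rewrite ?ReM ?ImM /= ?cosD ?sinD//; ring. Qed.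

Lemma expi0 : expi 0 = 1.
Proof. by rewrite /expi cos0 sin0. Qed.

Lemma normc_expi x : normc (expi x) = 1.
Proof. by rewrite normcE /= cos2Dsin2 sqrtr1. Qed.

Lemma conjc_expi x : conjc (expi x) = expi (- x).
Proof. by rewrite /expi /= cosN sinN. Qed.

Lemma measurable_cos : measurable_fun setT (@cos R).
Proof. by apply: continuous_measurable_fun; exact: continuous_cos. Qed.

Lemma measurable_sin : measurable_fun setT (@sin R).
Proof. by apply: continuous_measurable_fun; exact: continuous_sin. Qed.

Lemma measurable_fun_cos d (T : measurableType d) (u : T -> R) :
  measurable_fun setT u -> measurable_fun setT (fun x => cos (u x)).
Proof. by move=> mu'; exact: (measurableT_comp measurable_cos mu'). Qed.

Lemma measurable_fun_sin d (T : measurableType d) (u : T -> R) :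
  measurable_fun setT u -> measurable_fun setT (fun x => sin (u x)).
Proof. by move=> mu'; exact: (measurableT_comp measurable_sin mu'). Qed.

Lemma cmeas_expi d (T : measurableType d) (u : T -> R) : measurable_fun setT u ->
  cmeas (fun x => expi (u x)).
Proof.
move=> mu'; split => /=; first exact: (measurableT_comp measurable_cos mu').
exact: (measurableT_comp measurable_sin mu').
Qed.

Variable a : R.
Hypothesis a0 : 0 < a.

Let pia_gt0 : 0 < pi * a. Proof. by rewrite mulr_gt0// pi_gt0. Qed.

(** With [pi] in the exponent the Fourier transform exchanges, up to a constant, the parameters [a]
    and [1 / a]; [a = 1] is the window of [feichtinger]. *)
Definition gauss1 (c t : R) := expR (- (pi * a * (t - c) ^+ 2)).

Lemma measurable_gauss1 c : measurable_fun setT (gauss1 c).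
Proof.
apply: measurableT_comp => //; apply: measurableT_comp => //.
apply: measurable_funM => //; apply: measurable_funX; exact: measurable_funB.
Qed.

Lemma integral_gauss1 c : (\int[mu]_t (gauss1 c t)%:E = ((Num.sqrt a)^-1)%:E)%E.
Proof.
(* The variance [1 / (2 pi a)] makes the normal density equal to [sqrt a] times [gauss1 a c]. *)
pose s := Num.sqrt ((pi * a *+ 2)^-1).
have ss : s ^+ 2 = (pi * a *+ 2)^-1.
  by rewrite sqr_sqrtr// invr_ge0 mulrn_wge0// ltW.
have s0 : s != 0 by rewrite gt_eqF// sqrtr_gt0 invr_gt0 mulrn_wgt0.
have := integral_normal_pdf c s; rewrite normal_pdfE//.
have -> : normal_peak s = Num.sqrt a.
  rewrite /normal_peak ss -sqrtrV; last first.
    by rewrite mulrn_wge0// mulr_ge0 ?pi_ge0// invr_ge0 mulrn_wge0// ltW.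
  congr Num.sqrt; move: (pi : R) (pi_gt0 R) => p p0; field.
  by rewrite (gt_eqF a0) (gt_eqF p0).
under eq_integral do rewrite EFinM.
rewrite (ge0_integralZl _ measurableT); first last.
- by rewrite lee_fin sqrtr_ge0.
- by move=> x _; rewrite lee_fin normal_fun_ge0.
- by apply/measurable_EFinP; exact: measurable_normal_fun.
rewrite (_ : (fun x => _) = (fun t => (gauss1 c t)%:E)) => [|]; last first.
  apply/funext => t; rewrite /normal_fun /gauss1 ss; congr (expR _)%:E.
  move: (pi : R) (pi_gt0 R) => p p0; field.
  by rewrite (gt_eqF a0) (gt_eqF p0).
move=> h; apply/esym/eqP; rewrite -[X in X == _]mule1 eqe_pdivrMl ?h//.
by rewrite gt_eqF// sqrtr_gt0.
Qed.

Lemma integrable_gauss1 c : mu.-integrable setT (EFin \o gauss1 c).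
Proof.
apply/integrableP; split; first by apply/measurable_EFinP; exact: measurable_gauss1.
under eq_integral do rewrite /= ger0_norm ?expR_ge0//.
by rewrite integral_gauss1 ltry.
Qed.

End gaussian_1d.

Section gaussian_Fourier_1d.
Context (R : realType) (a : R).
Hypothesis a0 : 0 < a.
Local Notation mu := (@lebesgue_measure R).
Local Notation g := (gauss1 a 0).

Let pia_gt0 : 0 < pi * a. Proof. by rewrite mulr_gt0// pi_gt0. Qed.

Let gE t : g t = expR (- (pi * a * t ^+ 2)).
Proof. by rewrite /gauss1 subr0. Qed.

Let is_derive_g t : is_derive t (1 : R) (fun t => g t) (- (2 * pi * a) * t * g t).
Proof.
under eq_fun do rewrite gE.
apply: is_derive_eq; rewrite gE /GRing.scale /=; ring.
Qed.

(** Up to the factor [2 pi], a bound uniform in [w] for the [w]-derivative of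
    [g t * cos (2 pi w t)], as differentiation under the integral sign requires. *)
Let moment t := `|t| * g t.

(** Chosen for the inequality [1 + x <= expR x] at [x = pi (a / 2) t^2]: the factor [4 / (pi a)]
    turns [x] into [2 t^2], and [|t| <= 1 + 2 t^2]. *)
Let K : R := 1 + 4 / (pi * a).

(** Half of the exponent absorbs the factor [|t|]; the other half remains as an integrable
    Gaussian. *)
Let moment_ub t : moment t <= K * expR (- (pi * (a / 2) * t ^+ 2)).
Proof.
have e : g t = expR (- (pi * (a / 2) * t ^+ 2)) * expR (- (pi * (a / 2) * t ^+ 2)).
  by rewrite gE -expRD; congr expR; field.
set E := expR _ in e *.
have E0 : 0 < E by exact: expR_gt0.
rewrite /moment e mulrA ler_wpM2r ?(ltW E0)//.
rewrite /E expRN ler_pdivrMr ?expR_gt0//.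
have t2 : 0 <= t ^+ 2 by exact: sqr_ge0.
have h : 1 + pi * (a / 2) * t ^+ 2 <= expR (pi * (a / 2) * t ^+ 2) by exact: expR_ge1Dx.
have K0 : 0 <= K by rewrite addr_ge0// divr_ge0// ltW.
apply: le_trans (ler_wpM2l K0 h).
have -> : K * (1 + pi * (a / 2) * t ^+ 2) =
    1 + 4 / (pi * a) + (pi * a) * t ^+ 2 / 2 + 2 * t ^+ 2.
  by rewrite /K; move: (pi : R) (pi_gt0 R) => p p0; field; rewrite (gt_eqF a0) (gt_eqF p0).
have : 0 <= 4 / (pi * a) by rewrite divr_ge0// ltW.
have : 0 <= pi * a * t ^+ 2 / 2 by rewrite divr_ge0// mulr_ge0// ltW.
have := ler_norm t; have : `|t| ^+ 2 = t ^+ 2 by rewrite real_normK// num_real.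
move: (_ / _) (_ / 2) => u v; move: (normr_ge0 t); nra.
Qed.

Let integrable_moment : mu.-integrable setT (EFin \o moment).
Proof.
have a2 : 0 < a / 2 by rewrite divr_gt0.
apply: (le_integrable measurableT _ _ (integrableZl measurableT K (integrable_gauss1 a2 0))).
- apply/measurable_EFinP; apply: measurable_funM; first exact: normr_measurable.
  exact: measurable_gauss1.
- move=> t _; rewrite /= lee_fin ger0_norm; last by rewrite mulr_ge0// expR_ge0.
  apply: le_trans (ler_norm _); apply: le_trans (moment_ub t) _.
  by rewrite /gauss1 subr0.
Qed.

Let F (w : R) : R := \int[mu]_t (g t * cos (2 * pi * w * t)).

Let integrable_gcos w : mu.-integrable setT (EFin \o (fun t => g t * cos (2 * pi * w * t))).
Proof.
apply: (le_integrable measurableT _ _ (integrable_gauss1 a0 0)).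
- apply/measurable_EFinP; apply: measurable_funM; first exact: measurable_gauss1.
  by apply: measurable_fun_cos; exact: measurable_funM.
- move=> t _; rewrite /= lee_fin normrM ler_piMr// cos_max//.
Qed.

Let integrable_gsin w : mu.-integrable setT (EFin \o (fun t => g t * sin (2 * pi * w * t))).
Proof.
apply: (le_integrable measurableT _ _ (integrable_gauss1 a0 0)).
- apply/measurable_EFinP; apply: measurable_funM; first exact: measurable_gauss1.
  by apply: measurable_fun_sin; exact: measurable_funM.
- move=> t _; rewrite /= lee_fin normrM ler_piMr// sin_max//.
Qed.

Let integrable_tgsin w :
  mu.-integrable setT (EFin \o (fun t => t * g t * sin (2 * pi * w * t))).
Proof.
apply: (le_integrable measurableT _ _ integrable_moment).
- apply/measurable_EFinP; apply: measurable_funM.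
    by apply: measurable_funM => //; exact: measurable_gauss1.
  by apply: measurable_fun_sin; exact: measurable_funM.
- move=> t _; rewrite /= lee_fin /moment !normrM normr_id ler_piMr// ?sin_max//.
Qed.

Let is_derive_gcos w t :
  is_derive w (1 : R) (fun w => g t * cos (2 * pi * w * t)) (- (2 * pi) * (t * g t * sin (2 * pi * w * t))).
Proof.
apply: is_derive_eq; rewrite /GRing.scale /=; ring.
Qed.

Let derive_F w : is_derive w (1 : R) F (- (2 * pi) * \int[mu]_t (t * g t * sin (2 * pi * w * t))).
Proof.
pose f (w t : R) := g t * cos (2 * pi * w * t).
have wI : (`]w - 1, w + 1[%classic : set R) w by rewrite /= in_itv/= gtrDl ltrDl ltrN10 ltr01.
have d1 v t : partial1of2 f v t = - (2 * pi) * (t * g t * sin (2 * pi * v * t)).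
  by rewrite partial1of2E; case: (is_derive_gcos v t).
have i1 v : `]w - 1, w + 1[%classic v -> mu.-integrable setT (EFin \o f v).
  by move=> _; exact: integrable_gcos.
have i2 v t : `]w - 1, w + 1[%classic v -> setT t -> derivable (f ^~ t) v 1.
  by move=> _ _; case: (is_derive_gcos v t).
have i3 t : 0 <= 2 * pi * moment t.
  by rewrite !mulr_ge0 ?pi_ge0// expR_ge0.
have i4 : mu.-integrable setT (EFin \o (fun t => 2 * pi * moment t)).
  exact: (integrableZl measurableT (2 * pi) integrable_moment).
have i5 v t : `]w - 1, w + 1[%classic v -> setT t -> `|partial1of2 f v t| <= 2 * pi * moment t.
  move=> _ _; rewrite d1 /moment !normrM normrN normrM (ger0_norm (pi_ge0 R)) ger0_norm// -!mulrA.
  rewrite ler_pM2l// ler_pM2l ?pi_gt0//.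
  by rewrite ler_wpM2l// (ger0_norm (expR_ge0 _)) ler_piMr ?sin_max// expR_ge0.
apply: DeriveDef; first exact: (derivable_under_integral measurableT wI i1 i2 i3 i4 i5).
rewrite -derive1E (differentiation_under_integral measurableT wI i1 i2 i3 i4 i5).
under eq_Rintegral do rewrite d1.
by rewrite RintegralZl.
Qed.

(** Integration by parts: [h] is the derivative of [g t * sin (2 pi w t)], which tends to 0 at both
    ends, so [h] has integral 0. *)
Let FTC_relation w :
  2 * pi * w * F w = 2 * pi * a * \int[mu]_t (t * g t * sin (2 * pi * w * t)).
Proof.
pose h (t : R) := - (2 * pi * a) * (t * g t * sin (2 * pi * w * t)) + 2 * pi * w * (g t * cos (2 * pi * w * t)).
have dh (t : R) : is_derive t (1 : R) (fun t => g t * sin (2 * pi * w * t)) (h t).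
  have dg := is_derive_g t.
  by apply: is_derive_eq; rewrite /h /GRing.scale /=; ring.
have cg : continuous g.
  move=> t; apply: differentiable_continuous; apply/derivable1_diffP.
  by case: (is_derive_g t).
have csc (u : R -> R) : continuous u -> continuous (fun t => u (2 * pi * w * t)).
  move=> cu t; apply: continuous_comp; last exact: cu.
  by apply: cvgMl_tmp; exact: cvg_id.
have ch : continuous h.
  move=> t; apply: cvgD; apply: cvgMl_tmp; apply: cvgM.
  - by apply: cvgM; [exact: cvg_id|exact: cg].
  - by apply: csc; exact: continuous_sin.
  - exact: cg.
  - by apply: csc; exact: continuous_cos.
have i1 := integrableZl measurableT (- (2 * pi * a)) (integrable_tgsin w).
have i2 := integrableZl measurableT (2 * pi * w) (integrable_gcos w).
have ih : mu.-integrable setT (EFin \o h) by exact: (integrableD measurableT i1 i2).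
have gn (t : R) : 1 <= t -> g t <= expR (- (pi * a * t)).
  by move=> t1; rewrite gE ler_expR lerN2 ler_pM2l// expr2 ler_peMl// (le_trans _ t1).
have gN (t : R) : g (- t) = g t by rewrite !gE sqrrN.
have lim0 : expR (- (pi * a * n%:R)) @[n --> \oo] --> (0 : R).
  apply: (cvg_comp (fun n : nat => pi * a * n%:R) (fun x => expR (- x))); last exact: cvgr_expR.
  exact: (cvg_comp _ _ cvgr_idn (gt0_cvgMry pia_gt0 cvg_id)).
have sq (s : nat -> R) : (forall n, `|s n| <= g n%:R) -> s n @[n --> \oo] --> (0 : R).
  move=> sg; apply/norm_cvg0P; apply: (squeeze_cvgr _ (cvg_cst 0) lim0).
  near=> n; rewrite normr_ge0/= (le_trans (sg n))// gn//.
  by rewrite ler1n; near: n; exact: nbhs_infty_gt.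
have := integral_derivative_eq0 dh ch ih.
rewrite RintegralD// ?RintegralZl//.
rewrite -/(F w) => e.
apply/eqP; rewrite -subr_eq0 addrC -mulNr; apply/eqP; apply: e; apply: sq.
- by move=> n; rewrite normrM (ger0_norm (expR_ge0 _)) ler_piMr ?expR_ge0// sin_max.
- by move=> n; rewrite normrM gN (ger0_norm (expR_ge0 _)) ler_piMr ?expR_ge0// sin_max.
Unshelve. all: by end_near.
Qed.

(** [derive_F] and [FTC_relation] combine into F' = - (2 pi w / a) F, so F times [expR (pi w^2 / a)]
    is constant; its value at 0 is the Gaussian integral. *)
Let F_eq w : F w = (Num.sqrt a)^-1 * expR (- (pi / a * w ^+ 2)).
Proof.
pose H (w : R) : R := F w * expR (pi / a * w ^+ 2).
have dH (v : R) : is_derive v (1 : R) H 0.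
  have dF := derive_F v.
  apply: is_derive_eq; rewrite /GRing.scale /=.
  set S := \int[mu]_t _.
  have -> : S = v * F v / a.
    have := FTC_relation v; rewrite -/S => h.
    have pa0 : 2 * pi * a != 0 :> R by rewrite -mulrA mulf_neq0// gt_eqF.
    apply: (mulfI pa0); rewrite -h; move: (pi : R) (F v) => p f; field.
    by rewrite gt_eqF.
  move: (pi : R) (F v) (expR _) => p f e; field.
  by rewrite gt_eqF.
have := is_derive_0_is_cst w 0 dH.
rewrite /H expr0n mulr0 expR0 mulr1 => /(canRL (mulfK (lt0r_neq0 (expR_gt0 _)))) ->.
rewrite -expRN; congr (_ * _).
rewrite /F /Rintegral; under eq_integral do rewrite mulr0 mul0r cos0 mulr1.
by rewrite integral_gauss1.
Qed.

Let mp_opp1 : measure_preserving mu mu (-%R : R -> R).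
Proof. by split => // A mA; exact: lebesgue_measureN. Qed.

(** The integrand is odd, and Lebesgue measure is invariant under negation. *)
Let sin_eq0 w : \int[mu]_t (g t * sin (2 * pi * w * t)) = 0.
Proof.
set S := LHS.
have mS : measurable_fun setT (EFin \o (fun t => g t * sin (2 * pi * w * t))).
  exact: measurable_int (integrable_gsin w).
have : S = - S.
  rewrite {1}/S /Rintegral.
  rewrite -(mp_integral mp_opp1 mS) -[RHS]mulN1r -RintegralZl//.
  congr fine; apply: eq_integral => t _ /=; congr EFin.
  by rewrite mulrN sinN !gE sqrrN; ring.
by move/eqP; rewrite -subr_eq0 opprK -mulr2n mulrn_eq0 => /eqP.
Qed.

Let mp_shift1 (c : R) : measure_preserving mu mu (fun t => t + c).
Proof.
by split => [|A mA]; [exact: measurable_funD|exact: lebesgue_measure_shift].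
Qed.

Lemma cintegrable_gauss1 c w :
  cintegrable mu (fun t => (gauss1 a c t)%:C%C * expi (2 * pi * w * t)).
Proof.
apply: (le_cintegrable _ _ (integrable_gauss1 a0 c)).
  apply: cmeasM; first by apply: cmeas_real; exact: measurable_gauss1.
  by apply: cmeas_expi; exact: measurable_funM.
by move=> t; rewrite Normc.normcM normc_expi mulr1 normc_real ger0_norm ?expR_ge0.
Qed.

(** Translation moves the centre to 0 at the price of a phase; there the real part is [F w] and the
    imaginary part vanishes. *)
Lemma cint_gauss1 c w :
  cint mu (fun t => (gauss1 a c t)%:C%C * expi (2 * pi * w * t)) =
  ((Num.sqrt a)^-1 * expR (- (pi / a * w ^+ 2)))%:C%C * expi (2 * pi * w * c).
Proof.
have [m1 m2] := cintegrable_gauss1 0 w.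
have m3 := cintegrable_cmeas (cintegrable_gauss1 c w).
rewrite -(mp_cint (mp_shift1 c) m3).
rewrite (_ : (fun t => _) = (fun t => expi (2 * pi * w * c) * ((g t)%:C%C * expi (2 * pi * w * t)))); last first.
  apply/funext => t; rewrite /gauss1 subr0 addrK mulrDr expiD.
  by rewrite [in LHS]mulrA [in LHS]mulrC.
rewrite cintZ; last exact: cintegrable_gauss1.
rewrite mulrC; congr (_ * _); apply: complex_eqP; rewrite /=.
  rewrite -F_eq; apply: eq_Rintegral => t _.
  by rewrite mul0r subr0.
rewrite -[RHS](sin_eq0 w); apply: eq_Rintegral => t _.
by rewrite mul0r addr0.
Qed.

End gaussian_Fourier_1d.

Section measurable_rV_operations.
Context (R : realType) (d : measure_display) (T : measurableType d).

Lemma measurable_funDrV n (u v : T -> 'rV[R]_n) : measurable_fun setT u ->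
  measurable_fun setT v -> measurable_fun setT (fun x => u x + v x).
Proof.
move=> /measurable_fun_coordP mu /measurable_fun_coordP mv.
apply/measurable_fun_coordP => i; under eq_fun do rewrite mxE.
exact: measurable_funD.
Qed.

Lemma measurable_funBrV n (u v : T -> 'rV[R]_n) : measurable_fun setT u ->
  measurable_fun setT v -> measurable_fun setT (fun x => u x - v x).
Proof.
move=> /measurable_fun_coordP mu /measurable_fun_coordP mv.
apply/measurable_fun_coordP => i; under eq_fun do rewrite !mxE.
exact: measurable_funB.
Qed.

Lemma measurable_funZrV n (a : R) (u : T -> 'rV[R]_n) : measurable_fun setT u ->
  measurable_fun setT (fun x => a *: u x).
Proof.
move=> /measurable_fun_coordP mu.
apply/measurable_fun_coordP => i; under eq_fun do rewrite !mxE.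
exact: measurable_funM.
Qed.

Lemma measurable_fun_lsubmx m n (u : T -> 'rV[R]_(m + n)) : measurable_fun setT u ->
  measurable_fun setT (fun x => lsubmx (u x)).
Proof.
move=> /measurable_fun_coordP mu.
by apply/measurable_fun_coordP => i; under eq_fun do rewrite !mxE; exact: mu.
Qed.

Lemma measurable_fun_rsubmx m n (u : T -> 'rV[R]_(m + n)) : measurable_fun setT u ->
  measurable_fun setT (fun x => rsubmx (u x)).
Proof.
move=> /measurable_fun_coordP mu.
by apply/measurable_fun_coordP => i; under eq_fun do rewrite !mxE; exact: mu.
Qed.

Lemma measurable_fun_dotrV n (u v : T -> 'rV[R]_n) : measurable_fun setT u ->
  measurable_fun setT v -> measurable_fun setT (fun x => dotrV (u x) (v x)).
Proof.
move=> /measurable_fun_coordP mu /measurable_fun_coordP mv.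
by apply: measurable_sum => i; exact: measurable_funM.
Qed.

End measurable_rV_operations.

Section dotrV_theory.
Context (R : realType) (n : nat).
Implicit Types x y : 'rV[R]_n.

Lemma dotrVC x y : dotrV x y = dotrV y x.
Proof. by apply: eq_bigr => i _; rewrite mulrC. Qed.

Lemma dotrVDl x x' y : dotrV (x + x') y = dotrV x y + dotrV x' y.
Proof. by rewrite -big_split; apply: eq_bigr => i _; rewrite mxE mulrDl. Qed.

Lemma dotrVDr x y y' : dotrV x (y + y') = dotrV x y + dotrV x y'.
Proof. by rewrite dotrVC dotrVDl !(dotrVC x). Qed.

Lemma dotrVNl x y : dotrV (- x) y = - dotrV x y.
Proof. by rewrite -sumrN; apply: eq_bigr => i _; rewrite mxE mulNr. Qed.

Lemma dotrVNr x y : dotrV x (- y) = - dotrV x y.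
Proof. by rewrite dotrVC dotrVNl dotrVC. Qed.

Lemma dotrVBl x x' y : dotrV (x - x') y = dotrV x y - dotrV x' y.
Proof. by rewrite dotrVDl dotrVNl. Qed.

Lemma dotrVBr x y y' : dotrV x (y - y') = dotrV x y - dotrV x y'.
Proof. by rewrite dotrVDr dotrVNr. Qed.

Lemma dotrV0l y : dotrV 0 y = 0.
Proof. by rewrite /dotrV big1// => i _; rewrite mxE mul0r. Qed.

Lemma dotrV0r x : dotrV x 0 = 0.
Proof. by rewrite dotrVC dotrV0l. Qed.

Lemma dotrV_ge0 x : 0 <= dotrV x x.
Proof. by apply: sumr_ge0 => i _; rewrite -expr2 sqr_ge0. Qed.

Lemma sqr_coord_le x i : x ord0 i ^+ 2 <= dotrV x x.
Proof.
rewrite /dotrV (bigD1 i)//= -expr2 lerDl sumr_ge0// => j _.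
by rewrite -expr2 sqr_ge0.
Qed.

End dotrV_theory.

Section gaussian_nd.
Context (R : realType).
Local Notation mu := (@lebesgue_measure R).
Local Notation leb := (@lebesgue_rV R).

Definition tail_rV n (t : 'rV[R]_n.+1) : 'rV[R]_n := \row_i t ord0 (lift ord0 i).

Lemma measurable_tail_rV n : measurable_fun setT (@tail_rV n).
Proof.
apply/measurable_fun_coordP => i; under eq_fun do rewrite mxE.
exact: measurable_coord.
Qed.

Lemma tail_rV_cons n x (v : 'rV[R]_n) : tail_rV (cons_rV (x, v)) = v.
Proof. by apply/rowP => i; rewrite mxE cons_rV_lift. Qed.

(** Fubini for a tensor product with the first coordinate split off; it is the induction step from
    Gaussians on the line to dimension [n]. *)
Lemma cint_head_tail n (f : R -> R[i]) (h : 'rV[R]_n -> R[i]) :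
  cintegrable mu f -> cintegrable (leb n) h ->
  cintegrable (leb n.+1) (fun t => f (t ord0 ord0) * h (tail_rV t)) /\
  cint (leb n.+1) (fun t => f (t ord0 ord0) * h (tail_rV t)) = cint mu f * cint (leb n) h.
Proof.
move=> fi hi.
have mf := cintegrable_cmeas fi; have mh := cintegrable_cmeas hi.
have mF : cmeas (fun t : 'rV[R]_n.+1 => f (t ord0 ord0) * h (tail_rV t)).
  apply: cmeasM; first exact: (cmeas_comp (measurable_coord ord0) mf).
  exact: (cmeas_comp (@measurable_tail_rV n) mh).
have mP : cmeas (fun z : R * 'rV[R]_n => f z.1 * h z.2).
  apply: cmeasM; first exact: (cmeas_comp measurable_fst mf).
  exact: (cmeas_comp measurable_snd mh).
have E (z : R * 'rV[R]_n) : f (cons_rV z ord0 ord0) * h (tail_rV (cons_rV z)) = f z.1 * h z.2.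
  by case: z => x v; rewrite cons_rV0 tail_rV_cons.
have finI : (\int[mu]_x \int[leb n]_y (normc (f x * h y))%:E < +oo)%E.
  under eq_integral => x _.
    under eq_integral => y _ do rewrite Normc.normcM EFinM.
    rewrite ge0_integralZl//; [|by apply/measurable_EFinP; exact: measurable_normc|
      by move=> y _; rewrite lee_fin normc_ge0|by rewrite lee_fin normc_ge0].
    over.
  have hfin : (\int[leb n]_y (normc (h y))%:E)%E \is a fin_num.
    by rewrite ge0_fin_numE ?cintegrable_lty// integral_ge0// => y _; rewrite lee_fin normc_ge0.
  rewrite -(fineK hfin) ge0_integralZr//; [|by apply/measurable_EFinP; exact: measurable_normc|
      by move=> y _; rewrite lee_fin normc_ge0|
      by rewrite lee_fin fine_ge0// integral_ge0// => y _; rewrite lee_fin normc_ge0].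
  have ffin : (\int[mu]_y (normc (f y))%:E)%E \is a fin_num.
    by rewrite ge0_fin_numE ?cintegrable_lty// integral_ge0// => y _; rewrite lee_fin normc_ge0.
  by rewrite -(fineK ffin) -EFinM ltry.
split.
  apply: cintegrableP => //.
  have mN := measurable_normc mF.
  rewrite -(mp_integral (@mp_cons_rV R n) (f := fun t => (normc (f (t ord0 ord0) * h (tail_rV t)))%:E))//; last first.
    by apply/measurable_EFinP.
  under eq_integral do rewrite E.
  rewrite fubini_tonelli1//; last by move=> z; rewrite lee_fin normc_ge0.
  by apply/measurable_EFinP; exact: measurable_normc.
rewrite -(mp_cint (@mp_cons_rV R n) mF).
under eq_cint do rewrite E.
rewrite -(cint_prod1 (m1 := mu) (m2 := leb n) mP finI) /=; last by move=> x; exact: (cintegrableZ (f x) hi).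
under eq_cint => x do rewrite cintZ// mulrC.
by rewrite cintZ// mulrC.
Qed.

Definition gaussd n (a : R) (c t : 'rV[R]_n) : R :=
  expR (- (pi * a * dotrV (t - c) (t - c))).

Lemma dotrV_head_tail n (x y : 'rV[R]_n.+1) :
  dotrV x y = x ord0 ord0 * y ord0 ord0 + dotrV (tail_rV x) (tail_rV y).
Proof.
rewrite /dotrV big_ord_recl; congr (_ + _).
by apply: eq_bigr => i _; rewrite !mxE.
Qed.

Lemma tail_rVB n (x y : 'rV[R]_n.+1) : tail_rV (x - y) = tail_rV x - tail_rV y.
Proof. by apply/rowP => i; rewrite !mxE. Qed.

Lemma gaussd_head_tail n a (c t : 'rV[R]_n.+1) :
  gaussd a c t = gauss1 a (c ord0 ord0) (t ord0 ord0) * gaussd a (tail_rV c) (tail_rV t).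
Proof.
rewrite /gaussd /gauss1 dotrV_head_tail tail_rVB -expRD; congr expR.
by rewrite !mxE; ring.
Qed.

Lemma gaussd_gt0 n a (c t : 'rV[R]_n) : 0 < gaussd a c t.
Proof. exact: expR_gt0. Qed.

Lemma gaussd_ge0 n a (c t : 'rV[R]_n) : 0 <= gaussd a c t.
Proof. exact: expR_ge0. Qed.

Lemma gaussd_sym n a (c t : 'rV[R]_n) : gaussd a c t = gaussd a t c.
Proof. by rewrite /gaussd -[c - t]opprB dotrVNl dotrVNr opprK. Qed.

Lemma gaussd_le1 n a (c t : 'rV[R]_n) : 0 <= a -> gaussd a c t <= 1.
Proof.
move=> a0; rewrite -[leRHS]expR0 ler_expR oppr_le0.
by rewrite !mulr_ge0 ?pi_ge0// dotrV_ge0.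
Qed.

Lemma measurable_gaussd d (T : measurableType d) n a (u v : T -> 'rV[R]_n) :
  measurable_fun setT u -> measurable_fun setT v ->
  measurable_fun setT (fun x => gaussd a (u x) (v x)).
Proof.
move=> mu' mv; apply: measurableT_comp => //; apply: measurableT_comp => //.
apply: measurable_funM => //.
by apply: measurable_fun_dotrV; exact: measurable_funBrV.
Qed.

(** Integrability and value are proved together because the induction step consumes both for the
    remaining coordinates. In dimension 0 the measure is a unit point mass. *)
Lemma gaussd_fourier n a (c w : 'rV[R]_n) : 0 < a ->
  cintegrable (leb n) (fun t => (gaussd a c t)%:C%C * expi (2 * pi * dotrV w t)) /\
  cint (leb n) (fun t => (gaussd a c t)%:C%C * expi (2 * pi * dotrV w t)) =
  ((Num.sqrt a)^-1 ^+ n * expR (- (pi / a * dotrV w w)))%:C%C * expi (2 * pi * dotrV w c).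
Proof.
move=> a0; elim: n => [|n IH] in c w *.
  have -> : (fun t => (gaussd a c t)%:C%C * expi (2 * pi * dotrV w t)) = (fun=> 1).
    apply/funext => t; rewrite /gaussd (thinmx0 t) (thinmx0 c) (thinmx0 w).
    by rewrite subr0 !dotrV0r !mulr0 oppr0 expR0 expi0 mulr1.
  have i1 (r : R) : (\int[leb 0]_x r%:E)%E = r%:E.
    by rewrite /= integral_cst//= diracT mule1.
  rewrite (thinmx0 w) (thinmx0 c) !dotrV0r !mulr0 oppr0 expR0 expi0 !mulr1 expr0.
  split.
    apply: cintegrableP; first exact: cmeas_cst.
    by rewrite i1 ltry.
  by apply: complex_eqP => /=; rewrite /Rintegral i1.
have [i1 e1] := IH (tail_rV c) (tail_rV w).
have E (t : 'rV[R]_n.+1) : (gaussd a c t)%:C%C * expi (2 * pi * dotrV w t) =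
    ((gauss1 a (c ord0 ord0) (t ord0 ord0))%:C%C * expi (2 * pi * w ord0 ord0 * t ord0 ord0)) *
    ((gaussd a (tail_rV c) (tail_rV t))%:C%C * expi (2 * pi * dotrV (tail_rV w) (tail_rV t))).
  rewrite gaussd_head_tail rmorphM/= dotrV_head_tail mulrDr expiD -!mulrA.
  by congr (_ * _); rewrite mulrCA; congr (_ * _); rewrite !mulrA.
have [i2 e2] := cint_head_tail (cintegrable_gauss1 a0 (c ord0 ord0) (w ord0 ord0)) i1.
split; first by apply: eq_cintegrable i2 => t; rewrite E.
under eq_cint do rewrite E.
rewrite e2 e1 cint_gauss1// !dotrV_head_tail (mulrDr (pi / a)) opprD expRD.
rewrite (mulrDr (2 * pi)) expiD -(mulrA (2 * pi)) -expr2 (exprS _ n) !rmorphM/=.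
by move: (expi _) (expi _) (_%:C%C) (_%:C%C) (_%:C%C) (_%:C%C) => u v p q r s; ring.
Qed.

Lemma integrable_gaussd n a (c : 'rV[R]_n) : 0 < a ->
  (leb n).-integrable setT (EFin \o gaussd a c).
Proof.
move=> a0; have [[h _] _] := gaussd_fourier c 0 a0.
apply: eq_integrable h => // t _ /=.
by rewrite dotrV0l mulr0 cos0 mulr1 mul0r subr0.
Qed.

Lemma integral_gaussd n a (c : 'rV[R]_n) : 0 < a ->
  (\int[leb n]_t (gaussd a c t)%:E = ((Num.sqrt a)^-1 ^+ n)%:E)%E.
Proof.
move=> a0; rewrite -(fineK (integrable_fin_num measurableT (integrable_gaussd c a0))).
congr EFin; have [_ /(congr1 (@complex.Re R))] := gaussd_fourier c 0 a0.
rewrite !dotrV0l !mulr0 oppr0 expR0 expi0 !mulr1 /= => <-.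
congr fine; apply: eq_integral => t _.
by rewrite dotrV0l mulr0 cos0 mulr1 mul0r subr0.
Qed.

(** Completing the square: the product is a Gaussian around the weighted mean of the centres, scaled
    by a Gaussian in their difference. *)
Lemma gaussd_mul n a b (p q t : 'rV[R]_n) : 0 < a -> 0 < b ->
  gaussd a p t * gaussd b q t = gaussd (a * b / (a + b)) p q *
    gaussd (a + b) ((a / (a + b)) *: p + (b / (a + b)) *: q) t.
Proof.
move=> a0 b0; rewrite -!expRD; congr expR; rewrite -!opprD -!mulrA -!mulrDr.
congr (- (pi * _)); rewrite /dotrV !mulr_sumr -!big_split /=.
apply: eq_bigr => i _; rewrite !mxE; field.
by rewrite gt_eqF// addr_gt0.
Qed.

End gaussian_nd.

(** * Integrals on products of Euclidean spaces *)

Section integrals_on_products.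
Context (R : realType).
Local Notation leb := (@lebesgue_rV R).

Lemma integrable_normr_fin d (T : measurableType d) (mu : {measure set T -> \bar R}) (u : T -> R) :
  mu.-integrable setT (EFin \o u) -> (\int[mu]_x `|u x|%:E)%E \is a fin_num.
Proof. by move=> ui; apply: integrable_fin_num => //; exact: integrable_norm. Qed.

Lemma integrable_split m n (u : 'rV[R]_m -> R) (v : 'rV[R]_n -> R) :
  (leb m).-integrable setT (EFin \o u) -> (leb n).-integrable setT (EFin \o v) ->
  (leb (m + n)).-integrable setT (fun z => (u (lsubmx z) * v (rsubmx z))%:E).
Proof.
move=> ui vi.
have /measurable_EFinP mu := measurable_int _ ui.
have /measurable_EFinP mv := measurable_int _ vi.
have mF : measurable_fun setT (fun z : 'rV[R]_(m + n) => u (lsubmx z) * v (rsubmx z)).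
  apply: measurable_funM.
    by apply: (measurableT_comp mu); exact: measurable_fun_lsubmx.
  by apply: (measurableT_comp mv); exact: measurable_fun_rsubmx.
apply/integrableP; split; first exact/measurable_EFinP.
rewrite -(mp_integral (mp_row_mx R m n) (f := fun z => `|(u (lsubmx z) * v (rsubmx z))%:E|%E)); last first.
  by apply: measurableT_comp => //; exact/measurable_EFinP.
under eq_integral do rewrite row_mxKl row_mxKr.
rewrite fubini_tonelli1//; last first.
  apply: measurableT_comp => //; apply/measurable_EFinP; apply: measurable_funM.
    exact: (measurableT_comp mu).
  exact: (measurableT_comp mv).
rewrite /fubini_F; under eq_integral => x _.
  under eq_integral => y _ do rewrite /= normrM EFinM.
  rewrite ge0_integralZl//; last by apply/measurable_EFinP; exact: measurableT_comp.
  over.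
rewrite -(fineK (integrable_normr_fin vi)) ge0_integralZr//.
- by rewrite -(fineK (integrable_normr_fin ui)) -EFinM ltry.
- by apply/measurable_EFinP; exact: measurableT_comp.
- by rewrite lee_fin fine_ge0// integral_ge0.
Qed.

Lemma cint_split m n (F : 'rV[R]_(m + n) -> R[i]) :
  cintegrable (leb (m + n)) F ->
  (forall x, cintegrable (leb n) (fun w => F (row_mx x w))) ->
  cint (leb (m + n)) F = cint (leb m) (fun x => cint (leb n) (fun w => F (row_mx x w))).
Proof.
move=> iF sF; have mF := cintegrable_cmeas iF.
have mF' : cmeas (fun z : 'rV[R]_m * 'rV[R]_n => F (row_mx z.1 z.2)).
  exact: (cmeas_comp (@measurable_row_mx R m n) mF).
rewrite -(mp_cint (mp_row_mx R m n) mF).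
rewrite -(cint_prod1 (m1 := leb m) (m2 := leb n) mF')//.
rewrite -(fubini_tonelli1 (fun z => (normc (F (row_mx z.1 z.2)))%:E)).
- rewrite (mp_integral (mp_row_mx R m n) (f := fun z => (normc (F z))%:E)).
    exact: cintegrable_lty.
  by apply/measurable_EFinP; exact: measurable_normc.
- by apply/measurable_EFinP; exact: measurable_normc.
- by move=> z; rewrite lee_fin normc_ge0.
Qed.

End integrals_on_products.

(** * Square-integrable functions *)

Section Lp_spaces.
Context (R : realType) (n : nat).
Local Notation leb := (@lebesgue_rV R n).
Implicit Types f g : 'rV[R]_n -> R[i].

Lemma L2norm_sqr f : (L2norm f ^+ 2 = \int[leb]_t (normc (f t) ^+ 2)%:E)%E.
Proof.
have r2 : 2 != 0 :> R by rewrite pnatr_eq0.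
have h := powR_Lnorm leb (EFin \o (@Normc.normc R \o f)) r2.
have -> : (L2norm f ^+ 2 = L2norm f `^ 2)%E.
  have := Lnorm_ge0 leb 2%:E (EFin \o (@Normc.normc R \o f)).
  rewrite -[Lnorm _ _ _]/(L2norm f); case: (L2norm f) => [r r0|_|//].
    by rewrite poweR_EFin powR_mulrn -?EFin_expe -?lee_fin.
  by rewrite expe2 mulyy poweRyr.
rewrite [LHS]h; apply: eq_integral => t _ /=.
by rewrite ger0_norm ?normc_ge0// powR_mulrn ?normc_ge0.
Qed.

Lemma in_L2P f : in_Lp 2 f <->
  cmeas f /\ (\int[leb]_t (normc (f t) ^+ 2)%:E < +oo)%E.
Proof.
rewrite -L2norm_sqr; split => -[mf fi]; split => //.
  by rewrite -[complex_Lnorm _ _]/(L2norm f) in fi; rewrite expe2 lte_mul_pinfty ?Lnorm_ge0// ge0_fin_numE ?Lnorm_ge0.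
rewrite -[complex_Lnorm _ _]/(L2norm f); move: fi; have := Lnorm_ge0 leb 2%:E (EFin \o (@Normc.normc R \o f)).
rewrite -[Lnorm _ _ _]/(L2norm f).
by case: (L2norm f) => [r|//|//] _ _; rewrite ltry.
Qed.

Lemma in_L1P f : in_Lp 1 f -> cintegrable leb f.
Proof.
move=> [mf]; rewrite /complex_Lnorm Lnorm1 => fi; apply: cintegrableP => //.
apply: le_lt_trans fi; apply: ge0_le_integral => //.
- by move=> x _; rewrite lee_fin normc_ge0.
- by apply/measurable_EFinP; exact: measurable_normc.
- by apply: measurableT_comp => //; apply/measurable_EFinP; exact: measurable_normc.
- by move=> x _; exact: lee_abs.
Qed.

Lemma in_L2_sqr_integrable f : in_Lp 2 f ->
  leb.-integrable setT (EFin \o (fun t => normc (f t) ^+ 2)).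
Proof.
move=> /in_L2P[mf fi]; apply/integrableP; split.
  by apply/measurable_EFinP; apply: measurable_funX; exact: measurable_normc.
by under eq_integral do rewrite /= ger0_norm ?sqr_ge0//.
Qed.

(* By [2ab <= a^2 + b^2], which gives integrability of products of square-integrable functions. *)
Lemma cintegrable_L2M f g : in_Lp 2 f -> in_Lp 2 g -> cintegrable leb (fun t => f t * g t).
Proof.
move=> fi gi; have [mf _] := fi; have [mg _] := gi.
apply: (@le_cintegrable _ _ _ _ _ (fun t => normc (f t) ^+ 2 + normc (g t) ^+ 2)).
- exact: cmeasM.
- move=> t; rewrite Normc.normcM.
  by have := normc_ge0 (f t); have := normc_ge0 (g t); nra.
- exact: (integrableD measurableT (in_L2_sqr_integrable fi) (in_L2_sqr_integrable gi)).
Qed.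

Lemma in_L2_conj f : in_Lp 2 f -> in_Lp 2 (fun t => conjc (f t)).
Proof.
move=> /in_L2P[mf fi]; apply/in_L2P; split; first exact: cmeas_conj.
by under eq_integral do rewrite normcJ.
Qed.

Lemma in_L2_scale (c : R[i]) f : in_Lp 2 f -> in_Lp 2 (fun t => c * f t).
Proof.
move=> fi; have [mf _] := fi; apply/in_L2P; split; first by apply: cmeasM => //; exact: cmeas_cst.
under eq_integral do rewrite Normc.normcM exprMn.
by have /integrable_lty := integrableZl measurableT (normc c ^+ 2) (in_L2_sqr_integrable fi); apply.
Qed.

Lemma in_L2D f g : in_Lp 2 f -> in_Lp 2 g -> in_Lp 2 (fun t => f t + g t).
Proof.
move=> fi gi; have [mf _] := fi; have [mg _] := gi.
apply/in_L2P; split; first exact: cmeasD.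
have fgi := integrableD measurableT (in_L2_sqr_integrable fi) (in_L2_sqr_integrable gi).
have /integrable_lty := integrableZl measurableT 2 fgi; move=> /(_ measurableT).
apply: le_lt_trans; apply: ge0_le_integral => //.
- by move=> x _; rewrite lee_fin sqr_ge0.
- by apply/measurable_EFinP; apply: measurable_funX; apply: measurable_normc; exact: cmeasD.
- by apply: measurable_funeM; exact: measurable_int fgi.
- move=> t _; rewrite /= lee_fin.
  have : normc (f t + g t) ^+ 2 <= (normc (f t) + normc (g t)) ^+ 2.
    by rewrite ler_pXn2r ?nnegrE ?addr_ge0 ?normc_ge0// ler_normcD.
  by have := sqr_ge0 (normc (f t) - normc (g t)); lra.
Qed.

Lemma in_L2_0 : in_Lp 2 (fun _ : 'rV[R]_n => 0 : R[i]).
Proof.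
apply/in_L2P; split; first exact: cmeas_cst.
by under eq_integral do rewrite Normc.normc0 expr0n; rewrite integral0.
Qed.

Lemma in_L2_sum I (r : seq I) (F : I -> 'rV[R]_n -> R[i]) :
  (forall i, in_Lp 2 (F i)) -> in_Lp 2 (fun t => \sum_(i <- r) F i t).
Proof.
move=> iF; elim: r => [|i r IH].
  by under eq_fun do rewrite big_nil; exact: in_L2_0.
by under eq_fun do rewrite big_cons; exact: in_L2D.
Qed.

End Lp_spaces.

(** * Gaussian inversion of the short-time Fourier transform *)

Section weak_inversion.
Context (R : realType) (d : nat).
Local Notation leb := (@lebesgue_rV R).

Lemma tfshift_gaussianE (z : 'rV[R]_(d + d)) (t : 'rV[R]_d) :
  tfshift z (@gaussian R d) t =
  expi (2 * pi * dotrV (rsubmx z) t) * (gaussd 1 (lsubmx z) t)%:C%C.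
Proof.
by rewrite /tfshift /modulation /translation /gaussian /gaussd mulr1 mulNr.
Qed.

Lemma normc_tfshift_gaussian (z : 'rV[R]_(d + d)) (t : 'rV[R]_d) :
  normc (tfshift z (@gaussian R d) t) = gaussd 1 (lsubmx z) t.
Proof.
by rewrite tfshift_gaussianE Normc.normcM normc_expi mul1r normc_real ger0_norm// gaussd_ge0.
Qed.

Lemma cmeas_tfshift_gaussian dT (T : measurableType dT)
    (u : T -> 'rV[R]_(d + d)) (v : T -> 'rV[R]_d) :
  measurable_fun setT u -> measurable_fun setT v ->
  cmeas (fun x => tfshift (u x) (@gaussian R d) (v x)).
Proof.
move=> mu mv; under eq_fun do rewrite tfshift_gaussianE.
apply: cmeasM.
  apply: cmeas_expi; apply: measurable_funM => //.
  by apply: measurable_fun_dotrV => //; exact: measurable_fun_rsubmx.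
by apply: cmeas_real; apply: measurable_gaussd => //; exact: measurable_fun_lsubmx.
Qed.

Lemma in_L2_tfshift_gaussian (z : 'rV[R]_(d + d)) : in_Lp 2 (tfshift z (@gaussian R d)).
Proof.
apply/in_L2P; split.
  by apply: (cmeas_tfshift_gaussian (T := 'rV[R]_d)) => //; exact: measurable_cst.
under eq_integral do rewrite normc_tfshift_gaussian.
have /integrable_lty := @integrable_gaussd R d 1 (lsubmx z) ltr01; move=> /(_ measurableT).
apply: le_lt_trans; apply: ge0_le_integral => //.
- by move=> x _; rewrite lee_fin sqr_ge0.
- by apply/measurable_EFinP; apply: measurable_funX; apply: measurable_gaussd => //; exact: measurable_cst.
- by apply/measurable_EFinP; apply: measurable_gaussd => //; exact: measurable_cst.
- by move=> t _; rewrite lee_fin expr2 ler_piMr ?gaussd_ge0// gaussd_le1.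
Qed.

Variable a : R.
Hypothesis a0 : 0 < a.
Variable y : 'rV[R]_d.

Let b1 : 0 < 1 + a. Proof. by rewrite addr_gt0. Qed.

(** The inner product of the atom at [z] with a test Gaussian; as the latter is real, no conjugation
    shows. *)
Definition gabor_coef (z : 'rV[R]_(d + d)) : R[i] :=
  cint (leb d) (fun t => tfshift z (@gaussian R d) t * (gaussd a y t)%:C%C).

Let ctr (x : 'rV[R]_d) := (1 / (1 + a)) *: x + (a / (1 + a)) *: y.

Let gm (x t : 'rV[R]_d) : gaussd 1 x t * gaussd a y t =
  gaussd (1 * a / (1 + a)) x y * gaussd (1 + a) (ctr x) t.
Proof. by rewrite gaussd_mul. Qed.

(** In the time variable the two Gaussians merge into one around [ctr x]; its Fourier transform
    supplies the decay in frequency and the phase. *)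
Lemma gabor_coefE z : gabor_coef z =
  ((Num.sqrt (1 + a))^-1 ^+ d *
   (gaussd (1 * a / (1 + a)) y (lsubmx z) * gaussd (1 / (1 + a)) 0 (rsubmx z)))%:C%C
   * expi (2 * pi * dotrV (rsubmx z) (ctr (lsubmx z))).
Proof.
rewrite /gabor_coef.
have [i1 e1] := gaussd_fourier (ctr (lsubmx z)) (rsubmx z) b1.
rewrite (_ : (fun t => _) = (fun t => (gaussd (1 * a / (1 + a)) (lsubmx z) y)%:C%C *
    ((gaussd (1 + a) (ctr (lsubmx z)) t)%:C%C * expi (2 * pi * dotrV (rsubmx z) t)))); last first.
  apply/funext => t; rewrite tfshift_gaussianE mulrA -rmorphM/= -gm rmorphM/=; ring.
rewrite cintZ// e1 mulrA -rmorphM/=; congr (_%:C%C * _).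
rewrite [gaussd _ _ y]gaussd_sym mulrCA; congr (_ * (_ * _)).
by rewrite /gaussd subr0 mulrA mulr1.
Qed.

Lemma cmeas_gabor_coef : cmeas gabor_coef.
Proof.
apply: eq_cmeas (fun z => esym (gabor_coefE z)) _; apply: cmeasM.
  apply: cmeas_real; apply: measurable_funM => //; apply: measurable_funM.
    apply: measurable_gaussd; first exact: measurable_cst.
    exact: measurable_fun_lsubmx.
  apply: measurable_gaussd; first exact: measurable_cst.
  exact: measurable_fun_rsubmx.
apply: cmeas_expi; apply: measurable_funM => //; apply: measurable_fun_dotrV.
  exact: measurable_fun_rsubmx.
apply: measurable_funDrV; apply: measurable_funZrV; first exact: measurable_fun_lsubmx.
exact: measurable_cst.
Qed.

Lemma normc_gabor_coef z : normc (gabor_coef z) =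
  (Num.sqrt (1 + a))^-1 ^+ d *
   (gaussd (1 * a / (1 + a)) y (lsubmx z) * gaussd (1 / (1 + a)) 0 (rsubmx z)).
Proof.
rewrite gabor_coefE Normc.normcM normc_expi mulr1 normc_real ger0_norm//.
by rewrite !mulr_ge0 ?gaussd_ge0// exprn_ge0// invr_ge0.
Qed.

Lemma integrable_gabor_coef : (leb (d + d)).-integrable setT (fun z => (normc (gabor_coef z))%:E).
Proof.
have c1 : 0 < 1 * a / (1 + a) by rewrite mul1r divr_gt0.
have c2 : 0 < 1 / (1 + a) by rewrite divr_gt0.
have h := integrable_split (integrable_gaussd y c1) (integrable_gaussd (0 : 'rV[R]_d) c2).
have := integrableZl measurableT ((Num.sqrt (1 + a))^-1 ^+ d) h.
by apply: eq_integrable => // z _; rewrite normc_gabor_coef.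
Qed.

(** The inversion formula for a Gaussian, by explicit computation. The frequency integral is a
    Fourier transform evaluated at [ctr x - t]; with the other factors it leaves
    [gaussd a y t * gaussd 2 t x], and the integral over [x] gives [2^(-d/2)], the squared norm of
    the window. *)
Lemma gabor_reconstruct (t : 'rV[R]_d) :
  cint (leb (d + d)) (fun z => conjc (tfshift z (@gaussian R d) t) * gabor_coef z) =
  ((Num.sqrt 2)^-1 ^+ d * gaussd a y t)%:C%C.
Proof.
have c2 : 0 < 1 / (1 + a) by rewrite divr_gt0.
have mA : cmeas (fun z : 'rV[R]_(d + d) => conjc (tfshift z (@gaussian R d) t)).
  by apply: cmeas_conj; apply: cmeas_tfshift_gaussian => //; exact: measurable_cst.
pose q := (Num.sqrt (1 + a))^-1 ^+ d.
have sE x w : conjc (tfshift (row_mx x w) (@gaussian R d) t) * gabor_coef (row_mx x w) =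
   (q * (gaussd 1 x t * gaussd (1 * a / (1 + a)) x y))%:C%C *
   ((gaussd (1 / (1 + a)) 0 w)%:C%C * expi (2 * pi * dotrV (ctr x - t) w)).
  rewrite gabor_coefE tfshift_gaussianE row_mxKl row_mxKr [gaussd _ y x]gaussd_sym.
  rewrite conjcM conjc_expi conjc_real dotrVBl mulrBr expiD !(dotrVC _ w) !rmorphM/= -/q.
  by move: (expi _) (expi _) (_%:C%C) (_%:C%C) (_%:C%C) (_%:C%C) => u1 u2 u3 u4 u5 u6; ring.
rewrite cint_split; last 2 first.
- apply: le_cintegrable integrable_gabor_coef.
    by apply: cmeasM => //; exact: cmeas_gabor_coef.
  move=> z; rewrite Normc.normcM normcJ normc_tfshift_gaussian ler_piMl ?normc_ge0//.
  exact: gaussd_le1.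
- move=> x; under eq_fun do rewrite sE; apply: cintegrableZ.
  by case: (gaussd_fourier 0 (ctr x - t) c2).
transitivity (cint (leb d) (fun x => (gaussd a y t)%:C%C * (gaussd 2 t x)%:C%C)).
  apply: eq_cint => x.
  under eq_cint do rewrite sE.
  have [i1 e1] := gaussd_fourier 0 (ctr x - t) c2.
  rewrite cintZ// e1 dotrV0r mulr0 expi0 mulr1 -!rmorphM/=; congr (_%:C%C).
  have -> : expR (- (pi / (1 / (1 + a)) * dotrV (ctr x - t) (ctr x - t))) = gaussd (1 + a) (ctr x) t.
    by rewrite gaussd_sym /gaussd mul1r invrK.
  have -> : gaussd 2 t x = gaussd 1 x t * gaussd 1 x t.
    by rewrite gaussd_sym -expRD; congr expR; ring.
  rewrite [Num.sqrt (1 / _)](_ : _ = (Num.sqrt (1 + a))^-1); last by rewrite mul1r sqrtrV// ltW.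
  rewrite invrK.
  have qq : q * Num.sqrt (1 + a) ^+ d = 1.
    by rewrite /q -exprMn mulVf ?expr1n// gt_eqF// sqrtr_gt0.
  transitivity ((q * Num.sqrt (1 + a) ^+ d) * (gaussd 1 x t * (gaussd (1 * a / (1 + a)) x y * gaussd (1 + a) (ctr x) t))).
    ring.
  by rewrite qq -gm; ring.
have i2 : cintegrable (leb d) (fun x => (gaussd 2 t x)%:C%C).
  have i2 := integrable_gaussd t (ltr0n R 2).
  by split; [exact: i2|apply: eq_integrable (integrable0 _ _)].
rewrite cintZ// cint_real /Rintegral integral_gaussd//= -rmorphM/=.
by rewrite mulrC.
Qed.

End weak_inversion.

(** Meant for [p = |phi t|] and [q] a Gaussian: it dominates their product by a sum of two
    integrable functions. *)
Lemma ler_mul_sqrD (R : realFieldType) (p q : R) :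
  0 <= p -> 0 <= q -> q <= 1 -> p * q <= p ^+ 2 + q.
Proof. by nra. Qed.

(** * Fubini's theorem under pointwise domination *)

Section dominated_Fubini.
Context d d' (T : measurableType d) (T' : measurableType d') (R : realType).
Variables (m1 : {sigma_finite_measure set T -> \bar R}).
Variables (m2 : {sigma_finite_measure set T' -> \bar R}).
Variable f : T * T' -> R[i].
Hypothesis mf : cmeas f.
Variables (u : T -> R) (v : T -> T' -> R) (M : R) (C : T' -> R).
Hypothesis u_ge0 : forall x, 0 <= u x.
Hypothesis v_ge0 : forall x y, 0 <= v x y.
Hypothesis ui : m1.-integrable setT (EFin \o u).
Hypothesis vi : forall x, m2.-integrable setT (EFin \o v x).
Hypothesis vM : forall x, (\int[m2]_y (v x y)%:E <= M%:E)%E.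
Hypothesis f_uv : forall x y, normc (f (x, y)) <= u x * v x y.
Hypothesis f_Cu : forall x y, normc (f (x, y)) <= C y * u x.

Let mfx x : cmeas (fun y => f (x, y)).
Proof. exact: (cmeas_comp (measurable_pair1 x) mf). Qed.

Let mfy y : cmeas (fun x => f (x, y)).
Proof. exact: (cmeas_comp (measurable_pair2 y) mf). Qed.

Let f1 x : cintegrable m2 (fun y => f (x, y)).
Proof.
apply: (le_cintegrable _ _ (integrableZl measurableT (u x) (vi x))) => //.
Qed.

Let f2 y : cintegrable m1 (fun x => f (x, y)).
Proof.
apply: (le_cintegrable _ _ (integrableZl measurableT (C y) ui)) => //.
Qed.

Let f_inner x : (\int[m2]_y (normc (f (x, y)))%:E <= (u x * M)%:E)%E.
Proof.
apply: (@le_trans _ _ (\int[m2]_y ((u x)%:E * (v x y)%:E)))%E.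
  apply: ge0_le_integral => //.
  - by move=> y _; rewrite lee_fin normc_ge0.
  - by apply/measurable_EFinP; exact: measurable_normc.
  - by apply: measurable_funeM; exact: measurable_int (vi x).
  - by move=> y _; rewrite lee_fin; exact: f_uv.
rewrite ge0_integralZl//.
- by rewrite EFinM lee_wpmul2l// lee_fin.
- exact: measurable_int (vi x).
- by move=> y _; rewrite lee_fin.
- by rewrite lee_fin.
Qed.

Let mnorm : measurable_fun setT (fun z : T * T' => (normc (f z))%:E).
Proof. by apply/measurable_EFinP; exact: measurable_normc. Qed.

Let fi : (\int[m1]_x \int[m2]_y (normc (f (x, y)))%:E < +oo)%E.
Proof.
have /integrable_lty := integrableZr measurableT M ui; move=> /(_ measurableT).
apply: le_lt_trans; apply: ge0_le_integral => //.
- by move=> x _; apply: integral_ge0 => y _; rewrite lee_fin normc_ge0.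
- apply: (measurable_fun_fubini_tonelli_F (fun z => (normc (f z))%:E)) => //.
  by move=> z; rewrite lee_fin normc_ge0.
- by apply: measurable_int (integrableZr measurableT M ui).
Qed.

Let mswap : cmeas (fun z : T' * T => f (z.2, z.1)).
Proof.
have h : measurable_fun setT (fun z : T' * T => (z.2, z.1)).
  by apply/measurable_fun_pairP; split; [exact: measurable_snd|exact: measurable_fst].
exact: (cmeas_comp h mf).
Qed.

Let fi' : (\int[m2]_y \int[m1]_x (normc (f (x, y)))%:E < +oo)%E.
Proof.
rewrite -(fubini_tonelli (fun z => (normc (f z))%:E))//.
by move=> z; rewrite lee_fin normc_ge0.
Qed.

Lemma cintegrable_cint2 : cintegrable m1 (fun x => cint m2 (fun y => f (x, y))).
Proof.
have mg := cmeas_cint2 (m1 := m1) (m2 := m2) mf fi f1.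
apply: cintegrableP => //.
apply: le_lt_trans fi; apply: ge0_le_integral => //.
- by move=> x _; rewrite lee_fin normc_ge0.
- by apply/measurable_EFinP; exact: measurable_normc.
- apply: (measurable_fun_fubini_tonelli_F (fun z => (normc (f z))%:E)) => //.
  by move=> z; rewrite lee_fin normc_ge0.
- by move=> x _; exact: le_normc_cint.
Qed.

Lemma cintegrable_cint1 : cintegrable m2 (fun y => cint m1 (fun x => f (x, y))).
Proof.
have mg := cmeas_cint2 (m1 := m2) (m2 := m1) mswap fi' f2.
apply: cintegrableP => //.
apply: le_lt_trans fi'; apply: ge0_le_integral => //.
- by move=> x _; rewrite lee_fin normc_ge0.
- by apply/measurable_EFinP; apply: measurable_normc.
- apply: (measurable_fun_fubini_tonelli_G (fun z => (normc (f z))%:E)) => //.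
  by move=> z; rewrite lee_fin normc_ge0.
- by move=> x _; exact: le_normc_cint.
Qed.

(** The two bounds have different roles: [f_uv], with the masses of [v x] bounded by [M], makes the
    double integral absolutely convergent, while [f_Cu] makes every slice at fixed [y]
    integrable. *)
Lemma dominated_cint_Fubini :
  cint m1 (fun x => cint m2 (fun y => f (x, y))) = cint m2 (fun y => cint m1 (fun x => f (x, y))).
Proof. exact: cint_Fubini. Qed.

End dominated_Fubini.

(** * The short-time Fourier transform and its weak inversion *)

Section short_time_Fourier_transform.
Context (R : realType) (d : nat) (phi : 'rV[R]_d -> R[i]).
Hypothesis hphi : feichtinger phi.
Local Notation leb := (@lebesgue_rV R).
Local Notation g0 := (@gaussian R d).

Definition stft (z : 'rV[R]_(d + d)) : R[i] := L2inner phi (tfshift z g0).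
(** The atoms are bounded by 1 and [stft] is integrable, so the integral converges absolutely for
    every [t]: [synth] is a bounded function defined everywhere. *)
Definition synth (t : 'rV[R]_d) : R[i] :=
  cint (leb (d + d)) (fun z => stft z * tfshift z g0 t).

Lemma cintegrable_stft : cintegrable (leb (d + d)) stft.
Proof. by apply: in_L1P; case: hphi. Qed.

Let phi2 : in_Lp 2 phi. Proof. by case: hphi. Qed.
Let mphi : cmeas phi. Proof. by case: phi2. Qed.
Let mV : cmeas stft. Proof. exact: cintegrable_cmeas cintegrable_stft. Qed.
Let iV := cintegrable_normc cintegrable_stft.

Let gauss_le1 (z : 'rV[R]_(d + d)) (t : 'rV[R]_d) : normc (tfshift z g0 t) <= 1.
Proof. by rewrite normc_tfshift_gaussian gaussd_le1. Qed.

Lemma synth_bound t : normc (synth t) <= fine (\int[leb (d + d)]_z (normc (stft z))%:E).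
Proof.
have cf : cintegrable (leb (d + d)) (fun z => stft z * tfshift z g0 t).
  apply: le_cintegrable iV; first by apply: cmeasM => //; apply: cmeas_tfshift_gaussian => //; exact: measurable_cst.
  by move=> z; rewrite Normc.normcM ler_piMr ?normc_ge0.
have mN := measurable_normc (cintegrable_cmeas cf).
rewrite -lee_fin fineK; last exact: integrable_fin_num.
apply: le_trans (le_normc_cint cf) _; apply: ge0_le_integral => //.
- by move=> x _; rewrite lee_fin normc_ge0.
- exact/measurable_EFinP.
- exact: measurable_int iV.
- by move=> z _; rewrite lee_fin Normc.normcM ler_piMr ?normc_ge0.
Qed.

Let gint (z : 'rV[R]_(d + d)) := @integrable_gaussd R d 1 (lsubmx z) ltr01.

Let mV1 : cmeas (fun z : 'rV[R]_(d + d) * 'rV[R]_d => stft z.1).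
Proof. exact: (cmeas_comp measurable_fst mV). Qed.

Let mA1 : cmeas (fun z : 'rV[R]_(d + d) * 'rV[R]_d => tfshift z.1 g0 z.2).
Proof. by apply: cmeas_tfshift_gaussian. Qed.

(** Measurability is a by-product of Fubini: as an inner integral, [synth] is even integrable. *)
Lemma cmeas_synth : cmeas synth.
Proof.
apply: cintegrable_cmeas.
have h0 : cmeas (fun z : 'rV[R]_(d + d) * 'rV[R]_d => stft z.1 * tfshift z.1 g0 z.2) by exact: cmeasM.
have h1 (z : 'rV[R]_(d + d)) : 0 <= normc (stft z) by exact: normc_ge0.
have h2 (z : 'rV[R]_(d + d)) (t : 'rV[R]_d) : 0 <= gaussd 1 (lsubmx z) t by exact: gaussd_ge0.
have h5 (z : 'rV[R]_(d + d)) : (\int[leb d]_t (gaussd 1 (lsubmx z) t)%:E <= ((Num.sqrt 1)^-1 ^+ d)%:E)%E.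
  by rewrite integral_gaussd.
have h6 (z : 'rV[R]_(d + d)) (t : 'rV[R]_d) :
    normc (stft z * tfshift z g0 t) <= normc (stft z) * gaussd 1 (lsubmx z) t.
  by rewrite Normc.normcM normc_tfshift_gaussian.
have h7 (z : 'rV[R]_(d + d)) (t : 'rV[R]_d) : normc (stft z * tfshift z g0 t) <= 1 * normc (stft z).
  by rewrite Normc.normcM mul1r ler_piMr ?normc_ge0.
exact: (cintegrable_cint1 (m1 := leb (d + d)) (m2 := leb d) h0 h1 h2 iV gint h5 h6 h7).
Qed.

(** Integrals are exchanged twice. First the test Gaussian moves inside the synthesis integral,
    which gives the integral of [stft z * gabor_coef a y z]; then [stft] is opened and the integral
    over [z] is done first, where [gabor_reconstruct] applies. *)
Lemma weak_inversion a (y : 'rV[R]_d) : 0 < a ->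
  cint (leb d) (fun t => synth t * (gaussd a y t)%:C%C) =
  ((Num.sqrt 2)^-1 ^+ d)%:C%C * cint (leb d) (fun t => phi t * (gaussd a y t)%:C%C).
Proof.
move=> a0.
have mG : cmeas (fun z : 'rV[R]_(d + d) * 'rV[R]_d => (gaussd a y z.2)%:C%C).
  by apply: cmeas_real; apply: measurable_gaussd => //; exact: measurable_cst.
have ga1 t : gaussd a y t <= 1 by rewrite gaussd_le1// ltW.
have iVz t : cintegrable (leb (d + d)) (fun z => stft z * tfshift z g0 t).
  apply: le_cintegrable iV; first by apply: cmeasM => //; apply: cmeas_tfshift_gaussian => //; exact: measurable_cst.
  by move=> z; rewrite Normc.normcM ler_piMr ?normc_ge0.
have i1 z : cintegrable (leb d) (fun t => tfshift z g0 t * (gaussd a y t)%:C%C).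
  apply: le_cintegrable (integrable_gaussd y a0).
    apply: cmeasM; first by apply: cmeas_tfshift_gaussian => //; exact: measurable_cst.
    by apply: cmeas_real; apply: measurable_gaussd => //; exact: measurable_cst.
  by move=> t; rewrite Normc.normcM normc_real [X in _ * X]ger0_norm ?gaussd_ge0// ler_piMl ?gaussd_ge0.
pose f1 (z : 'rV[R]_(d + d) * 'rV[R]_d) := stft z.1 * (tfshift z.1 g0 z.2 * (gaussd a y z.2)%:C%C).
pose f2 (z : 'rV[R]_(d + d) * 'rV[R]_d) := gabor_coef a y z.1 * (phi z.2 * conjc (tfshift z.1 g0 z.2)).
transitivity (cint (leb d) (fun t => cint (leb (d + d)) (fun z => f1 (z, t)))).
  apply: eq_cint => t; rewrite /f1/= mulrC -cintZ//.
  by apply: eq_cint => z; ring.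
have m1' : cmeas f1 by apply: cmeasM => //; exact: cmeasM.
have h1 (z : 'rV[R]_(d + d)) : 0 <= normc (stft z) by exact: normc_ge0.
have h2 (z : 'rV[R]_(d + d)) (t : 'rV[R]_d) : 0 <= gaussd a y t by exact: gaussd_ge0.
have h4 (z : 'rV[R]_(d + d)) := integrable_gaussd y a0.
have h5 (z : 'rV[R]_(d + d)) : (\int[leb d]_t (gaussd a y t)%:E <= ((Num.sqrt a)^-1 ^+ d)%:E)%E.
  by rewrite integral_gaussd.
have nf1 z t : normc (f1 (z, t)) = normc (stft z) * (normc (tfshift z g0 t) * gaussd a y t).
  rewrite -[f1 _]/(stft z * (tfshift z g0 t * (gaussd a y t)%:C%C)) Normc.normcM Normc.normcM; congr (_ * (_ * _)).
  by rewrite normc_real ger0_norm ?gaussd_ge0.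
have h6 z t : normc (f1 (z, t)) <= normc (stft z) * gaussd a y t.
  by rewrite nf1 ler_wpM2l ?normc_ge0// ler_piMl ?gaussd_ge0.
have h7 z t : normc (f1 (z, t)) <= 1 * normc (stft z).
  by rewrite mul1r nf1 ler_piMr ?normc_ge0// mulr_ile1 ?normc_ge0 ?gaussd_ge0.
rewrite -(dominated_cint_Fubini (m1 := leb (d + d)) (m2 := leb d) m1' h1 h2 iV h4 h5 h6 h7).
have iphi z : cintegrable (leb d) (fun t => phi t * conjc (tfshift z g0 t)).
  by apply: cintegrable_L2M => //; apply: in_L2_conj; exact: in_L2_tfshift_gaussian.
transitivity (cint (leb (d + d)) (fun z => cint (leb d) (fun t => f2 (z, t)))).
  apply: eq_cint => z; transitivity (stft z * gabor_coef a y z).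
    exact: (cintZ (stft z) (i1 z)).
  by rewrite mulrC; apply/esym; exact: (cintZ (gabor_coef a y z) (iphi z)).
pose I2 := (\int[leb d]_t (normc (phi t) ^+ 2)%:E)%E.
have I2fin : I2 \is a fin_num by apply: integrable_fin_num => //; exact: in_L2_sqr_integrable.
(* In [t] the integrand is dominated by [|phi|^2] plus a Gaussian, whose mass is bounded
   independently of [z]. *)
have vint (z : 'rV[R]_(d + d)) := integrableD measurableT (in_L2_sqr_integrable phi2) (gint z).
have m2' : cmeas f2.
  apply: cmeasM; first exact: (cmeas_comp measurable_fst (cmeas_gabor_coef a0 y)).
  by apply: cmeasM; [exact: (cmeas_comp measurable_snd mphi)|exact: cmeas_conj].
have k1 (z : 'rV[R]_(d + d)) : 0 <= normc (gabor_coef a y z) by exact: normc_ge0.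
have k2 (z : 'rV[R]_(d + d)) (t : 'rV[R]_d) : 0 <= normc (phi t) ^+ 2 + gaussd 1 (lsubmx z) t.
  by rewrite addr_ge0 ?sqr_ge0 ?gaussd_ge0.
have k5 (z : 'rV[R]_(d + d)) : (\int[leb d]_t (normc (phi t) ^+ 2 + gaussd 1 (lsubmx z) t)%:E <=
    (fine I2 + (Num.sqrt 1)^-1 ^+ d)%:E)%E.
  under eq_integral do rewrite EFinD.
  rewrite ge0_integralD//.
  + by rewrite integral_gaussd// EFinD fineK.
  + by move=> t _; rewrite lee_fin sqr_ge0.
  + exact: measurable_int (in_L2_sqr_integrable phi2).
  + by move=> t _; rewrite lee_fin gaussd_ge0.
  + exact: measurable_int (gint z).
have nf2 z t : normc (f2 (z, t)) = normc (gabor_coef a y z) * (normc (phi t) * gaussd 1 (lsubmx z) t).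
  rewrite -[f2 _]/(gabor_coef a y z * (phi t * conjc (tfshift z g0 t))) Normc.normcM Normc.normcM; congr (_ * (_ * _)).
  by rewrite normcJ normc_tfshift_gaussian.
have k6 z t : normc (f2 (z, t)) <= normc (gabor_coef a y z) * (normc (phi t) ^+ 2 + gaussd 1 (lsubmx z) t).
  rewrite nf2 ler_wpM2l ?normc_ge0//.
  by apply: ler_mul_sqrD; [exact: normc_ge0|exact: gaussd_ge0|exact: gaussd_le1].
have k7 z t : normc (f2 (z, t)) <= normc (phi t) * normc (gabor_coef a y z).
  rewrite nf2 mulrC ler_wpM2r ?normc_ge0// ler_piMr ?normc_ge0//.
  exact: gaussd_le1.
rewrite (dominated_cint_Fubini (m1 := leb (d + d)) (m2 := leb d) m2' k1 k2 (integrable_gabor_coef a0 y) vint k5 k6 k7).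
rewrite -cintZ; last first.
  apply: cintegrable_L2M => //; apply/in_L2P; split.
    by apply: cmeas_real; apply: measurable_gaussd => //; exact: measurable_cst.
  have /integrable_lty := integrable_gaussd y a0; move=> /(_ measurableT).
  apply: le_lt_trans; apply: ge0_le_integral => //.
  + by move=> t _; rewrite lee_fin sqr_ge0.
  + by apply/measurable_EFinP; apply: measurable_funX; apply: measurable_normc; apply: cmeas_real; apply: measurable_gaussd => //; exact: measurable_cst.
  + exact: measurable_int (integrable_gaussd y a0).
  + by move=> t _; rewrite lee_fin normc_real ger0_norm ?gaussd_ge0// expr2 ler_piMr ?gaussd_ge0.
apply: eq_cint => t; rewrite /f2 /=.
transitivity (phi t * cint (leb (d + d)) (fun z => conjc (tfshift z g0 t) * gabor_coef a y z)).
  rewrite -cintZ; last first.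
    apply: le_cintegrable (integrable_gabor_coef a0 y).
      apply: cmeasM; last exact: cmeas_gabor_coef.
      by apply: cmeas_conj; apply: cmeas_tfshift_gaussian => //; exact: measurable_cst.
    by move=> z; rewrite Normc.normcM normcJ ler_piMl ?normc_ge0.
  by apply: eq_cint => z; rewrite mulrCA (mulrC (conjc _)).
by rewrite gabor_reconstruct// [X in _ * X]rmorphM mulrCA.
Qed.

End short_time_Fourier_transform.

(* The integrals over y in an orthant of the normalized Gaussians kern k y tend
   boundedly to the indicator of the orthant, off its boundary. *)
Section gaussian_test_functions.
Context (R : realType) (n : nat).
Local Notation leb := (@lebesgue_rV R n).
Implicit Types (t y c : 'rV[R]_n) (S : set 'rV[R]_n).

Let kern (k : nat) y t : R := k.+1%:R ^+ n * gaussd (k.+1%:R ^+ 2) y t.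

Let k2_gt0 (k : nat) : 0 < (k.+1%:R : R) ^+ 2.
Proof. by rewrite exprn_gt0. Qed.

Let kern_ge0 k y t : 0 <= kern k y t.
Proof. by rewrite mulr_ge0 ?gaussd_ge0// exprn_ge0. Qed.

Let kern_int k t : leb.-integrable setT (EFin \o (fun y => kern k y t)).
Proof.
have := integrableZl measurableT (k.+1%:R ^+ n) (integrable_gaussd t (k2_gt0 k)).
by apply: eq_integrable => // y _ /=; rewrite gaussd_sym.
Qed.

Let kern_mass k t : (\int[leb]_y (kern k y t)%:E = 1)%E.
Proof.
under eq_integral do rewrite EFinM gaussd_sym.
rewrite ge0_integralZl//.
- rewrite integral_gaussd// sqrtr_sqr ger0_norm// -EFinM -exprMn mulfV ?expr1n//.
- exact: measurable_int (integrable_gaussd t (k2_gt0 k)).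
- by move=> y _; rewrite lee_fin gaussd_ge0.
Qed.

Let mkern1 k t : measurable_fun setT (fun y => kern k y t).
Proof. by apply: measurable_funM => //; apply: measurable_gaussd => //; exact: measurable_cst. Qed.

Let chi S k t : R := \int[leb]_y (\1_S y * kern k y t).

Let chi_int S k t : measurable S -> leb.-integrable setT (EFin \o (fun y => \1_S y * kern k y t)).
Proof.
move=> mS; apply: (le_integrable measurableT _ _ (kern_int k t)).
  by apply/measurable_EFinP; apply: measurable_funM.
move=> y _; rewrite /= lee_fin normrM ler_piMl// indicE.
by case: (y \in S); rewrite ?normr1 ?normr0.
Qed.

Let chi_ge0 S k t : 0 <= chi S k t.
Proof. by apply: Rintegral_ge0 => y _; rewrite mulr_ge0// indicE. Qed.

Let chi_compl S k t : measurable S -> chi S k t + chi (~` S) k t = 1.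
Proof.
move=> mS; rewrite -RintegralD//; [|exact: chi_int|by apply: chi_int; exact: measurableC].
rewrite -[RHS]/(fine 1%E) -(kern_mass k t) /Rintegral; congr fine.
apply: eq_integral => y _; congr EFin; rewrite -mulrDl !indicE in_setC.
by case: (y \in S); rewrite /= ?addr0 ?add0r mul1r.
Qed.

Let chi_le1 S k t : measurable S -> chi S k t <= 1.
Proof. by move=> mS; rewrite -(chi_compl k t mS) lerDl. Qed.

(** Write K for [k.+1] and D for the squared distance to [t]. On [S], K^2 D is at least D + (K^2 -
    1) r: the second term leaves the integral, the first is the exponent of a Gaussian of mass 1. *)
Let chi_tail S k t r : measurable S -> 0 <= r ->
  (forall y, S y -> r <= dotrV (t - y) (t - y)) ->
  chi S k t <= k.+1%:R ^+ n * expR (- (pi * r * (k.+1%:R ^+ 2 - 1))).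
Proof.
move=> mS r0 Sr.
set B := _ * _.
have B0 : 0 <= B by rewrite mulr_ge0 ?exprn_ge0 ?expR_ge0.
have g1 := integrable_gaussd t (ltr01 : 0 < (1 : R)).
have h : chi S k t <= \int[leb]_y (B * gaussd 1 t y).
  apply: le_Rintegral => //; [exact: chi_int|exact: (integrableZl measurableT B g1)|].
  move=> y _; rewrite indicE; case: (boolP (y \in S)) => [yS|_]; last first.
    by rewrite mul0r mulr_ge0 ?gaussd_ge0.
  rewrite mul1r /kern /B -mulrA ler_wpM2l ?exprn_ge0//.
  rewrite /gaussd -expRD ler_expR -opprD lerN2 -!mulrA -mulrDr ler_pM2l ?pi_gt0//.
  have -> : dotrV (y - t) (y - t) = dotrV (t - y) (t - y).
    by rewrite -[y - t]opprB dotrVNl dotrVNr opprK.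
  rewrite mul1r.
  have yr := Sr y (set_mem yS).
  have k1 : 1 <= k.+1%:R ^+ 2 :> R by rewrite exprn_ege1// ler1n.
  rewrite -subr_ge0 in k1; rewrite [leRHS]mulrA -expr2.
  by move: (dotrV _ _) (_ ^+ 2) k1 yr => D K k1 yr; nra.
apply: le_trans h _; rewrite RintegralZl//= /Rintegral integral_gaussd//=.
by rewrite sqrtr1 invr1 expr1n mulr1.
Qed.

(** With K for [k.+1], the power K^n is at most [expR (K n)]; once K is at least (n + 1) / (pi r),
    the total exponent is at most pi r - K. *)
Let tail_cvg0 r : 0 < r ->
  k.+1%:R ^+ n * expR (- (pi * r * (k.+1%:R ^+ 2 - 1))) @[k --> \oo] --> (0 : R).
Proof.
move=> r0.
have pr : 0 < pi * r by rewrite mulr_gt0// pi_gt0.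
have h0 : expR (- k%:R) @[k --> \oo] --> (0 : R).
  apply: (cvg_comp (fun k : nat => k%:R) (fun x : R => expR (- x))); last exact: cvgr_expR.
  exact: cvgr_idn.
have lim0 : expR (pi * r) * expR (- k.+1%:R) @[k --> \oo] --> (0 : R).
  rewrite -[X in _ --> X](mulr0 (expR (pi * r))); apply: cvgMl_tmp.
  by move: h0; rewrite -cvg_shiftS.
apply: (squeeze_cvgr _ (cvg_cst 0) lim0).
near=> k; rewrite mulr_ge0 ?exprn_ge0 ?expR_ge0//=.
have kn : (k.+1%:R : R) ^+ n <= expR (k.+1%:R * n%:R).
  rewrite expRM_natr lerXn2r ?nnegrE ?expR_ge0//.
  by rewrite (le_trans _ (expR_ge1Dx _))// lerDr.
apply: le_trans (ler_wpM2r (expR_ge0 _) kn) _.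
rewrite -!expRD ler_expR.
have : (n%:R + 1) / (pi * r) <= k.+1%:R.
  near: k; exists (Num.truncn ((n%:R + 1) / (pi * r))) => // m /= km.
  by rewrite ltW// (lt_le_trans (truncnS_gt _))// ler_nat.
rewrite ler_pdivrMr// => h.
have k0 : 0 < (k.+1%:R : R) by [].
move: (k.+1%:R) (pi * r) (n%:R) k0 pr h => K p N k0 p0 h; nra.
Unshelve. all: by end_near.
Qed.

(** Open orthants are closed under intersection, generate the sigma-algebra, and have boundaries of
    measure 0. *)
Definition orthant c : set 'rV[R]_n := rVbox (fun i => `]c ord0 i, +oo[%classic).

Lemma measurable_orthant c : measurable (orthant c).
Proof. by apply: measurable_rVbox => i; exact: measurable_itv. Qed.

Let chi_orthant_cvg c t : (forall i, t ord0 i != c ord0 i) ->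
  chi (orthant c) k t @[k --> \oo] --> (\1_(orthant c) t : R).
Proof.
move=> tc; have mO := measurable_orthant c.
rewrite indicE; case: (boolP (t \in orthant c)) => tO.
  have tci i : c ord0 i < t ord0 i.
    by move/set_mem: tO => /(_ i); rewrite /= in_itv /= andbT.
  (* [s^-1] is below every gap between [t] and [c]; the summand 1 keeps [s] positive in dimension
     0. *)
  pose s := \sum_i (t ord0 i - c ord0 i)^-1 + 1.
  have s0 : 0 < s.
    by rewrite ltr_wpDl// sumr_ge0// => i _; rewrite invr_ge0 subr_ge0 ltW.
  have si i : s^-1 <= t ord0 i - c ord0 i.
    rewrite -[leRHS]invrK lef_pV2 ?posrE ?invr_gt0 ?subr_gt0//.
    rewrite /s (bigD1 i)//= -addrA lerDl addr_ge0// sumr_ge0// => j _.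
    by rewrite invr_ge0 subr_ge0 ltW.
  have -> : (fun k => chi (orthant c) k t) = (fun k => 1 - chi (~` orthant c) k t).
    by apply/funext => k; rewrite -(chi_compl k t mO) addrK.
  rewrite -[X in _ --> X](subr0 1); apply: cvgB; first exact: cvg_cst.
  have r0 : 0 < s^-1 ^+ 2 by rewrite exprn_gt0// invr_gt0.
  apply: (squeeze_cvgr _ (cvg_cst 0) (tail_cvg0 r0)).
  near=> k; rewrite chi_ge0/=; apply: chi_tail; [exact: measurableC|exact: ltW|].
  move=> y yO; have /existsNP[i /negP] : ~ (forall i, c ord0 i < y ord0 i).
    by move=> h; apply: yO => i; rewrite /= in_itv/= andbT.
  rewrite -leNgt => yc.
  apply: le_trans (sqr_coord_le _ i); rewrite !mxE.
  rewrite ler_pXn2r ?nnegrE ?invr_ge0 ?(ltW s0)//.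
    by rewrite (le_trans (si i))// lerB.
  by rewrite subr_ge0 (le_trans yc)// ltW.
have [i ti] : exists i, t ord0 i < c ord0 i.
  have /existsNP[i /negP] : ~ (forall i, c ord0 i < t ord0 i).
    move=> h; move/negP: tO; apply; apply/mem_set => i.
    by rewrite /= in_itv/= andbT.
  rewrite -leNgt => h.
  by exists i; rewrite lt_neqAle tc.
have r0 : 0 < (c ord0 i - t ord0 i) ^+ 2 by rewrite exprn_gt0// subr_gt0.
apply: (squeeze_cvgr _ (cvg_cst 0) (tail_cvg0 r0)).
near=> k; rewrite chi_ge0/=; apply: chi_tail => //; first exact: ltW.
move=> y /(_ i); rewrite /= in_itv/= andbT => yc.
apply: le_trans (sqr_coord_le _ i); rewrite !mxE.
rewrite -[leRHS]sqrrN opprB ler_pXn2r ?nnegrE ?subr_ge0 ?(ltW ti)//.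
  by rewrite lerB// ltW.
by rewrite (le_trans (ltW ti))// ltW.
Unshelve. all: by end_near.
Qed.

Let ae_neq c : {ae leb, forall t, forall i, t ord0 i != c ord0 i}.
Proof.
apply: filter_forall => i.
exists (rVbox (fun j => if j == i then [set c ord0 i] else setT)); split.
- by apply: measurable_rVbox => j; case: ifP => // _; exact: measurable_set1.
- rewrite lebesgue_rVbox; last by move=> j; case: ifP => // _; exact: measurable_set1.
  by rewrite (bigD1 i)//= eqxx lebesgue_measure_set1 mul0e.
- by move=> t /= /negP; rewrite negbK => /eqP tc j; case: eqP => // ->.
Qed.

Variable u : 'rV[R]_n -> R.
Hypothesis ui : leb.-integrable setT (EFin \o u).
Hypothesis u_gauss : forall a y, 0 < a -> \int[leb]_t (u t * gaussd a y t) = 0.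

Let mu : measurable_fun setT u.
Proof. by apply/measurable_EFinP; exact: measurable_int ui. Qed.

(** By Fubini this integral averages, over [y] in [S], the integrals of [u] against Gaussians
    centred at [y], which all vanish. *)
Let avg S k : measurable S ->
  leb.-integrable setT (EFin \o (fun t => u t * chi S k t)) /\
  \int[leb]_t (u t * chi S k t) = 0.
Proof.
move=> mS.
pose f (z : 'rV[R]_n * 'rV[R]_n) : R[i] := (u z.1 * (\1_S z.2 * kern k z.2 z.1))%:C%C.
have mf : cmeas f.
  apply: cmeas_real; apply: measurable_funM; first exact: (measurableT_comp mu).
  apply: measurable_funM.
    by apply: (measurableT_comp (f := \1_S : _ -> R)).
  apply: measurable_funM => //; exact: measurable_gaussd.
have h1 t : 0 <= `|u t| by [].
have h2 t y : 0 <= kern k y t by [].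
have h5 t : (\int[leb]_y (kern k y t)%:E <= 1%:E)%E by rewrite kern_mass.
have nf t y : normc (f (t, y)) <= `|u t| * kern k y t.
  rewrite normc_real normrM ler_wpM2l// normrM ger0_norm ?indicE// (ger0_norm (kern_ge0 _ _ _)).
  by rewrite ler_piMl//; case: (y \in S).
have h7 t y : normc (f (t, y)) <= k.+1%:R ^+ n * `|u t|.
  rewrite (le_trans (nf _ _))// mulrC ler_wpM2r// ler_piMr ?exprn_ge0//.
  by rewrite gaussd_le1// ltW.
have E t : cint leb (fun y => f (t, y)) = (u t * chi S k t)%:C%C.
  rewrite cint_real; congr (_%:C%C).
  by rewrite /chi -RintegralZl//; exact: chi_int.
have iu := integrable_norm ui.
have i1 := cintegrable_cint2 (m1 := leb) (m2 := leb) mf h1 h2 iu (kern_int k) h5 nf.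
have e1 := dominated_cint_Fubini (m1 := leb) (m2 := leb) mf h1 h2 iu (kern_int k) h5 nf h7.
split.
  by case: (eq_cintegrable E i1) => i1' _; exact: i1'.
apply: complexI; rewrite -cint_real.
under eq_cint do rewrite -E.
rewrite e1 -[RHS](cint0 leb); apply: eq_cint => y.
rewrite cint_real (_ : \int[leb]_x _ = \int[leb]_x ((\1_S y * k.+1%:R ^+ n) * (u x * gaussd (k.+1%:R ^+ 2) y x))); last first.
  by apply: eq_Rintegral => t _; rewrite /kern; ring.
have ig : leb.-integrable setT (EFin \o (fun x => u x * gaussd (k.+1%:R ^+ 2) y x)).
  apply: (le_integrable measurableT _ _ ui).
    apply/measurable_EFinP; apply: measurable_funM; first exact: mu.
    by apply: measurable_gaussd; [exact: measurable_cst|exact: measurable_id].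
  move=> t _; rewrite /comp abse_EFin lee_fin normrM (ger0_norm (gaussd_ge0 _ _ _)).
  apply: ler_piMr; first exact: normr_ge0.
  by apply: gaussd_le1; exact: (ltW (k2_gt0 k)).
by rewrite (RintegralZl _ measurableT ig) (u_gauss y (k2_gt0 k)) mulr0.
Qed.

Let integral_S_eq0 S : measurable S ->
  {ae leb, forall t, chi S k t @[k --> \oo] --> (\1_S t : R)} ->
  (\int[leb]_(t in S) (u t)%:E = 0)%E.
Proof.
move=> mS chiS.
have m1 k : measurable_fun setT (fun t => (u t * chi S k t)%:E).
  exact: measurable_int (avg k mS).1.
have m2 : measurable_fun setT (fun t => (u t * \1_S t)%:E).
  by apply/measurable_EFinP; exact: measurable_funM.
have hf : {ae leb, forall t, setT t -> (u t * chi S k t)%:E @[k --> \oo] --> (u t * \1_S t)%:E}.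
  apply: filterS chiS => t tS _; apply: cvg_EFin; first exact: nearW.
  by apply: cvgMl_tmp.
have hg : {ae leb, forall t k, setT t -> (`|(u t * chi S k t)%:E| <= `|u t|%:E)%E}.
  apply: aeW => t k _; rewrite abse_EFin lee_fin normrM ler_piMr// ger0_norm ?chi_ge0//.
  exact: chi_le1.
have [_ _ cv] := dominated_convergence measurableT m1 m2 hf (integrable_norm ui) hg.
have -> : (\int[leb]_(t in S) (u t)%:E = \int[leb]_t (u t * \1_S t)%:E)%E.
  rewrite integral_mkcond; apply: eq_integral => t _; rewrite patchE indicE.
  by case: (t \in S); rewrite ?mulr1 ?mulr0.
apply: (cvg_unique _ cv) => //.
apply: cvg_near_cst; apply: nearW => k.
have [i0 e0] := avg k mS.
transitivity (\int[leb]_t (u t * chi S k t))%:E; last by rewrite e0.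
exact: esym (fineK (integrable_fin_num measurableT i0)).
Qed.

(** The sets over which [u] has integral 0 form a Dynkin system containing the orthants, hence
    contain all measurable sets, and [u] is 0 almost everywhere. *)
Lemma gauss_test_eq0 : {ae leb, forall t, u t = 0}.
Proof.
pose G := [set O | exists c, O = orthant c].
have GE : @measurable _ 'rV[R]_n = <<s G >>.
  apply/seteqP; split; last first.
    apply: smallest_sub; first exact: sigma_algebra_measurable.
    by move=> _ [c ->]; exact: measurable_orthant.
  apply: measurable_rV_generated => i B mB.
  suff : measurable_fun [set: g_sigma_algebraType G]
      ((fun x : 'rV[R]_n => x ord0 i) : g_sigma_algebraType G -> R).
    by move=> /(_ measurableT _ mB); rewrite setTI.
  apply: (measurability _ (RGenOInfty.measurableE R)) => _ [_ [x ->] <-].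
  rewrite setTI.
  (* An open half-space is the union over [m] of the orthants with corner [x] in coordinate [i] and
     [- m] in the others. *)
  pose c (m : nat) : 'rV[R]_n := \row_j (if j == i then x else - m%:R).
  rewrite (_ : _ @^-1` _ = \bigcup_m orthant (c m)).
    by apply: bigcupT_measurable => m; apply: sub_sigma_algebra; exists (c m).
  apply/seteqP; split => t /=; rewrite in_itv/= andbT; last first.
    by move=> [m _ /(_ i)] /=; rewrite in_itv/= mxE eqxx andbT.
  move=> xt; exists (Num.truncn (\sum_j `|t ord0 j|)).+1 => // j.
  rewrite /= in_itv/= mxE andbT; case: eqP => [->//|_].
  rewrite ltrNl; apply: le_lt_trans (truncnS_gt _).
  rewrite (bigD1 j)//= -[leLHS]addr0 lerD ?sumr_ge0//.
  by rewrite -normrN ler_norm.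
have uS S : measurable S -> (\int[leb]_(t in S) (u t)%:E = 0)%E.
  move=> mS; have iS (A : set 'rV[R]_n) : measurable A -> leb.-integrable A (EFin \o u).
    by move=> mA; apply: (integrableS measurableT).
  move: (mS); rewrite {1}GE.
  apply: (dynkin_induction (P := fun S => (\int[leb]_(t in S) (u t)%:E = 0)%E) GE).
  - move=> _ _ [c1 ->] [c2 ->]; exists (\row_i Num.max (c1 ord0 i) (c2 ord0 i)).
    apply/seteqP; split => t /=.
      by move=> [t1 t2] i; have := t1 i; have := t2 i; rewrite /= !in_itv/= !andbT mxE gt_max => -> ->.
    by move=> h; split => i; have := h i; rewrite /= !in_itv/= !andbT mxE gt_max => /andP[].
  - apply: integral_S_eq0 => //; apply: aeW => t.
    rewrite indicT; apply: cvg_near_cst; apply: nearW => k.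
    rewrite /chi; under eq_Rintegral do rewrite indicT mul1r.
    by rewrite /Rintegral kern_mass.
  - move=> _ [c ->]; apply: integral_S_eq0; first exact: measurable_orthant.
    by apply: filterS (ae_neq c) => t; exact: chi_orthant_cvg.
  - move=> A mA A0.
    have := integral_setU leb mA (measurableC mA) (f := EFin \o u).
    rewrite setUv => e.
    have T0 : (\int[leb]_t (u t)%:E = 0)%E.
      apply: integral_S_eq0 => //; apply: aeW => t.
      rewrite indicT; apply: cvg_near_cst; apply: nearW => k.
      rewrite /chi; under eq_Rintegral do rewrite indicT mul1r.
      by rewrite /Rintegral kern_mass.
    move: e; rewrite T0 A0 add0e => <- //.
      exact: measurable_int ui.
    by rewrite disj_set2E setICr.
  - move=> F mF tF F0; rewrite integral_bigcup//; last by apply: iS; exact: bigcupT_measurable.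
    by rewrite eseries0.
have := integral_ae_eq measurableT ui (g := cst 0%E) (measurable_cst _).
move=> /(_ _)[|N [mN N0 sN]].
  by move=> E _ mE; rewrite uS// integral0.
exists N; split => // t /= ut; apply: sN => /= h; apply: ut.
by have [] := h I.
Qed.

End gaussian_test_functions.

Section stft_inversion.
Context (R : realType) (d : nat) (phi : 'rV[R]_d -> R[i]).
Hypothesis hphi : feichtinger phi.
Local Notation leb := (@lebesgue_rV R).
Local Notation g0 := (@gaussian R d).

Lemma in_L2_gaussd a (y : 'rV[R]_d) : 0 < a -> in_Lp 2 (fun t => (gaussd a y t)%:C%C).
Proof.
move=> a0; apply/in_L2P.
have mg : cmeas (fun t => (gaussd a y t)%:C%C).
  by apply: cmeas_real; apply: measurable_gaussd => //; exact: measurable_cst.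
split => //.
have /integrable_lty := integrable_gaussd y a0; move=> /(_ measurableT).
apply: le_lt_trans; apply: ge0_le_integral => //.
- by move=> t _; rewrite lee_fin sqr_ge0.
- by apply/measurable_EFinP; apply: measurable_funX; exact: measurable_normc.
- exact: measurable_int (integrable_gaussd y a0).
- move=> t _; rewrite lee_fin normc_real ger0_norm ?gaussd_ge0// expr2 ler_piMr ?gaussd_ge0//.
  exact: gaussd_le1 (ltW a0).
Qed.

Let phi2 : in_Lp 2 phi. Proof. by case: hphi. Qed.

(** [2^(-d/2)] is the squared L2 norm of the Gaussian window, the usual constant of the inversion
    formula. *)
Definition inv_cst : R := (Num.sqrt 2)^-1 ^+ d.

Let w t := synth phi t + (- inv_cst%:C%C) * phi t.

Let mw : cmeas w.
Proof.
apply: cmeasD; first exact: cmeas_synth.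
by apply: cmeasM; [exact: cmeas_cst|case: phi2].
Qed.

Let iw a y : 0 < a -> cintegrable (leb d) (fun t => w t * (gaussd a y t)%:C%C) /\
  cint (leb d) (fun t => w t * (gaussd a y t)%:C%C) = 0.
Proof.
move=> a0.
have i2 : cintegrable (leb d) (fun t => phi t * (gaussd a y t)%:C%C).
  by apply: cintegrable_L2M => //; exact: in_L2_gaussd.
have i1 : cintegrable (leb d) (fun t => synth phi t * (gaussd a y t)%:C%C).
  apply: (le_cintegrable _ _ (integrableZl measurableT (fine (\int[leb (d + d)]_z (normc (stft phi z))%:E)%E) (integrable_gaussd y a0))).
    apply: cmeasM; first exact: cmeas_synth.
    by apply: cmeas_real; apply: measurable_gaussd => //; exact: measurable_cst.
  move=> t; rewrite Normc.normcM normc_real ger0_norm ?gaussd_ge0//.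
  by apply: ler_wpM2r; [exact: gaussd_ge0|exact: synth_bound].
have E t : w t * (gaussd a y t)%:C%C = synth phi t * (gaussd a y t)%:C%C +
    (- inv_cst%:C%C) * (phi t * (gaussd a y t)%:C%C).
  by rewrite /w mulrDl mulrA.
have i3 := cintegrableZ (- inv_cst%:C%C) i2.
split; first by apply: eq_cintegrable (fun t => esym (E t)) (cintegrableD i1 i3).
under eq_cint do rewrite E.
by rewrite cintD// cintZ// weak_inversion// mulNr subrr.
Qed.

(** No integrability of [w] itself is established, so the criterion is applied to its product with
    one fixed Gaussian. That product still integrates to 0 against every Gaussian, because a product
    of Gaussians is a multiple of a Gaussian. *)
Let part_eq0 (P : R[i] -> R) : (P = @complex.Re R \/ P = @complex.Im R) ->
  {ae leb d, forall t, P (w t) = 0}.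
Proof.
move=> hP.
have PM (z : R[i]) (r : R) : P (z * r%:C%C) = P z * r.
  by case: hP => ->; case: z => p q /=; rewrite mulr0 ?subr0 ?add0r.
have Pint (f : 'rV[R]_d -> R[i]) : cintegrable (leb d) f ->
    (leb d).-integrable setT (EFin \o (fun t => P (f t))).
  by move=> [f1 f2]; case: hP => ->.
have Pcint (f : 'rV[R]_d -> R[i]) : P (cint (leb d) f) = \int[leb d]_t P (f t).
  by case: hP => ->.
have P0 : P 0 = 0 by case: hP => ->.
have u1 a y (a0 : 0 < a) : (leb d).-integrable setT (EFin \o (fun t => P (w t) * gaussd a y t)).
  have := Pint _ (iw y a0).1.
  by apply: eq_integrable => // t _ /=; rewrite PM.
have u2 a y (a0 : 0 < a) : \int[leb d]_t (P (w t) * gaussd a y t) = 0.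
  have := Pcint (fun t => w t * (gaussd a y t)%:C%C).
  rewrite (iw y a0).2 P0 => e; rewrite [RHS]e.
  by apply: eq_Rintegral => t _; rewrite PM.
have := gauss_test_eq0 (u1 1 0 ltr01) _.
have hu a y : 0 < a -> \int[leb d]_t (P (w t) * gaussd 1 0 t * gaussd a y t) = 0.
  move=> a0.
  have a1 : 0 < 1 + a by rewrite addr_gt0.
  pose c := (1 / (1 + a)) *: (0 : 'rV[R]_d) + (a / (1 + a)) *: y.
  transitivity (\int[leb d]_t (gaussd (1 * a / (1 + a)) 0 y * (P (w t) * gaussd (1 + a) c t))).
    by apply: eq_Rintegral => t _; rewrite -mulrA gaussd_mul// mulrCA.
  by rewrite (RintegralZl _ measurableT (u1 _ c a1)) u2// mulr0.
move=> /(_ hu); apply: filterS => t /eqP; rewrite mulf_eq0 => /orP[/eqP//|].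
by rewrite gt_eqF// gaussd_gt0.
Qed.

Lemma stft_inversion : {ae leb d, forall t, synth phi t = inv_cst%:C%C * phi t}.
Proof.
have h1 := part_eq0 (or_introl erefl); have h2 := part_eq0 (or_intror erefl).
apply: filterS2 h1 h2 => t e1 e2; apply/eqP; rewrite -subr_eq0 -mulNr.
by apply/eqP/complex_eqP; [exact: e1|exact: e2].
Qed.

Lemma inv_cst_gt0 : 0 < inv_cst.
Proof. by rewrite exprn_gt0// invr_gt0 sqrtr_gt0. Qed.

End stft_inversion.

(** * Off-diagonal decay of the Gram matrix *)

Section tfshift_theory.
Context (R : realType) (d : nat).
Local Notation leb := (@lebesgue_rV R).
Local Notation g0 := (@gaussian R d).
Implicit Types (l z : 'rV[R]_(d + d)) (f : 'rV[R]_d -> R[i]).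

Lemma tfshiftE l f t :
  tfshift l f t = expi (2 * pi * dotrV (rsubmx l) t) * f (t - lsubmx l).
Proof. by []. Qed.

Lemma normc_tfshift l f t : normc (tfshift l f t) = normc (f (t - lsubmx l)).
Proof. by rewrite tfshiftE Normc.normcM normc_expi mul1r. Qed.

Lemma mp_shiftN n (x : 'rV[R]_n) : measure_preserving (leb n) (leb n) (fun t => t - x).
Proof. exact: mp_shift. Qed.

Lemma cmeas_tfshift l f : cmeas f -> cmeas (tfshift l f).
Proof.
move=> mf; apply: cmeasM.
  apply: cmeas_expi; apply: measurable_funM => //.
  by apply: measurable_fun_dotrV => //; exact: measurable_cst.
by apply: (cmeas_comp _ mf); apply: measurable_funBrV => //; exact: measurable_cst.
Qed.

Lemma L2norm_tfshift l f : cmeas f -> (L2norm (tfshift l f) ^+ 2 = L2norm f ^+ 2)%E.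
Proof.
move=> mf; rewrite !L2norm_sqr; under eq_integral do rewrite normc_tfshift.
rewrite (mp_integral (mp_shiftN (lsubmx l)) (f := fun t => (normc (f t) ^+ 2)%:E))//.
by apply/measurable_EFinP; apply: measurable_funX; exact: measurable_normc.
Qed.

Lemma in_L2_tfshift l f : in_Lp 2 f -> in_Lp 2 (tfshift l f).
Proof.
move=> fi; have [mf _] := fi; apply/in_L2P; split; first exact: cmeas_tfshift.
by rewrite -L2norm_sqr L2norm_tfshift// L2norm_sqr; case/in_L2P : fi.
Qed.

(** Composing two time-frequency shifts gives the shift by the sum up to this phase; its modulus is
    1, so it drops out of all bounds. *)
Definition tfphase l z : R[i] := expi (- (2 * pi * dotrV (rsubmx z) (lsubmx l))).

Lemma tfshift_tfshift l z t :
  tfshift l (tfshift z g0) t = tfphase l z * tfshift (l + z) g0 t.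
Proof.
rewrite !tfshiftE /tfphase mulrA [RHS]mulrA -!expiD; congr (expi _ * g0 _).
  by rewrite linearD /= dotrVDl dotrVBr; ring.
by rewrite linearD opprD addrA.
Qed.

Lemma dotrV_split m n (x y : 'rV[R]_(m + n)) :
  dotrV x y = dotrV (lsubmx x) (lsubmx y) + dotrV (rsubmx x) (rsubmx y).
Proof. by rewrite /dotrV big_split_ord; congr (_ + _); apply: eq_bigr => i _; rewrite !mxE. Qed.

(** Completing the square gives a Gaussian in the time difference, the Fourier transform one in the
    frequency difference; both have parameter 1/2 and merge into a single Gaussian on phase
    space. *)
Lemma normc_gaussian_gram (p q : 'rV[R]_(d + d)) :
  normc (cint (leb d) (fun t => tfshift p g0 t * conjc (tfshift q g0 t))) =
  inv_cst R d * gaussd (2^-1) p q.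
Proof.
pose c := (1 / (1 + 1)) *: lsubmx p + (1 / (1 + 1)) *: lsubmx q.
have E t : tfshift p g0 t * conjc (tfshift q g0 t) =
    (gaussd (1 * 1 / (1 + 1)) (lsubmx p) (lsubmx q))%:C%C *
    ((gaussd 2 c t)%:C%C * expi (2 * pi * dotrV (rsubmx p - rsubmx q) t)).
  rewrite !tfshift_gaussianE conjcM conjc_expi conjc_real dotrVBl mulrBr expiD.
  rewrite [RHS]mulrA -rmorphM -(@gaussd_mul R d 1 1)//= rmorphM/=.
  by move: (expi _) (expi _) (_%:C%C) (_%:C%C) => a b e f; ring.
have two : (0 : R) < 2 by [].
have [i1 e1] := gaussd_fourier c (rsubmx p - rsubmx q) two.
under eq_cint do rewrite E.
rewrite cintZ// e1 mulrA Normc.normcM normc_expi mulr1 -rmorphM normc_real ger0_norm; last first.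
  by rewrite !mulr_ge0 ?gaussd_ge0 ?expR_ge0// exprn_ge0// invr_ge0.
rewrite mulrCA -/(inv_cst R d); congr (_ * _); rewrite /gaussd -expRD; congr expR.
rewrite -opprD; congr (- _).
have -> : dotrV (q - p) (q - p) = dotrV (p - q) (p - q).
  by rewrite -[q - p]opprB dotrVNl dotrVNr opprK.
have -> : dotrV (lsubmx q - lsubmx p) (lsubmx q - lsubmx p) = dotrV (lsubmx p - lsubmx q) (lsubmx p - lsubmx q).
  by rewrite -[lsubmx q - _]opprB dotrVNl dotrVNr opprK.
by rewrite [in RHS]dotrV_split !linearB /=; field.
Qed.

End tfshift_theory.

Section cross_gram.
Context (R : realType) (d : nat) (phi : 'rV[R]_d -> R[i]).
Hypothesis hphi : feichtinger phi.
Local Notation leb := (@lebesgue_rV R).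
Local Notation g0 := (@gaussian R d).
Local Notation V := (stft phi).
Local Notation nV z := (normc (V z)).
Implicit Types l z : 'rV[R]_(d + d).

Let phi2 : in_Lp 2 phi. Proof. by case: hphi. Qed.
Let mphi : cmeas phi. Proof. by case: phi2. Qed.
Let mV : cmeas V. Proof. exact: cintegrable_cmeas (cintegrable_stft hphi). Qed.
Let iV := cintegrable_normc (cintegrable_stft hphi).

(** Expanding [synth] bounds its pairing with a bounded function by pairings of Gaussian atoms. Used
    twice, with [H] the other [synth] atom and then with [H] a Gaussian atom, it turns both
    arguments of a Gram entry into Gaussian atoms. *)
Let pairing l (H : 'rV[R]_d -> R[i]) (M0 : R) : cmeas H -> (forall t, normc (H t) <= M0) ->
  (leb (d + d)).-integrable setT
    (fun z => (nV z * normc (cint (leb d) (fun t => tfshift (l + z) g0 t * H t)))%:E) /\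
  ((normc (cint (leb d) (fun t => tfshift l (synth phi) t * H t)))%:E <=
   \int[leb (d + d)]_z (nV z * normc (cint (leb d) (fun t => tfshift (l + z) g0 t * H t)))%:E)%E.
Proof.
move=> mH HM.
have M0_ge0 : 0 <= M0 := le_trans (normc_ge0 _) (HM 0).
pose f (z : 'rV[R]_(d + d) * 'rV[R]_d) := V z.1 * tfphase l z.1 * (tfshift (l + z.1) g0 z.2 * H z.2).
have mf : cmeas f.
  apply: cmeasM; apply: cmeasM.
  - exact: (cmeas_comp measurable_fst mV).
  - apply: cmeas_expi; apply: measurableT_comp => //; apply: measurable_funM => //.
    by apply: measurable_fun_dotrV; [exact: measurable_fun_rsubmx|exact: measurable_cst].
  - apply: cmeas_tfshift_gaussian => //; apply: measurable_funDrV => //; exact: measurable_cst.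
  - exact: (cmeas_comp measurable_snd mH).
have nf z t : normc (f (z, t)) = nV z * (gaussd 1 (lsubmx (l + z)) t * normc (H t)).
  rewrite -[f _]/(V z * tfphase l z * (tfshift (l + z) g0 t * H t)).
  by rewrite Normc.normcM Normc.normcM Normc.normcM normc_expi mulr1 normc_tfshift_gaussian.
have h1 z : 0 <= nV z by exact: normc_ge0.
have h2 z (t : 'rV[R]_d) : 0 <= gaussd 1 (lsubmx (l + z)) t * M0 by rewrite mulr_ge0 ?gaussd_ge0.
have h4 z : (leb d).-integrable setT (EFin \o (fun t => gaussd 1 (lsubmx (l + z)) t * M0)).
  exact: (integrableZr measurableT M0 (integrable_gaussd (lsubmx (l + z)) ltr01)).
have h5 z : (\int[leb d]_t (gaussd 1 (lsubmx (l + z)) t * M0)%:E <= ((Num.sqrt 1)^-1 ^+ d * M0)%:E)%E.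
  under eq_integral do rewrite EFinM.
  rewrite ge0_integralZr//.
  - by rewrite integral_gaussd.
  - exact: measurable_int (integrable_gaussd (lsubmx (l + z)) ltr01).
  - by move=> t _; rewrite lee_fin gaussd_ge0.
have h6 z t : normc (f (z, t)) <= nV z * (gaussd 1 (lsubmx (l + z)) t * M0).
  by rewrite nf ler_wpM2l// ler_wpM2l// gaussd_ge0.
have h7 z t : normc (f (z, t)) <= M0 * nV z.
  by rewrite nf mulrC ler_wpM2r// -[leRHS]mul1r ler_pM ?gaussd_ge0 ?normc_ge0// gaussd_le1.
have i1 := cintegrable_cint2 (m1 := leb (d + d)) (m2 := leb d) mf h1 h2 iV h4 h5 h6.
have e1 := dominated_cint_Fubini (m1 := leb (d + d)) (m2 := leb d) mf h1 h2 iV h4 h5 h6 h7.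
have iz z : cintegrable (leb d) (fun t => tfshift (l + z) g0 t * H t).
  apply: (le_cintegrable _ _ (h4 z)).
    by apply: cmeasM => //; apply: cmeas_tfshift_gaussian => //; exact: measurable_cst.
  by move=> t; rewrite Normc.normcM normc_tfshift_gaussian ler_wpM2l ?gaussd_ge0.
have E1 z : normc (cint (leb d) (fun t => f (z, t))) =
    nV z * normc (cint (leb d) (fun t => tfshift (l + z) g0 t * H t)).
  rewrite -[cint _ _]/(cint (leb d) (fun t => V z * tfphase l z * (tfshift (l + z) g0 t * H t))).
  by rewrite cintZ// Normc.normcM Normc.normcM normc_expi mulr1.
split.
  by apply: eq_integrable (cintegrable_normc i1) => // z _; rewrite E1.
have -> : cint (leb d) (fun t => tfshift l (synth phi) t * H t) =
    cint (leb d) (fun t => cint (leb (d + d)) (fun z => f (z, t))).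
  apply: eq_cint => t; rewrite tfshiftE /synth.
  have it : cintegrable (leb (d + d)) (fun z => V z * tfshift z g0 (t - lsubmx l)).
    apply: (le_cintegrable _ _ iV).
      by apply: cmeasM => //; apply: cmeas_tfshift_gaussian => //; exact: measurable_cst.
    move=> z; rewrite Normc.normcM normc_tfshift_gaussian ler_piMr ?normc_ge0//.
    exact: gaussd_le1.
  rewrite mulrAC -cintZ//; apply: eq_cint => z.
  rewrite -[f _]/(V z * tfphase l z * (tfshift (l + z) g0 t * H t)).
  rewrite -[X in _ = X]mulrA (mulrA (tfphase l z)) -tfshift_tfshift [in RHS]tfshiftE.
  by move: (expi _) (H t) (V z) (tfshift z g0 _) => a b e g; ring.
rewrite -e1; apply: le_trans (le_normc_cint i1) _.
by under eq_integral do rewrite E1.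
Qed.

Lemma cmeas_tfshift_synth l : cmeas (tfshift l (synth phi)).
Proof. by apply: cmeas_tfshift; exact: cmeas_synth. Qed.

Lemma synth_gram l m :
  ((normc (cint (leb d) (fun t => tfshift l (synth phi) t * conjc (tfshift m (synth phi) t))))%:E <=
   \int[leb (d + d)]_z \int[leb (d + d)]_w (nV z * (nV w * (inv_cst R d * gaussd 2^-1 (m + w) (l + z))))%:E)%E.
Proof.
pose M := fine (\int[leb (d + d)]_z (nV z)%:E)%E.
have mH := cmeas_conj (cmeas_tfshift_synth m).
have HM t : normc (conjc (tfshift m (synth phi) t)) <= M.
  by rewrite normcJ normc_tfshift; exact: synth_bound.
have [i1 le1] := pairing l mH HM.
pose F (z : 'rV[R]_(d + d) * 'rV[R]_(d + d)) : \bar R :=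
  (nV z.1 * (nV z.2 * (inv_cst R d * gaussd 2^-1 (m + z.2) (l + z.1))))%:E.
have mF : measurable_fun setT F.
  apply/measurable_EFinP; apply: measurable_funM.
    exact: (measurableT_comp (measurable_normc mV) measurable_fst).
  apply: measurable_funM.
    exact: (measurableT_comp (measurable_normc mV) measurable_snd).
  apply: measurable_funM => //; apply: measurable_gaussd; apply: measurable_funDrV => //; exact: measurable_cst.
have F0 (z : 'rV[R]_(d + d) * 'rV[R]_(d + d)) : (0 <= F z)%E.
  by rewrite lee_fin !mulr_ge0 ?normc_ge0 ?gaussd_ge0//; exact/ltW/inv_cst_gt0.
apply: le_trans le1 _; apply: ge0_le_integral => //.
- by move=> z _; rewrite lee_fin mulr_ge0 ?normc_ge0.
- exact: measurable_int i1.
- exact: (measurable_fun_fubini_tonelli_F (m2 := leb (d + d)) F mF F0).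
move=> z _.
have mH2 : cmeas (fun t => conjc (tfshift (l + z) g0 t)).
  by apply: cmeas_conj; apply: cmeas_tfshift_gaussian => //; exact: measurable_cst.
have HM2 t : normc (conjc (tfshift (l + z) g0 t)) <= 1.
  by rewrite normcJ normc_tfshift_gaussian gaussd_le1.
have [i2 le2] := pairing m mH2 HM2.
have -> : normc (cint (leb d) (fun t => tfshift (l + z) g0 t * conjc (tfshift m (synth phi) t))) =
    normc (cint (leb d) (fun t => tfshift m (synth phi) t * conjc (tfshift (l + z) g0 t))).
  rewrite -[RHS]normcJ -cint_conj; last first.
    apply: (le_cintegrable _ _ (integrableZl measurableT M (integrable_gaussd (lsubmx (l + z)) ltr01))).
      by apply: cmeasM => //; exact: cmeas_tfshift_synth.
    move=> t; rewrite Normc.normcM normcJ normc_tfshift_gaussian; apply: ler_wpM2r; first exact: gaussd_ge0.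
    by rewrite normc_tfshift; exact: synth_bound.
  congr normc; apply: eq_cint => t; by rewrite [RHS]conjcM conjcK mulrC.
under [leRHS]eq_integral do rewrite EFinM.
have mi : measurable_fun setT (fun w => (nV w * (inv_cst R d * gaussd 2^-1 (m + w) (l + z)))%:E).
  apply/measurable_EFinP; apply: measurable_funM; first exact: measurable_normc.
  apply: measurable_funM => //; apply: measurable_gaussd; last exact: measurable_cst.
  by apply: measurable_funDrV => //; exact: measurable_cst.
rewrite ge0_integralZl//; last 2 first.
- move=> w _; rewrite lee_fin !mulr_ge0 ?normc_ge0 ?gaussd_ge0//.
  exact/ltW/inv_cst_gt0.
- by rewrite lee_fin normc_ge0.
rewrite EFinM lee_wpmul2l ?lee_fin ?normc_ge0//.
apply: le_trans le2 _; rewrite le_eqVlt; apply/orP; left; apply/eqP.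
by apply: eq_integral => w _; congr (_ * _)%:E; exact: normc_gaussian_gram.
Qed.

(** Almost everywhere [synth phi] is [inv_cst] times [phi], and the factor enters once for each
    argument. *)
Lemma phi_gram l m :
  normc (L2inner (tfshift l phi) (tfshift m phi)) =
  (inv_cst R d)^-1 ^+ 2 *
  normc (cint (leb d) (fun t => tfshift l (synth phi) t * conjc (tfshift m (synth phi) t))).
Proof.
have k0 : inv_cst R d != 0 by rewrite gt_eqF// inv_cst_gt0.
pose k : R[i] := ((inv_cst R d)^-1 ^+ 2)%:C%C.
have ae1 (p : 'rV[R]_(d + d)) := mp_ae (mp_shiftN (lsubmx p)) (stft_inversion hphi).
have E : {ae leb d, forall t, tfshift l phi t * conjc (tfshift m phi t) =
   k * (tfshift l (synth phi) t * conjc (tfshift m (synth phi) t))}.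
  apply: filterS2 (ae1 l) (ae1 m) => t; rewrite !tfshiftE => -> ->.
  rewrite !conjcM conjc_real /k rmorphXn fmorphV/=.
  have k1 : ((inv_cst R d)%:C%C : R[i]) != 0.
    by apply: contra k0 => /eqP/complexI ->.
  move: (inv_cst R d)%:C%C k1 (expi _) (phi _) (phi _)^*%C (Complex _ _) => q q0 a b e g.
  by field; exact: q0.
have kk : (inv_cst R d ^+ 2)%:C%C * k = 1.
  by rewrite /k -rmorphM -exprMn mulfV// expr1n.
have mL : cmeas (fun t => tfshift l phi t * conjc (tfshift m phi t)).
  by apply: cmeasM; [|apply: cmeas_conj]; exact: cmeas_tfshift.
(* Inherited from the product of the two square-integrable atoms of [phi], through the relation
   [E]. *)
have iS : cintegrable (leb d) (fun t => tfshift l (synth phi) t * conjc (tfshift m (synth phi) t)).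
  have i0 : cintegrable (leb d) (fun t => tfshift l phi t * conjc (tfshift m phi t)).
    by apply: cintegrable_L2M; [|apply: in_L2_conj]; exact: in_L2_tfshift.
  have mS : cmeas (fun t => tfshift l (synth phi) t * conjc (tfshift m (synth phi) t)).
    by apply: cmeasM; [|apply: cmeas_conj]; exact: cmeas_tfshift_synth.
  apply: cintegrableP => //.
  have i3 := cintegrable_normc (cintegrableZ ((inv_cst R d ^+ 2)%:C%C) i0).
  have := integrable_lty measurableT i3; apply: le_lt_trans.
  rewrite le_eqVlt; apply/orP; left; apply/eqP; apply: ae_eq_integral => //.
  - by apply/measurable_EFinP; exact: measurable_normc.
  - exact: measurable_int i3.
  - by apply: filterS E => t e _; rewrite e mulrA kk mul1r.
rewrite -[L2inner _ _]/(cint (leb d) (fun t => tfshift l phi t * conjc (tfshift m phi t))).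
rewrite (ae_eq_cint mL _ E); last first.
  by apply: cmeasM; [exact: cmeas_cst|exact: cintegrable_cmeas iS].
rewrite cintZ// Normc.normcM /k normc_real ger0_norm// exprn_ge0// invr_ge0 ltW// inv_cst_gt0//.
Qed.

End cross_gram.

Section esum_fsets.
Context (R : realType) (T : choiceType) (S : set T) (a : T -> \bar R).

Lemma fset_le_esum (F : {fset T}) : [set` F] `<=` S ->
  (\sum_(l <- F) a l <= \esum_(l in S) a l)%E.
Proof.
move=> FS; apply: ereal_sup_ubound; exists [set` F].
  by split => //; exact: finite_fset.
by rewrite fsbig_finite//= set_fsetK.
Qed.

Lemma esum_le_fset x : (forall F : {fset T}, [set` F] `<=` S -> (\sum_(l <- F) a l <= x)%E) ->
  (\esum_(l in S) a l <= x)%E.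
Proof.
move=> h; apply: ge_ereal_sup => _ [X [finX XS] <-].
by rewrite fsbig_finite//=; apply: h; rewrite fset_setK.
Qed.

Lemma esum_approx (x : \bar R) : (x < \esum_(l in S) a l)%E ->
  exists2 F : {fset T}, [set` F] `<=` S & (x < \sum_(l <- F) a l)%E.
Proof.
move=> /ereal_sup_gt[_ [X [finX XS] <-]] xX; exists (fset_set X).
  by rewrite fset_setK.
by rewrite -fsbig_finite.
Qed.

End esum_fsets.

Section cubes.
Context (R : realType) (n : nat).
Local Notation leb := (@lebesgue_rV R n).

Lemma cubeE (x : 'rV[R]_n) r :
  cube x r = rVbox (fun i => `[x ord0 i - r, x ord0 i + r]%classic).
Proof. by apply/seteqP; split => y /= h i; have := h i; rewrite /= in_itv. Qed.

Lemma measurable_cube (x : 'rV[R]_n) r : measurable (cube x r).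
Proof. by rewrite cubeE; apply: measurable_rVbox => i; exact: measurable_itv. Qed.

Lemma lebesgue_cube (x : 'rV[R]_n) r : 0 <= r -> leb (cube x r) = ((2 * r) ^+ n)%:E.
Proof.
move=> r0; rewrite cubeE lebesgue_rVbox; last by move=> i; exact: measurable_itv.
have mE (i : 'I_n) : lebesgue_measure (`[x ord0 i - r, x ord0 i + r]%classic : set R) = (2 * r)%:E.
  rewrite lebesgue_measure_itv /= lte_fin; case: ltP => h.
    by rewrite -EFinB; congr EFin; ring.
  have -> : r = 0 by lra.
  by rewrite mulr0.
by under eq_bigr do rewrite mE; rewrite prodEFin prodr_const card_ord.
Qed.

Lemma cubeP (x y : 'rV[R]_n) r : cube x r y <-> forall i, `|y ord0 i - x ord0 i| <= r.
Proof.
split=> h i; have := h i; rewrite ler_norml.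
  by move=> /andP[h1 h2]; apply/andP; split; lra.
by move=> /andP[h1 h2]; apply/andP; split; lra.
Qed.

(** For [u] in the cube, [|u - c|^2 <= 2 |x - c|^2 + 2 n]. Halving the parameter and paying
    [expR (pi n / 2)] thus bounds the value at [x] by every value in the cube, hence by the
    integral, since the volume [2^n] is at least 1. *)
Lemma gaussd_le_cube (c x : 'rV[R]_n) :
  ((gaussd 2^-1 c x)%:E <= (expR (pi * n%:R / 2))%:E * \int[leb]_(u in cube x 1) (gaussd 4^-1 c u)%:E)%E.
Proof.
pose e := expR (- (pi * n%:R / 2)) * gaussd 2^-1 c x.
have e0 : 0 <= e by rewrite mulr_ge0 ?expR_ge0 ?gaussd_ge0.
have mg : measurable_fun (cube x 1) (fun u => (gaussd 4^-1 c u)%:E).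
  by apply: measurable_funTS; apply/measurable_EFinP; apply: measurable_gaussd => //; exact: measurable_cst.
have h : (e%:E <= \int[leb]_(u in cube x 1) (gaussd 4^-1 c u)%:E)%E.
  apply: (@le_trans _ _ (\int[leb]_(u in cube x 1) e%:E)%E).
    rewrite integral_cst; last exact: measurable_cube.
    by rewrite [X in (_ * X)%E](lebesgue_cube x ler01) mulr1 -EFinM lee_fin ler_peMr// exprn_ege1// ler1n.
  apply: ge0_le_integral => //.
  - exact: measurable_cube.
  - move=> u /cubeP ux; rewrite lee_fin /e /gaussd -expRD ler_expR -opprD lerN2.
    have h1 : dotrV (u - c) (u - c) <= 2 * dotrV (x - c) (x - c) + 2 * n%:R.
      have -> : (n%:R : R) = \sum_(i < n) 1 by rewrite sumr_const card_ord.
      rewrite /dotrV !mulr_sumr -big_split /=.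
      apply: ler_sum => i _; rewrite !mxE.
      have := ux i; rewrite ler_norml => /andP[h1 h2].
      move: (u _ _) (x _ _) (c _ _) h1 h2 => p q r h1 h2.
      have h3 : (p - q) ^+ 2 <= 1 by rewrite -(expr1n _ 2) -[leLHS]real_normK ?num_real// lerXn2r ?nnegrE// ler_norml h1 h2.
      have := sqr_ge0 ((p - q) - (q - r)); lra.
    have p0 := pi_ge0 R.
    have := ler_wpM2l p0 h1.
    by move: (dotrV _ _) (dotrV _ _) (pi : R) (n%:R : R) => D D' p N; lra.
have -> : gaussd 2^-1 c x = expR (pi * n%:R / 2) * e.
  by rewrite /e mulrA -expRD subrr expR0 mul1r.
by rewrite EFinM lee_wpmul2l// lee_fin expR_ge0.
Qed.

End cubes.

Lemma mulr_shuffle5 (R : comPzRingType) (e a b k g : R) :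
  e * (a * (b * (k * g))) = a * b * (e * k) * g.
Proof. by ring. Qed.

Section gram_envelope.
Context (R : realType) (d : nat) (phi : 'rV[R]_d -> R[i]).
Hypothesis hphi : feichtinger phi.
Local Notation leb := (@lebesgue_rV R).
Local Notation V := (stft phi).
Local Notation nV z := (normc (V z)).
Local Notation nu := (leb ((d + d) + (d + d))).
Local Notation P := 'rV[R]_((d + d) + (d + d)).

Let mnV : measurable_fun setT (fun z => nV z).
Proof. exact: measurable_normc (cintegrable_cmeas (cintegrable_stft hphi)). Qed.

Let iV := cintegrable_normc (cintegrable_stft hphi).

Let N (p : P) : R := nV (lsubmx p) * nV (rsubmx p).

Let N_ge0 p : 0 <= N p. Proof. by rewrite mulr_ge0 ?normc_ge0. Qed.

Let iN : nu.-integrable setT (EFin \o N).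
Proof. exact: (integrable_split (u := fun z => nV z) (v := fun z => nV z) iV iV). Qed.

Let mN : measurable_fun setT N.
Proof. by apply/measurable_EFinP; exact: measurable_int iN. Qed.

(** Collects the squared inverse of the inversion constant, the constant of the Gaussian Gram matrix
    and the loss in [gaussd_le_cube]. *)
Let K : R := (inv_cst R d)^-1 ^+ 2 * inv_cst R d * expR (pi * (d + d)%:R / 2).

Let K_ge0 : 0 <= K.
Proof. by rewrite !mulr_ge0 ?expR_ge0 ?exprn_ge0 ?invr_ge0// ltW// inv_cst_gt0. Qed.

Let F (p : P) (u : 'rV[R]_(d + d)) : R :=
  N p * (K * gaussd 4^-1 (rsubmx p - lsubmx p) u).

Let F_ge0 p u : 0 <= F p u.
Proof. by apply: mulr_ge0; [exact: N_ge0|apply: mulr_ge0; [exact: K_ge0|exact: gaussd_ge0]]. Qed.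

Let mF : measurable_fun setT (fun z : P * 'rV[R]_(d + d) => F z.1 z.2).
Proof.
apply: measurable_funM; first exact: (measurableT_comp mN measurable_fst).
apply: measurable_funM => //; apply: measurable_gaussd => //.
apply: measurable_funBrV.
  by apply: measurable_fun_rsubmx; exact: measurable_fst.
by apply: measurable_fun_lsubmx; exact: measurable_fst.
Qed.

Let FE (z : P * 'rV[R]_(d + d)) : \bar R := (F z.1 z.2)%:E.

Let mFE : measurable_fun setT FE. Proof. exact/measurable_EFinP. Qed.

Let FE_ge0 z : (0 <= FE z)%E. Proof. by rewrite lee_fin. Qed.

(** With [p] the pair (z, w), this is a constant times the convolution of [|V|], of its reflection
    and of a Gaussian. *)
Definition envelope (u : 'rV[R]_(d + d)) : \bar R := (\int[nu]_p (F p u)%:E)%E.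

Lemma envelope_ge0 u : (0 <= envelope u)%E.
Proof. by apply: integral_ge0 => p _; rewrite lee_fin. Qed.

Lemma measurable_envelope : measurable_fun setT envelope.
Proof.
exact: (measurable_fun_fubini_tonelli_G (m1 := nu) FE mFE FE_ge0).
Qed.

(** Integrating over [u] first leaves a constant times the square of the integral of [|V|]. *)
Lemma integral_envelope_lty : (\int[leb (d + d)]_u envelope u < +oo)%E.
Proof.
rewrite -(fubini_tonelli (m1 := nu) (m2 := leb (d + d)) FE)// /FE /=.
have q4 : (0 : R) < 4^-1 by [].
under eq_integral => p _.
  under eq_integral do rewrite EFinM.
  rewrite ge0_integralZl//; last 3 first.
  - apply/measurable_EFinP; apply: measurable_funM => //; apply: measurable_gaussd => //; exact: measurable_cst.
  - by move=> u _; rewrite lee_fin mulr_ge0 ?gaussd_ge0.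
  - by rewrite lee_fin.
  under eq_integral do rewrite EFinM.
  rewrite ge0_integralZl//; last 2 first.
  - by apply/measurable_EFinP; apply: measurable_gaussd => //; exact: measurable_cst.
  - by move=> u _; rewrite lee_fin gaussd_ge0.
  rewrite integral_gaussd//.
  over.
rewrite -EFinM ge0_integralZr//.
- have fN : (\int[nu]_p (N p)%:E)%E \is a fin_num.
    exact: integrable_fin_num.
  by rewrite -(fineK fN) -EFinM ltry.
- exact/measurable_EFinP.
- by move=> p _; rewrite lee_fin.
- by rewrite lee_fin; apply: mulr_ge0; [exact: K_ge0|rewrite exprn_ge0// invr_ge0].
Qed.

(** The double integral bounding a Gram entry contains a Gaussian evaluated at [l - m]; bounding
    that value by an integral over the cube prepares sums of entries to be bounded by integrals. *)
Lemma gram_le_envelope l m :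
  ((normc (L2inner (tfshift l phi) (tfshift m phi)))%:E <=
   \int[leb (d + d)]_(u in cube (l - m) 1) envelope u)%E.
Proof.
have k2 : 0 <= (inv_cst R d)^-1 ^+ 2 by rewrite exprn_ge0// invr_ge0 ltW// inv_cst_gt0.
(* The indicator of the cube is put into the integrand so that Tonelli applies on the whole
   product. *)
pose G (z : P * 'rV[R]_(d + d)) : R := F z.1 z.2 * \1_(cube (l - m) 1) z.2.
have mG : measurable_fun setT (EFin \o G).
  apply/measurable_EFinP; apply: measurable_funM => //.
  apply: (measurableT_comp (f := \1_(cube (l - m) 1) : _ -> R)) => //.
  by apply: measurable_indic; exact: measurable_cube.
have G0 z : (0 <= (EFin \o G) z)%E.
  by rewrite lee_fin mulr_ge0// indicE.
have -> : (\int[leb (d + d)]_(u in cube (l - m) 1) envelope u = \int[leb (d + d)]_u \int[nu]_p (G (p, u))%:E)%E.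
  rewrite integral_mkcond; apply: eq_integral => u _; rewrite patchE /G /= indicE.
  case: (u \in _); first by apply: eq_integral => p _; rewrite mulr1.
  by under eq_integral do rewrite mulr0; rewrite integral0.
rewrite -(fubini_tonelli (m1 := nu) (m2 := leb (d + d)) (EFin \o G))//.
rewrite phi_gram// EFinM.
apply: le_trans (lee_wpmul2l _ (synth_gram hphi l m)) _; first by rewrite lee_fin.
pose H (p : P) : \bar R :=
  (nV (lsubmx p) * (nV (rsubmx p) * (inv_cst R d * gaussd 2^-1 (m + rsubmx p) (l + lsubmx p))))%:E.
have mH : measurable_fun setT H.
  have ml : measurable_fun setT (@lsubmx R 1 (d + d) (d + d)) by exact: measurable_fun_lsubmx.
  have mr : measurable_fun setT (@rsubmx R 1 (d + d) (d + d)) by exact: measurable_fun_rsubmx.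
  apply/measurable_EFinP; apply: measurable_funM; first exact: (measurableT_comp mnV ml).
  apply: measurable_funM; first exact: (measurableT_comp mnV mr).
  apply: measurable_funM => //; apply: measurable_gaussd; apply: measurable_funDrV => //; exact: measurable_cst.
have H0 (p : P) : (0 <= H p)%E.
  rewrite lee_fin; apply: mulr_ge0; first exact: normc_ge0.
  apply: mulr_ge0; first exact: normc_ge0.
  by apply: mulr_ge0; [exact/ltW/inv_cst_gt0|exact: gaussd_ge0].
have -> : (\int[leb (d + d)]_z \int[leb (d + d)]_w
    (nV z * (nV w * (inv_cst R d * gaussd 2^-1 (m + w) (l + z))))%:E = \int[nu]_p H p)%E.
  rewrite -(mp_integral (mp_row_mx R (d + d) (d + d)) mH).
  have mH' : measurable_fun setT (fun p : 'rV[R]_(d + d) * 'rV[R]_(d + d) => H (row_mx p.1 p.2)).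
    exact: (measurableT_comp mH (@measurable_row_mx R (d + d) (d + d))).
  rewrite (fubini_tonelli1 (m1 := leb (d + d)) (m2 := leb (d + d)) _ mH' (fun p => H0 (row_mx p.1 p.2))).
  apply: eq_integral => z _; apply: eq_integral => w _.
  by rewrite /H row_mxKl row_mxKr.
rewrite -ge0_integralZl//.
apply: ge0_le_integral => //.
- by move=> p _; rewrite mule_ge0// lee_fin.
- exact: measurable_funeM.
- exact: (measurable_fun_fubini_tonelli_F (m2 := leb (d + d)) (EFin \o G)).
move=> p _.
have -> : (\int[leb (d + d)]_u (G (p, u))%:E =
    (N p * K)%:E * \int[leb (d + d)]_(u in cube (l - m) 1) (gaussd 4^-1 (rsubmx p - lsubmx p) u)%:E)%E.
  rewrite [in RHS]integral_mkcond -ge0_integralZl//.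
  - apply: eq_integral => u _; rewrite patchE /G /F /= indicE.
    by case: (u \in _); rewrite ?mulr1 ?mulr0 ?mule0// -EFinM mulrA.
  - apply/(measurable_restrictT _ _).1; first exact: measurable_cube.
    by apply: measurable_funTS; apply/measurable_EFinP; apply: measurable_gaussd => //; exact: measurable_cst.
  - by move=> u _; rewrite patchE; case: ifP => // _; rewrite lee_fin gaussd_ge0.
  - by rewrite lee_fin mulr_ge0.
rewrite /H; have -> : gaussd 2^-1 (m + rsubmx p) (l + lsubmx p) = gaussd 2^-1 (rsubmx p - lsubmx p) (l - m).
  rewrite /gaussd (_ : l + lsubmx p - (m + rsubmx p) = l - m - (rsubmx p - lsubmx p))//.
  by rewrite opprB opprD addrACA.
have := gaussd_le_cube (rsubmx p - lsubmx p) (l - m).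
set I := (\int[_]_(u in _) _)%E => hI.
have -> : (((inv_cst R d)^-1 ^+ 2)%:E * (nV (lsubmx p) * (nV (rsubmx p) * (inv_cst R d * gaussd 2^-1 (rsubmx p - lsubmx p) (l - m))))%:E =
   (N p * ((inv_cst R d)^-1 ^+ 2 * inv_cst R d))%:E * (gaussd 2^-1 (rsubmx p - lsubmx p) (l - m))%:E)%E.
  by rewrite -!EFinM; exact: (congr1 EFin (mulr_shuffle5 _ _ _ _ _)).
have h0 : (0 <= (N p * ((inv_cst R d)^-1 ^+ 2 * inv_cst R d))%:E)%E.
  rewrite lee_fin; apply: mulr_ge0 => //; apply: mulr_ge0; first by rewrite exprn_ge0// invr_ge0 ltW// inv_cst_gt0.
  exact/ltW/inv_cst_gt0.
apply: (le_trans (@lee_wpmul2l R _ h0 _ _ hI)).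
by rewrite muleA -EFinM /K !mulrA.
Qed.

End gram_envelope.

Lemma sume_const_seq (R : realType) (T : Type) (s : seq T) (x : \bar R) :
  (0 <= x)%E -> (\sum_(i <- s) x = (size s)%:R%:E * x)%E.
Proof.
move=> x0; elim: s => [|a s IH]; first by rewrite big_nil mul0e.
rewrite big_cons IH -[in RHS]natr1 EFinD ge0_muleDl ?lee_fin//.
by rewrite mul1e addeC.
Qed.

Lemma lee_sum_fset (R : realType) (T : choiceType) (F : {fset T}) (f g : T -> \bar R) :
  (forall l, l \in F -> (f l <= g l)%E) -> (\sum_(l <- F) f l <= \sum_(l <- F) g l)%E.
Proof. by move=> fg; rewrite big_seq [leRHS]big_seq; apply: lee_sum. Qed.

(** * Relative separation from the Bessel bound *)

Section relative_separation.
Context (R : realType) (d : nat) (phi : 'rV[R]_d -> R[i]).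
Hypothesis hphi : feichtinger phi.
Variables (L : set 'rV[R]_(d + d)) (B : R).
Hypothesis hB : bessel_bound phi L B.
Local Notation leb := (@lebesgue_rV R).
Local Notation g0 := (@gaussian R d).
Local Notation V := (stft phi).
Local Notation nV z := (normc (V z)).

Let phi2 : in_Lp 2 phi. Proof. by case: hphi. Qed.
Let mphi : cmeas phi. Proof. by case: phi2. Qed.
Let mV : cmeas V. Proof. exact: cintegrable_cmeas (cintegrable_stft hphi). Qed.

(** Covariance: shifting both arguments by [- l] changes phases only, and the modulus is that of
    [stft] at [z - l]. *)
Lemma normc_gram_stft z l :
  normc (L2inner (tfshift z g0) (tfshift l phi)) = nV (z - l).
Proof.
have e1 t : tfshift z g0 t = conjc (tfphase l (z - l)) * tfshift l (tfshift (z - l) g0) t.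
  rewrite tfshift_tfshift mulrA [conjc _ * _]mulrC mulc_conj normc_expi expr1n mul1r.
  by rewrite addrC subrK.
pose f := fun t => phi t * conjc (tfshift (z - l) g0 t).
have cf : cintegrable (leb d) f.
  by apply: cintegrable_L2M => //; apply: in_L2_conj; exact: in_L2_tfshift_gaussian.
have e2 t : tfshift z g0 t * conjc (tfshift l phi t) =
    conjc (tfphase l (z - l)) * conjc (f (t - lsubmx l)).
  rewrite e1 -mulrA; congr (_ * _); rewrite 2!tfshiftE [in LHS]conjcM mulrACA mulc_conj normc_expi expr1n mul1r.
  by rewrite /f [in RHS]conjcM conjcK mulrC.
rewrite (_ : L2inner _ _ = conjc (tfphase l (z - l)) * conjc (V (z - l))).
  by rewrite Normc.normcM !normcJ normc_expi mul1r.
rewrite -[LHS]/(cint (leb d) (fun t => tfshift z g0 t * conjc (tfshift l phi t))).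
rewrite (eq_cint _ e2) cintZ; last exact: (mp_cintegrable (mp_shiftN (lsubmx l)) (cintegrable_conj cf)).
congr (_ * _); rewrite (mp_cint (mp_shiftN (lsubmx l)) (f := fun t => conjc (f t))).
  by rewrite cint_conj.
exact: cintegrable_cmeas (cintegrable_conj cf).
Qed.

Let mV2 (l : 'rV[R]_(d + d)) :
  measurable_fun setT (fun z : 'rV[R]_(d + d) => (nV (z - l) ^+ 2)%:E).
Proof.
apply/measurable_EFinP; apply: measurable_funX.
apply: measurable_normc; apply: (cmeas_comp _ mV).
by apply: measurable_funBrV => //; exact: measurable_cst.
Qed.

Let mV2' : measurable_fun setT (fun z : 'rV[R]_(d + d) => (nV z ^+ 2)%:E).
Proof. by apply/measurable_EFinP; apply: measurable_funX; exact: measurable_normc. Qed.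

Definition stft_mass (rho : R) : \bar R := (\int[leb (d + d)]_(z in cube 0 rho) (nV z ^+ 2)%:E)%E.

(** If all these masses vanished, [stft] would be 0 almost everywhere, [synth phi] identically 0,
    and the inversion formula would force [phi] to be 0 almost everywhere. *)
Lemma stft_mass_gt0 : (0 < L2norm phi ^+ 2)%E -> exists k : nat, (0 < stft_mass k%:R)%E.
Proof.
move=> phi0; apply: contrapT => /forallNP h.
have h1 (k : nat) : {ae leb (d + d), forall z, cube 0 k%:R z -> nV z ^+ 2 = 0}.
  have e0 : stft_mass k%:R = 0%E.
    apply/eqP; rewrite eq_le leNgt; apply/andP; split; first exact/negP/h.
    by apply: integral_ge0 => z _; rewrite lee_fin sqr_ge0.
  have := (ae_eq_integral_abs (leb (d + d)) (measurable_cube 0 k%:R) (measurable_funTS mV2')).1.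
  rewrite (_ : (\int[_]_(x in _) _)%E = stft_mass k%:R); last first.
    by apply: eq_integral => z _; rewrite gee0_abs// lee_fin sqr_ge0.
  by move=> /(_ e0); apply: filterS => z hz cz; have h0 : ((nV z ^+ 2)%:E = 0%:E)%E := hz cz; case: h0.
have V0 : {ae leb (d + d), forall z, V z = 0}.
  move/ae_foralln : h1; apply: filterS => z hz.
  apply/Normc.eq0_normc/eqP; rewrite -[_ == _](sqrf_eq0 (nV z)); apply/eqP.
  apply: (hz (Num.truncn (\sum_i `|z ord0 i|)).+1).
  apply/cubeP => i; rewrite mxE subr0; apply: le_trans (ltW (truncnS_gt _)).
  by rewrite (bigD1 i)//= lerDl sumr_ge0.
have s0 t : synth phi t = 0.
  rewrite /synth -(cint0 (leb (d + d))); apply: ae_eq_cint.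
  - apply: cmeasM => //; apply: (cmeas_tfshift_gaussian (T := 'rV[R]_(d + d))) => //; exact: measurable_cst.
  - exact: cmeas_cst.
  - by apply: filterS V0 => z ->; rewrite mul0r.
have p0 : {ae leb d, forall t, phi t = 0}.
  apply: filterS (stft_inversion hphi) => t; rewrite s0 => /esym/eqP.
  rewrite mulf_eq0 => /orP[/eqP /(congr1 (@complex.Re R)) /= k0|/eqP//].
  by have := inv_cst_gt0 R d; rewrite k0 ltxx.
move: phi0; rewrite L2norm_sqr (_ : (\int[_]_t _)%E = 0%E) ?ltxx//.
rewrite -(integral0 (leb d) setT); apply: ae_eq_integral => //.
  by apply/measurable_EFinP; apply: measurable_funX; exact: measurable_normc.
by apply: filterS p0 => t -> _; rewrite Normc.normc0 expr0n.
Qed.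

(* The Bessel inequality for the Gaussian atom at z is integrated over z. *)
Lemma card_cube_mass (F : {fset 'rV[R]_(d + d)}) y r rho : 0 <= r -> 0 <= rho ->
  [set` F] `<=` L -> [set` F] `<=` cube y r ->
  ((#|` F|)%:R%:E * stft_mass rho <=
   (fine (B%:E * L2norm g0 ^+ 2)%E * (2 * (r + rho)) ^+ (d + d))%:E)%E.
Proof.
move=> r0 rho0 FL Fy.
have g0E : tfshift 0 g0 = g0.
  by apply/funext => t; rewrite tfshiftE !raddf0 dotrV0l mulr0 expi0 mul1r addr0.
have gi : in_Lp 2 g0 by rewrite -g0E; exact: in_L2_tfshift_gaussian.
have mg : cmeas g0 by case: gi.
have gf : (L2norm g0 ^+ 2)%E \is a fin_num.
  rewrite ge0_fin_numE ?L2norm_sqr; first by case/in_L2P : gi.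
  by rewrite integral_ge0// => t _; rewrite lee_fin sqr_ge0.
have h z : (\sum_(l <- F) (nV (z - l) ^+ 2)%:E <= (fine (B%:E * L2norm g0 ^+ 2)%E)%:E)%E.
  have -> : ((fine (B%:E * L2norm g0 ^+ 2)%E)%:E = B%:E * L2norm (tfshift z g0) ^+ 2)%E.
    by rewrite fineK ?L2norm_tfshift//; apply: fin_numM.
  apply: le_trans (hB (in_L2_tfshift_gaussian z)).
  apply: le_trans (fset_le_esum (fun l => (normc (L2inner (tfshift z g0) (tfshift l phi)) ^+ 2)%:E) FL).
  by apply: lee_sum => l _; rewrite normc_gram_stft.
move: (fine (B%:E * L2norm g0 ^+ 2)%E) h => K h.
have -> : ((#|` F|)%:R%:E * stft_mass rho = \sum_(l <- F) stft_mass rho)%E.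
  by rewrite sume_const_seq// integral_ge0// => z _; rewrite lee_fin sqr_ge0.
have ms : measurable_fun setT (fun z : 'rV[R]_(d + d) => (\sum_(l <- F) (nV (z - l) ^+ 2)%:E)%E).
  by apply: emeasurable_sum => l; exact: mV2.
have rr : 0 <= r + rho by rewrite addr_ge0.
rewrite EFinM -(lebesgue_cube y rr) -integral_cst; last exact: measurable_cube.
apply: (@le_trans _ _ (\int[leb (d + d)]_(z in cube y (r + rho)) \sum_(l <- F) (nV (z - l) ^+ 2)%:E)%E); last first.
  apply: ge0_le_integral.
  - exact: measurable_cube.
  - by move=> z _; apply: sume_ge0 => l _; rewrite lee_fin sqr_ge0.
  - exact: measurable_funTS ms.
  - exact: measurable_cst.
  - by move=> z _; apply: le_trans (h z) _.
rewrite ge0_integral_sum; last first.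
- by move=> l z _; rewrite lee_fin sqr_ge0.
- by move=> l; apply: measurable_funTS; exact: mV2.
- exact: measurable_cube.
apply: lee_sum_fset => l lF.
have -> : stft_mass rho = (\int[leb (d + d)]_(z in cube l rho) (nV (z - l) ^+ 2)%:E)%E.
  rewrite /stft_mass integral_mkcond -(mp_integral (mp_shiftN l)).
    rewrite [RHS]integral_mkcond; apply: eq_integral => z _; rewrite !patchE.
    rewrite (_ : (z - l \in cube 0 rho) = (z \in cube l rho))//.
    apply/idP/idP => /set_mem /cubeP hz; apply/mem_set/cubeP => i; have := hz i; by rewrite !mxE subr0.
  by apply/(measurable_restrictT _ _).1; [exact: measurable_cube|exact: measurable_funTS].
(* For [l] in the cube of radius [r] at [y], the cube of radius [rho] at [l] lies in that of radius
   [r + rho] at [y]. *)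
apply: ge0_subset_integral; [exact: measurable_cube|exact: measurable_cube|exact: (measurable_funTS (mV2 l))| |].
  by move=> z _; rewrite lee_fin sqr_ge0.
move=> z /cubeP hz; apply/cubeP => i; have /cubeP/(_ i) := Fy _ lF; have := hz i.
by rewrite !ler_norml => /andP[? ?] /andP[? ?]; apply/andP; split; lra.
Qed.

Lemma card_cube_bound : (0 < L2norm phi ^+ 2)%E ->
  exists C rho : R, [/\ 0 <= C, 0 <= rho &
    forall (F : {fset 'rV[R]_(d + d)}) y r, 0 <= r ->
    [set` F] `<=` L -> [set` F] `<=` cube y r ->
    (#|` F|)%:R <= C * (2 * (r + rho)) ^+ (d + d)].
Proof.
move=> /stft_mass_gt0[k k0].
(* A finite positive lower bound of the mass is extracted; 1 serves if the mass is infinite. *)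
have [q q0 qk] : exists2 q : R, 0 < q & (q%:E <= stft_mass k%:R)%E.
  case: (stft_mass k%:R) k0 => [q||]//; first by rewrite lte_fin => q0; exists q.
  by move=> _; exists 1 => //; exact: leey.
exists (`|fine (B%:E * L2norm g0 ^+ 2)%E| / q), k%:R; split => //.
  by rewrite divr_ge0// ltW.
move=> F y r r0 FL Fy; rewrite mulrAC ler_pdivlMr// -lee_fin EFinM.
apply: le_trans (_ : (#|` F|)%:R%:E * stft_mass k%:R <= _)%E; first by apply: lee_wpmul2l => //; rewrite lee_fin.
apply: (le_trans (card_cube_mass r0 (ler0n _ _) FL Fy)).
by rewrite lee_fin ler_wpM2r ?ler_norm// exprn_ge0// mulr_ge0// addr_ge0.
Qed.

End relative_separation.

(** * Uniform smallness of the Gram tails *)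

Section gram_tail.
Context (R : realType) (d : nat) (phi : 'rV[R]_d -> R[i]).
Hypothesis hphi : feichtinger phi.
Variables (L : set 'rV[R]_(d + d)) (C rho : R).
Hypothesis C_ge0 : 0 <= C.
Hypothesis rho_ge0 : 0 <= rho.
Hypothesis hC : forall (F : {fset 'rV[R]_(d + d)}) y r, 0 <= r ->
    [set` F] `<=` L -> [set` F] `<=` cube y r ->
    (#|` F|)%:R <= C * (2 * (r + rho)) ^+ (d + d).
Local Notation leb := (@lebesgue_rV R).
Local Notation env := (envelope phi).

Let cvg_env : ((fun k : nat => \int[leb (d + d)]_(u in ~` cube 0 k%:R) env u) @ \oo --> 0)%E.
Proof.
have mE := measurable_envelope hphi.
have mC (k : nat) : measurable (~` cube (0 : 'rV[R]_(d + d)) k%:R) by apply: measurableC; exact: measurable_cube.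
have m1 (k : nat) : measurable_fun setT (env \_ (~` cube 0 k%:R)).
  by apply/(measurable_restrictT _ _).1; [exact: mC|exact: measurable_funTS].
have ie : (leb (d + d)).-integrable setT env.
  apply/integrableP; split => //; under eq_integral do rewrite gee0_abs ?envelope_ge0//.
  exact: integral_envelope_lty.
have hf : {ae leb (d + d), forall u, setT u -> (env \_ (~` cube 0 k%:R)) u @[k --> \oo] --> cst 0%E u}.
  apply: aeW => u _; apply: cvg_near_cst; exists (Num.truncn (\sum_i `|u ord0 i|)).+1 => // k /= hk.
  rewrite patchE memNset// => nc; apply: nc; apply/cubeP => i; rewrite mxE subr0.
  apply: (@le_trans _ _ (\sum_i `|u ord0 i|)); first by rewrite (bigD1 i)//= lerDl sumr_ge0.
  by apply: le_trans (ltW (truncnS_gt _)) _; rewrite ler_nat.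
have hg : {ae leb (d + d), forall u k, setT u -> (`|(env \_ (~` cube 0 k%:R)) u| <= env u)%E}.
  apply: aeW => u k _; rewrite patchE; case: ifP => _; first by rewrite gee0_abs ?envelope_ge0.
  by rewrite abse0 envelope_ge0.
have [_ _] := dominated_convergence measurableT m1 (measurable_cst (0%E : \bar R)) hf ie hg.
rewrite integral0; apply: cvg_trans; apply: near_eq_cvg; near=> k.
by rewrite [RHS]integral_mkcond.
Unshelve. all: by end_near.
Qed.

(** By relative separation at most [N0] of the cubes of radius 1 around the points [l - m] overlap,
    and they avoid the cube of radius [k] at 0. The sum is thus at most [N0] times the integral of
    the envelope outside that cube, whatever [l] is. *)
Lemma gram_tail (tau : R) : 0 < tau -> exists2 M : R, 0 < M &
  forall l (F : {fset 'rV[R]_(d + d)}), [set` F] `<=` L ->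
    (forall m, m \in F -> ~ cube l M m) ->
    \sum_(m <- F) normc (L2inner (tfshift l phi) (tfshift m phi)) <= tau.
Proof.
move=> tau0; pose N0 : R := C * (2 * (1 + rho)) ^+ (d + d).
have N00 : 0 <= N0 by rewrite mulr_ge0// exprn_ge0// mulr_ge0// addr_ge0.
have [k hk] : exists k : nat, (\int[leb (d + d)]_(u in ~` cube 0 k%:R) env u <= (tau / (N0 + 1))%:E)%E.
  (* [N0 + 1] guards against [N0 = 0]. *)
  have p0 : 0 < tau / (N0 + 1) by rewrite divr_gt0// ltr_wpDl.
  move/fine_cvgP : cvg_env => [[k0 _ hf]].
  move=> /cvgrPdist_le/(_ _ p0)[k1 _ h1]; exists (maxn k0 k1).
  have := h1 _ (leq_maxr k0 k1); rewrite /= sub0r normrN => h2.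
  rewrite -(fineK (hf _ (leq_maxl k0 k1))) lee_fin.
  exact: le_trans (ler_norm _) h2.
(* One more than [k], because the cubes around [l - m] have radius 1. *)
exists (k%:R + 1); first by rewrite ltr_wpDl.
move=> l F FL hF; rewrite -lee_fin -sumEFin.
have mE := measurable_envelope hphi.
have mP (D : set 'rV[R]_(d + d)) : measurable D -> measurable_fun setT (env \_ D).
  by move=> mD; apply/(measurable_restrictT _ _).1 => //; exact: measurable_funTS.
have P0 (D : set 'rV[R]_(d + d)) u : (0 <= (env \_ D) u)%E.
  by rewrite patchE; case: ifP => // _; exact: envelope_ge0.
have mCk : measurable (~` cube (0 : 'rV[R]_(d + d)) k%:R) by apply: measurableC; exact: measurable_cube.
apply: (@le_trans _ _ (\sum_(m <- F) \int[leb (d + d)]_u (env \_ (cube (l - m) 1)) u)%E).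
  by apply: lee_sum => m _; rewrite -integral_mkcond; exact: gram_le_envelope.
rewrite -ge0_integral_sum//; last by move=> m; apply: mP; exact: measurable_cube.
apply: (@le_trans _ _ (\int[leb (d + d)]_u (N0%:E * (env \_ (~` cube 0 k%:R)) u))%E).
  apply: ge0_le_integral => //.
  - by move=> u _; exact: sume_ge0.
  - by apply: emeasurable_sum => m; apply: mP; exact: measurable_cube.
  - by apply: measurable_funeM; exact: mP.
  move=> u _; have [uk|uk] := pselect (cube 0 k%:R u).
    rewrite big_seq big1 ?mule_ge0 ?lee_fin// => m mF.
    rewrite patchE memNset// => /cubeP hu; apply: (hF _ mF); apply/cubeP => i.
    move/cubeP/(_ i) : uk; have := hu i; rewrite !mxE subr0 !ler_norml.
    by move=> /andP[? ?] /andP[? ?]; apply/andP; split; lra.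
  rewrite [leRHS]/= [in leRHS]patchE mem_set//.
  (* The points [m] whose cube around [l - m] contains [u] are exactly those in the cube of radius 1
     around [l - u]. *)
  pose G := [fset m in F | `[< cube (l - u) 1 m >]]%fset.
  have -> : (\sum_(m <- F) (env \_ (cube (l - m) 1)) u = \sum_(m <- G) env u)%E.
    rewrite -big_fset_condE [RHS]big_mkcond; apply: eq_bigr => m _; rewrite patchE.
    congr (if _ then _ else _); apply/idP/asboolP => [/set_mem|] /cubeP hu; [|apply/mem_set]; apply/cubeP => i;
    have := hu i; rewrite !mxE !ler_norml => /andP[? ?]; apply/andP; split; lra.
  rewrite sume_const_seq ?envelope_ge0//; apply: lee_wpmul2r; first exact: envelope_ge0.
  rewrite lee_fin; apply: (hC (y := l - u)) => // m /=.
    by rewrite !inE /= => /andP[/FL].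
  by rewrite !inE /= => /andP[_ /asboolP].
rewrite ge0_integralZl//; last exact: mP.
rewrite -integral_mkcond; apply: le_trans (lee_wpmul2l _ hk) _; first by rewrite lee_fin.
by rewrite -EFinM lee_fin mulrCA ler_piMr ?ltW// ltr_pdivrMr ?mul1r ?ltrDl ?ltr_wpDl.
Qed.

End gram_tail.

(** * Restricted invertibility for finite Gabor systems *)

Section gram_matrices.
Context (R : realType) (n : nat).
Variable G : 'M[R[i]]_n.

(** The placement of the conjugate matches the squared norm of a combination of vectors with Gram
    matrix [G], for an inner product linear in its first argument. *)
Definition quadratic_form (x : 'I_n -> R[i]) : R[i] :=
  \sum_i \sum_j x i * conjc (x j) * G i j.

Hypothesis G_hermitian : forall i j, G j i = conjc (G i j).
Hypothesis G_ge0 : forall x, 0 <= Re (quadratic_form x).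

(** By the spectral theorem [G] is diagonalised by a unitary [P], and the conjugate of [P] with rows
    scaled by the square roots of the eigenvalues serves as [A]. Each eigenvalue is the quadratic
    form at a row of [P], hence nonnegative. *)
Lemma psd_factorization :
  exists A : 'M[R[i]]_n, forall i j, \sum_k A k i * conjc (A k j) = G i j.
Proof.
have hG : G \is hermsymmx.
  apply/is_hermitianmxP; rewrite expr0 scale1r; apply/matrixP => i j.
  by rewrite !mxE; exact: G_hermitian.
have spr := hermitian_spectral_diag_real hG.
have /hermitian_normalmx/orthomx_spectralP := hG.
have := spectral_unitarymx G.
move: (spectralmx G) (spectral_diag G) spr => P sp spr Pu.
rewrite invmx_unitary// => GE.
have PGP : P *m G *m map_mx Num.conj (trmx P) = diag_mx sp.
  rewrite GE !mulmxA (unitarymxP Pu) mul1mx -mulmxA (unitarymxP Pu) mulmx1//.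
have spE k : sp 0 k = (Re (sp 0 k))%:C%C.
  have := mxOverP spr 0 k; rewrite realE !lecE => /orP[] /andP[/eqP h _]; apply: complex_eqP => //=.
have sp0 k : 0 <= Re (sp 0 k).
  rewrite (_ : sp 0 k = quadratic_form (fun i => P k i)); first exact: G_ge0.
  have := congr1 (fun M : 'M[R[i]]_n => M k k) PGP.
  rewrite [RHS]mxE eqxx mulr1n mxE => <-; rewrite /quadratic_form exchange_big; apply: eq_bigr => j _.
  by rewrite !mxE mulr_suml; apply: eq_bigr => i _; rewrite mulrAC.
exists (\matrix_(k, i) ((Num.sqrt (Re (sp 0 k)))%:C%C * conjc (P k i))) => i j.
rewrite [in RHS]GE mxE; apply: eq_bigr => k _.
rewrite !mxE (bigD1 k)//= big1 ?addr0; last first.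
  by move=> l lk; rewrite !mxE (negbTE lk) mulr0.
rewrite !mxE eqxx mulr1n.
have qq : (Num.sqrt (Re (sp 0 k)))%:C%C * (Num.sqrt (Re (sp 0 k)))%:C%C = sp 0 k.
  by rewrite -(rmorphM (real_complex R)) -expr2 sqr_sqrtr//; exact: esym.
rewrite conjcM conjc_real conjcK mulrACA qq.
by rewrite mulrA [sp 0 k * _]mulrC.
Qed.

Variable A : 'M[R[i]]_n.
Hypothesis hA : forall i j, \sum_k A k i * conjc (A k j) = G i j.

Lemma l2norm_mulmx (x : 'cV[R[i]]_n) :
  l2norm (A *m x) ^+ 2 = Re (quadratic_form (fun i => x i ord0)).
Proof.
rewrite sqr_sqrtr; last by apply: sumr_ge0 => i _; exact: sqr_ge0.
have -> : \sum_i normc ((A *m x) i ord0) ^+ 2 = Re (\sum_i (A *m x) i ord0 * conjc ((A *m x) i ord0)).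
  by rewrite Re_sum; apply: eq_bigr => i _; rewrite mulc_conj.
congr (Re _); rewrite (eq_bigr (fun k => \sum_i \sum_j x i ord0 * conjc (x j ord0) * (A k i * conjc (A k j)))).
  rewrite exchange_big; apply: eq_bigr => i _; rewrite exchange_big; apply: eq_bigr => j _.
  by rewrite -hA mulr_sumr.
move=> k _; rewrite !mxE conjc_sum mulr_suml; apply: eq_bigr => i _.
rewrite mulr_sumr; apply: eq_bigr => j _.
by rewrite [in LHS]conjcM [in LHS]mulrACA mulrC.
Qed.

End gram_matrices.

(** A factor [A] sends the standard basis to vectors with Gram matrix [G]: they have norm [sqrt s],
    [A] has operator norm at most [sqrt B], and squared norms of their combinations are values of
    the quadratic form. *)
Lemma gram_restricted_invertibility (R : realType) (c : R -> R) (eps s B : R) (n : nat) (G : 'M[R[i]]_n) :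
  finite_restricted_invertibility c -> 0 < eps < 1 -> (0 < n)%N -> 0 < s -> 0 < B ->
  (forall i j, G j i = conjc (G i j)) ->
  (forall x, 0 <= Re (quadratic_form G x)) ->
  (forall x, Re (quadratic_form G x) <= B * \sum_i normc (x i) ^+ 2) ->
  (forall i, Re (G i i) = s) ->
  exists2 J : {set 'I_n}, (1 - eps) * s / B <= #|J|%:R / n%:R &
    forall b : 'I_n -> R[i], c eps * s * (\sum_(j in J) normc (b j) ^+ 2) <=
      Re (\sum_(i in J) \sum_(j in J) b i * conjc (b j) * G i j).
Proof.
move=> [_ _ _ hRI] heps n0 s0 B0 hG G0 GB Gs.
have [A hA] := psd_factorization hG G0.
pose T : {linear 'cV[R[i]]_n -> 'cV[R[i]]_n} := mulmx A.
pose e (i : 'I_n) : 'cV[R[i]]_n := delta_mx i ord0.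
have eE i k : e i k ord0 = (k == i)%:R by rewrite mxE eqxx andbT.
have he : orthonormal_basis e.
  move=> i j; rewrite /l2inner (bigD1 i)//= big1 ?addr0 => [|k ki].
    by rewrite !eE eqxx mul1r; case: eqP => _; rewrite ?conjc1 ?conjc0.
  by rewrite !eE (negbTE ki) mul0r.
have Te i : l2norm (T (e i)) = Num.sqrt s.
  rewrite /l2norm; congr Num.sqrt; rewrite -(Gs i) -hA Re_sum; apply: eq_bigr => k _.
  by rewrite mulc_conj; congr (Re ((normc _ ^+ 2)%:C%C)); rewrite -[T (e i)]/(A *m delta_mx i 0) -colE mxE.
have TB x : l2norm x <= 1 -> l2norm (T x) <= Num.sqrt B.
  move=> x1; rewrite -(@ler_pXn2r _ 2) ?nnegrE ?sqrtr_ge0// (sqr_sqrtr (ltW B0)) -[T x]/(A *m x) (l2norm_mulmx hA).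
  apply: le_trans (GB _) _; apply: (ler_piMr (ltW B0)).
  have x2 : 0 <= \sum_i normc (x i ord0) ^+ 2 by apply: sumr_ge0 => i _; exact: sqr_ge0.
  by rewrite -(sqr_sqrtr x2); apply: exprn_ile1 => //; exact: sqrtr_ge0.
have l20 : l2norm (0 : 'cV[R[i]]_n) <= 1.
  by rewrite /l2norm big1 ?sqrtr0// => i _; rewrite mxE Normc.normc0 expr0n.
(* Comparing the inverses of [opnorm T ^+ 2] and [B] requires a positive norm; the image of one
   basis vector provides it. *)
have op0 : 0 < opnorm T.
  apply: (@lt_le_trans _ _ (Num.sqrt s)); first by rewrite sqrtr_gt0.
  apply: sup_ubound; last first.
    exists (e (Ordinal n0)); last exact: Te.
    rewrite /= /l2norm (bigD1 (Ordinal n0))//= big1 ?addr0 => [|k ki].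
      by rewrite eE eqxx Normc.normc1 expr1n sqrtr1.
    by rewrite eE (negbTE ki) Normc.normc0 expr0n.
  by exists (Num.sqrt B) => _ [x x1 <-]; exact: TB.
have us : 0 < Num.sqrt s by rewrite sqrtr_gt0.
have uT i : Num.sqrt s <= l2norm (T (e i)) by rewrite Te.
have [J hJ1 hJ2] := hRI eps n (Num.sqrt s) e T heps n0 us he uT.
exists J.
  apply: le_trans hJ1; rewrite (sqr_sqrtr (ltW s0)).
  have oB : opnorm T ^+ 2 <= B.
    rewrite -[leRHS](sqr_sqrtr (ltW B0)) ler_pXn2r ?nnegrE ?sqrtr_ge0//; last exact: ltW.
    apply: ge_sup; first by exists (l2norm (T 0)); exists 0.
    by move=> _ [x x1 <-]; exact: TB.
  by rewrite ler_pM2l ?mulr_gt0 ?subr_gt0 ?(andP heps).2// lef_pV2 ?posrE// exprn_gt0.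
move=> b; have := hJ2 b; rewrite (sqr_sqrtr (ltW s0)) => h; apply: (le_trans h).
have -> : \sum_(j in J) b j *: T (e j) = A *m \sum_(j in J) b j *: e j.
  by rewrite -[RHS]/(T _) linear_sum; apply: eq_bigr => j _; rewrite linearZ.
rewrite (l2norm_mulmx hA).
have xE k : (\sum_(j in J) b j *: e j) k ord0 = if k \in J then b k else 0.
  rewrite summxE big_mkcond (bigD1 k)//= big1 ?addr0 => [|j jk].
    by case: ifP => // _; rewrite mxE eE eqxx mulr1.
  by case: ifP => // _; rewrite mxE eE eq_sym (negbTE jk) mulr0.
rewrite le_eqVlt; apply/orP; left; apply/eqP; congr (Re _).
rewrite /quadratic_form [RHS]big_mkcond; apply: eq_bigr => i _; rewrite xE.
case: ifP => iJ; last by rewrite big1// => j _; rewrite !mul0r.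
rewrite [RHS]big_mkcond; apply: eq_bigr => j _; rewrite xE; case: ifP => // jJ.
by rewrite conjc0 mulr0 mul0r.
Qed.

Section L2_linear_combinations.
Context (R : realType) (n : nat).
Local Notation leb := (@lebesgue_rV R n).
Implicit Types f g : 'rV[R]_n -> R[i].

Lemma L2norm_sqr_fin_num f : in_Lp 2 f -> (L2norm f ^+ 2)%E \is a fin_num.
Proof.
move=> /in_L2P[_]; rewrite L2norm_sqr => h; rewrite ge0_fin_numE//.
by apply: integral_ge0 => t _; rewrite lee_fin sqr_ge0.
Qed.

Lemma L2norm_sqr_ge0 f : (0 <= L2norm f ^+ 2)%E.
Proof. by rewrite L2norm_sqr; apply: integral_ge0 => t _; rewrite lee_fin sqr_ge0. Qed.

Lemma L2inner_self f : L2inner f f = (fine (L2norm f ^+ 2)%E)%:C%C.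
Proof.
rewrite L2norm_sqr -[RHS](cint_real leb (fun t => normc (f t) ^+ 2)).
by apply: eq_cint => t; rewrite mulc_conj.
Qed.

Lemma L2inner_conj f g : in_Lp 2 f -> in_Lp 2 g -> L2inner g f = conjc (L2inner f g).
Proof.
move=> fi gi; rewrite -[L2inner f g]/(cint leb (fun t => f t * conjc (g t))) -cint_conj.
  by apply: eq_cint => t; rewrite [in RHS]conjcM conjcK mulrC.
by apply: cintegrable_L2M => //; exact: in_L2_conj.
Qed.

Lemma L2inner_suml (I : Type) (r : seq I) (x : I -> R[i]) (u : I -> 'rV[R]_n -> R[i]) g :
  (forall i, in_Lp 2 (u i)) -> in_Lp 2 g ->
  L2inner (fun t => \sum_(i <- r) x i * u i t) g = \sum_(i <- r) x i * L2inner (u i) g.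
Proof.
move=> ui gi; have ci i : cintegrable leb (fun t => u i t * conjc (g t)).
  by apply: cintegrable_L2M => //; exact: in_L2_conj.
rewrite -[LHS]/(cint leb (fun t => (\sum_(i <- r) x i * u i t) * conjc (g t))).
rewrite (eq_cint leb (g := fun t => \sum_(i <- r) x i * (u i t * conjc (g t)))).
  rewrite cint_sum => [|i]; last exact: cintegrableZ.
  by apply: eq_bigr => i _; rewrite cintZ.
by move=> t; rewrite mulr_suml; apply: eq_bigr => i _; rewrite mulrA.
Qed.

Lemma L2norm_lincomb (I : Type) (r : seq I) (x : I -> R[i]) (u : I -> 'rV[R]_n -> R[i]) :
  (forall i, in_Lp 2 (u i)) ->
  (L2norm (fun t => (\sum_(i <- r) x i * u i t)%R) ^+ 2 =
   (Re (\sum_(i <- r) \sum_(j <- r) x i * conjc (x j) * L2inner (u i) (u j)))%:E)%E.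
Proof.
move=> ui; set f := fun t => _.
have fi : in_Lp 2 f by apply: in_L2_sum => i; exact: in_L2_scale.
rewrite -[LHS]fineK ?L2norm_sqr_fin_num//.
have -> : fine (L2norm f ^+ 2)%E = Re (L2inner f f) by rewrite L2inner_self.
congr ((Re _)%:E); rewrite L2inner_suml//; apply: eq_bigr => i _.
rewrite (L2inner_conj fi (ui i)) L2inner_suml// conjc_sum mulr_sumr; apply: eq_bigr => j _.
by rewrite [in LHS]conjcM mulrA -L2inner_conj.
Qed.

Lemma L2inner_lincomb_ge0 (I : Type) (r : seq I) (x : I -> R[i]) (u : I -> 'rV[R]_n -> R[i]) :
  (forall i, in_Lp 2 (u i)) ->
  0 <= Re (\sum_(i <- r) \sum_(j <- r) x i * conjc (x j) * L2inner (u i) (u j)).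
Proof. by move=> ui; rewrite -lee_fin -L2norm_lincomb// L2norm_sqr_ge0. Qed.

End L2_linear_combinations.

Section gabor_restricted_invertibility.
Context (R : realType) (d : nat) (phi : 'rV[R]_d -> R[i]).
Hypothesis phi2 : in_Lp 2 phi.
Variables (L : set 'rV[R]_(d + d)) (B : R).
Hypothesis hB : bessel_bound phi L B.
Hypothesis B_gt0 : 0 < B.
Local Notation atom l := (tfshift l phi).

Let atom2 l : in_Lp 2 (atom l). Proof. exact: in_L2_tfshift. Qed.

(* Duality: the analysis and the synthesis operators have the same norm. *)
Lemma bessel_synthesis (F : {fset 'rV[R]_(d + d)}) (x : 'rV[R]_(d + d) -> R[i]) :
  [set` F] `<=` L ->
  Re (\sum_(l <- F) \sum_(m <- F) x l * conjc (x m) * L2inner (atom l) (atom m)) <=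
  B * \sum_(l <- F) normc (x l) ^+ 2.
Proof.
move=> FL; set Q := Re _.
pose f t := \sum_(l <- F) x l * atom l t.
have fi : in_Lp 2 f by apply: in_L2_sum => l; exact: in_L2_scale.
have fQ : (L2norm f ^+ 2 = Q%:E)%E by rewrite L2norm_lincomb.
have hQ : \sum_(l <- F) normc (L2inner f (atom l)) ^+ 2 <= B * Q.
  rewrite -lee_fin EFinM -fQ -sumEFin; apply: le_trans (hB fi).
  exact: (fset_le_esum (fun l => (normc (L2inner f (atom l)) ^+ 2)%:E) FL).
have Q1 : Q <= \sum_(l <- F) (B * normc (x l) ^+ 2 + B^-1 * normc (L2inner f (atom l)) ^+ 2) / 2.
  have -> : Q = Re (L2inner f f) by rewrite L2inner_self fQ.
  rewrite {1}/f L2inner_suml// Re_sum; apply: ler_sum => l _.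
  apply: le_trans (Re_le_normc _) _; rewrite Normc.normcM (L2inner_conj fi (atom2 l)) normcJ.
  move: (normc (x l)) (normc (L2inner f (atom l))) => p q; rewrite -subr_ge0.
  have -> : (B * p ^+ 2 + B^-1 * q ^+ 2) / 2 - p * q = B^-1 / 2 * (B * p - q) ^+ 2.
    by field; rewrite gt_eqF.
  by rewrite mulr_ge0 ?sqr_ge0// divr_ge0// invr_ge0 ltW.
move: Q1; rewrite -mulr_suml big_split -!mulr_sumr => Q1.
have : B^-1 * (\sum_(l <- F) normc (L2inner f (atom l)) ^+ 2) <= Q.
  by rewrite mulrC ler_pdivrMr// mulrC.
move: Q1; rewrite [X in X / 2]/=; lra.
Qed.

Variables (c : R -> R) (eps s : R).
Hypothesis hc : finite_restricted_invertibility c.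
Hypothesis heps : 0 < eps < 1.
Hypothesis phis : (L2norm phi ^+ 2 = s%:E)%E.
Hypothesis s_gt0 : 0 < s.

(** The points of [F] are enumerated by [lam], and the selected indices are carried back to
    points. *)
Lemma gabor_restricted_invertibility (F : {fset 'rV[R]_(d + d)}) :
  [set` F] `<=` L -> (0 < #|` F|)%N ->
  exists J : {fset 'rV[R]_(d + d)}, [/\ (J `<=` F)%fset,
    (1 - eps) * s / B * (#|` F|)%:R <= (#|` J|)%:R &
    forall b, c eps * s * (\sum_(l <- J) normc (b l) ^+ 2) <=
      Re (\sum_(l <- J) \sum_(m <- J) b l * conjc (b m) * L2inner (atom l) (atom m))].
Proof.
move=> FL F0; pose k := #|` F|.
pose lam (i : 'I_k) := nth 0 F i.
have lamF i : lam i \in F by exact: mem_nth.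
have lam_inj : injective lam.
  by move=> i j /eqP; rewrite nth_uniq ?fset_uniq// => /eqP/val_inj.
have sumF (T : nmodType) (g : 'rV[R]_(d + d) -> T) : \sum_(l <- F) g l = \sum_i g (lam i).
  by rewrite (big_nth 0) big_mkord.
pose G := \matrix_(i < k, j < k) L2inner (atom (lam i)) (atom (lam j)).
have QE x : quadratic_form G x = \sum_i \sum_j x i * conjc (x j) * L2inner (atom (lam i)) (atom (lam j)).
  by apply: eq_bigr => i _; apply: eq_bigr => j _; rewrite mxE.
have [||||J J1 J2] := @gram_restricted_invertibility R c eps s B k G hc heps F0 s_gt0 B_gt0.
- by move=> i j; rewrite !mxE; exact: L2inner_conj.
- by move=> x; rewrite QE; apply: L2inner_lincomb_ge0.
- move=> x; rewrite QE.
  (* Turns a vector of coefficients into a function on points; since [lam] is injective, its value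
     at [lam i] is [x i]. *)
  pose y l := if [pick i | lam i == l] is Some i then x i else 0.
  have yE i : y (lam i) = x i.
    by rewrite /y; case: pickP => [j /eqP/lam_inj ->//|/(_ i)]; rewrite eqxx.
  have := bessel_synthesis y FL; rewrite !sumF; congr (Re _ <= B * _).
    apply: eq_bigr => i _; rewrite sumF; apply: eq_bigr => j _; by rewrite !yE.
  by apply: eq_bigr => i _; rewrite yE.
- move=> i; rewrite mxE L2inner_self L2norm_tfshift ?phis//.
  by case: phi2.
exists [fset lam i | i in J]%fset; split.
- by apply/fsubsetP => _ /imfsetP[i _ ->].
- rewrite card_imfset//= -cardE; move: J1; rewrite -[#|` F|]/k => J1.
  by rewrite -ler_pdivlMr ?ltr0n.
have sumJ (T : nmodType) (g : 'rV[R]_(d + d) -> T) :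
    \sum_(l <- [fset lam i | i in J]%fset) g l = \sum_(i in J) g (lam i).
  by rewrite big_imfset/= ?big_enum//; move=> ? ? _ _; exact: lam_inj.
move=> b; have := J2 (b \o lam); rewrite !sumJ; congr (_ <= Re _).
by apply: eq_bigr => i _; rewrite sumJ; apply: eq_bigr => j _; rewrite mxE.
Qed.

End gabor_restricted_invertibility.

(** * Densities *)

Section counting_fset.
Context (R : realType) (T : choiceType).
Implicit Types (F : {fset T}) (A : set T).

Lemma fset_le_counting F A : [set` F] `<=` A -> ((#|` F|)%:R%:E <= (counting A : \bar R))%E.
Proof.
move=> FA; rewrite /counting; case: ifPn => [/asboolP fA|_]; last exact: leey.
rewrite lee_fin ler_nat; apply: fsubset_leq_card; apply/fsubsetP => x xF.
by rewrite in_fset_set// inE; exact: FA.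
Qed.

Lemma counting_le_fset F A : A `<=` [set` F] -> ((counting A : \bar R) <= (#|` F|)%:R%:E)%E.
Proof.
move=> AF; have fA : finite_set A by apply: sub_finite_set AF _; exact: finite_fset.
rewrite /counting asboolT// lee_fin ler_nat fsubset_leq_card//; apply/fsubsetP => x.
by rewrite in_fset_set// inE => /AF.
Qed.

Lemma counting_ge_fset A (x : R) : (x%:E <= counting A)%E ->
  exists2 F, [set` F] `<=` A & x <= (#|` F|)%:R.
Proof.
rewrite /counting; case: ifPn => [/asboolP fA|/asboolP fA _].
  by rewrite lee_fin => h; exists (fset_set A) => //; rewrite fset_setK.
have [F FA Fx] := infinite_set_fset (Num.truncn x).+1 fA.
by exists F => //; apply: le_trans (ltW (truncnS_gt _)) _; rewrite ler_nat.
Qed.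

End counting_fset.

Section densities.
Context (R : realType).

Lemma limf_esup_squeeze (f : R -> \bar R) (D : R) :
  (forall e, 0 < e -> exists r0, forall r, r0 < r -> ((D - e)%:E <= f r <= (D + e)%:E)%E) ->
  limf_esup f +oo%R = D%:E.
Proof.
move=> h; apply/eqP; rewrite eq_le; apply/andP; split.
  apply/lee_addgt0Pr => e /h[r0 hr0].
  apply: (@le_trans _ _ (ereal_sup (f @` [set r | r0 < r]))).
    apply: ereal_inf_lbound; exists [set r | r0 < r] => //.
    by exists r0; split => //; exact: num_real.
  by apply: ge_ereal_sup => _ [r /hr0/andP[_ +] <-]; rewrite EFinD.
apply: le_ereal_inf_tmp => _ [V [M [_ MV]] <-]; apply/lee_subgt0Pr => e /h[r0 hr0].
pose r := Num.max M r0 + 1.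
have /hr0/andP[+ _] : r0 < r by rewrite ltr_pwDr// le_max lexx orbT.
rewrite EFinB => /le_trans; apply; apply: ereal_sup_ubound; exists r => //.
by apply: MV; rewrite ltr_pwDr// le_max lexx.
Qed.

Lemma limf_einf_squeeze (f : R -> \bar R) (D : R) :
  (forall e, 0 < e -> exists r0, forall r, r0 < r -> ((D - e)%:E <= f r <= (D + e)%:E)%E) ->
  limf_einf f +oo%R = D%:E.
Proof.
move=> h; rewrite /limf_einf (@limf_esup_squeeze _ (- D)) ?EFinN ?oppeK// => e /h[r0 hr0].
exists r0 => r /hr0/andP[h1 h2].
have e1 : - D - e = - (D + e) by rewrite opprD.
have e2 : - D + e = - (D - e) by rewrite opprB addrC.
by apply/andP; split; rewrite ?e1 ?e2 EFinN leeN2.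
Qed.

Variable n : nat.
Implicit Types L : set 'rV[R]_n.

Lemma uniform_density_squeeze L (D : R) :
  (forall e, 0 < e -> exists r0, forall r x, r0 < r ->
    ((D - e)%:E <= cube_density L r x <= (D + e)%:E)%E) ->
  uniform_density L D%:E.
Proof.
move=> h; split; [apply: limf_einf_squeeze|apply: limf_esup_squeeze] => e /h[r0 hr0];
  exists r0 => r /hr0 hr; apply/andP; split.
- by apply: le_ereal_inf_tmp => _ [x _ <-]; case/andP: (hr x).
- case/andP: (hr 0) => _; apply: le_trans; apply: ereal_inf_lbound; by exists 0.
- case/andP: (hr 0) => + _ => /le_trans; apply; apply: ereal_sup_ubound; by exists 0.
- by apply: ge_ereal_sup => _ [x _ <-]; case/andP: (hr x).
Qed.

Lemma lower_density_gt L (a : \bar R) : (a < lower_density L)%E ->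
  exists r0, forall r x, r0 < r -> (a < cube_density L r x)%E.
Proof.
rewrite /lower_density /limf_einf lteNr => /ereal_inf_lt[_ [V [M [_ MV]] <-] hV].
exists M => r x /MV Vr.
apply: (@lt_le_trans _ _ (ereal_inf (range (cube_density L r)))); last by apply: ereal_inf_lbound; exists x.
by rewrite -lteN2; apply: le_lt_trans hV; apply: ereal_sup_ubound; exists r.
Qed.

Lemma cube_density_le L r x (C : R) : 0 < r -> 
  (cube_density L r x <= C%:E)%E = (counting (L `&` cube x r) <= (C * (2 * r) ^+ n)%:E)%E.
Proof.
move=> r0; have p0 : 0 < (2 * r) ^+ n by rewrite exprn_gt0// mulr_gt0.
by rewrite /cube_density inver gt_eqF// lee_pdivrMr.
Qed.

Lemma cube_density_ge L r x (C : R) : 0 < r -> 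
  (C%:E <= cube_density L r x)%E = ((C * (2 * r) ^+ n)%:E <= counting (L `&` cube x r))%E.
Proof.
move=> r0; have p0 : 0 < (2 * r) ^+ n by rewrite exprn_gt0// mulr_gt0.
by rewrite /cube_density inver gt_eqF// lee_pdivlMr.
Qed.

End densities.

(** The cell of index [u + w] is counted from [u], the quotient [(x - r) / N] rounded up. Rounding
    loses less than one cell, whence the bound [2 r / N - 1] on the number of cells. *)
Lemma grid_point_in (R : realType) (N x r y u w q : R) : 0 < N ->
  (x - r) / N <= u -> u < (x - r) / N + 1 -> 0 <= w -> w + 1 <= q -> q <= 2 * r / N - 1 ->
  N * (u + w) < y -> y < N * (u + w + 1) -> x - r <= y <= x + r.
Proof.
move=> N0; rewrite ler_pdivrMr// -ltrBlDr ltr_pdivlMr// => h1 h2 w0 wq.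
rewrite lerBrDr ler_pdivlMr// => h3 h4 h5.
have hw : 0 <= N * w by rewrite mulr_ge0// ltW.
have hwq : N * (w + 1) <= N * q by rewrite ler_pM2l.
by apply/andP; split; lra.
Qed.

(** A cell meeting the interval has index at least [a], the quotient [(x - r) / N] rounded down, and
    exceeding it by less than [2 r / N + 1]. *)
Lemma grid_cell_in (R : realType) (N x r y : R) (a b : int) : 0 < N ->
  N * b%:~R < y -> y < N * (b + 1)%:~R -> x - r <= y -> y <= x + r ->
  a%:~R <= (x - r) / N -> (x - r) / N < (a + 1)%:~R ->
  (a%:~R : R) < (b + 1)%:~R /\ (b%:~R : R) - a%:~R < 2 * r / N + 1.
Proof.
move=> N0 h1 h2 h3 h4 h5 h6; split.
  by apply: le_lt_trans h5 _; rewrite ltr_pdivrMr// mulrC; exact: le_lt_trans h2.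
rewrite ltrBlDr -[X in _ < X]addrA; have : b%:~R < (x + r) / N.
  by rewrite ltr_pdivlMr// mulrC; exact: lt_le_trans h4.
have -> : (x + r) / N = (x - r) / N + 2 * r / N by rewrite -mulrDl; congr (_ / _); ring.
by move: h6; rewrite intrD; lra.
Qed.

Section grid_density.
Context (R : realType) (n m : nat) (N : R) (J : 'rV[int]_n -> {fset 'rV[R]_n}).
Hypothesis N_gt0 : 0 < N.
Hypothesis cardJ : forall k, #|` J k| = m.
Hypothesis Jcell : forall k x, x \in J k -> forall i, N * (k ord0 i)%:~R < x ord0 i < N * (k ord0 i + 1)%:~R.

Lemma cell_inj k k' x : x \in J k -> x \in J k' -> k = k'.
Proof.
move=> /Jcell h /Jcell h'; apply/rowP => i.
have /andP[h1 h2] := h i; have /andP[h3 h4] := h' i.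
have := lt_trans h1 h4; have := lt_trans h3 h2; rewrite !ltr_pM2l// !ltr_int !ltzD1 => k1 k2.
by apply: le_anti; apply/andP; split; [exact: k2|exact: k1].
Qed.

(** Enumerates the points in the block of [q^n] cells starting at [p]: an offset selects the cell
    and a rank below [m] the point in it. Injectivity then gives the exact count [q^n m]. *)
Let pt (p : 'rV[int]_n) q (z : {ffun 'I_n -> 'I_q} * 'I_m) : 'rV[R]_n :=
  nth 0 (J (\row_i (p ord0 i + (z.1 i)%:Z))) z.2.

Let ptJ p q z : @pt p q z \in J (\row_i (p ord0 i + (z.1 i)%:Z)).
Proof. by apply: mem_nth; rewrite cardJ. Qed.

Let pt_inj p q : injective (@pt p q).
Proof.
move=> [j t] [j' t'] e.
have := ptJ p (j, t); rewrite e => /cell_inj/(_ (ptJ p (j', t')))/rowP h.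
have jj : j = j'.
  by apply/ffunP => i; have := h i; rewrite !mxE => /addrI /eqP; rewrite eqz_nat => /eqP/val_inj.
move: e; rewrite jj /pt /= => /eqP; rewrite nth_uniq ?cardJ ?fset_uniq//.
by move=> /eqP/val_inj ->.
Qed.

Let block p q := [fset @pt p q z | z : {ffun 'I_n -> 'I_q} * 'I_m]%fset.

Let card_block p q : #|` block p q| = (q ^ n * m)%N.
Proof. by rewrite card_imfset//= -cardE card_prod card_ffun !card_ord. Qed.

Local Notation L := (\bigcup_k [set` J k]).

Lemma grid_counting_ge x r (q : nat) : q%:R <= 2 * r / N - 1 ->
  (((q ^ n * m)%N%:R : R)%R%:E <= counting (L `&` cube x r))%E.
Proof.
move=> hq; pose p : 'rV[int]_n := \row_i Num.ceil ((x ord0 i - r) / N).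
rewrite -(card_block p q); apply: fset_le_counting => y /= /imfsetP[z _ ->]; split.
  by exists (\row_i (p ord0 i + (z.1 i)%:Z)) => //; exact: ptJ.
move=> i; have /andP[] := Jcell (ptJ p z) i; rewrite !mxE.
move: (@pt p q z ord0 i) (ltn_ord (z.1 i)) => y0; move: (nat_of_ord (z.1 i)) => w.
rewrite -(ler_nat R) -natr1 => wq.
have := ceil_itv ((x ord0 i - r) / N).
move: (Num.ceil _) => u; rewrite intrB => /andP[u1 u2]; rewrite !intrD -!pmulrn => h1 h2.
by apply: (grid_point_in N_gt0 u2 _ (ler0n _ w) wq hq h1 h2); lra.
Qed.

Lemma grid_counting_le x r (q : nat) : 2 * r / N + 1 <= q%:R ->
  (counting (L `&` cube x r) <= ((q ^ n * m)%N%:R : R)%R%:E)%E.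
Proof.
move=> hq; pose p : 'rV[int]_n := \row_i Num.floor ((x ord0 i - r) / N).
rewrite -(card_block p q); apply: counting_le_fset => y [[k _ yk] yx].
have hk i : p ord0 i <= k ord0 i /\ ((k ord0 i - p ord0 i)%:~R : R) < q%:R.
  have /andP[h1 h2] := Jcell yk i; have /andP[h3 h4] := yx i.
  have := floor_itv ((x ord0 i - r) / N); rewrite (_ : Num.floor _ = p ord0 i); last by rewrite mxE.
  move: (p ord0 i) (k ord0 i) h1 h2 => a b h1 h2 /andP[a1 a2].
  have [c1 c2] := grid_cell_in N_gt0 h1 h2 h3 h4 a1 a2.
  split; first by rewrite -ltzD1 -(ltr_int R).
  by rewrite intrB; lra.
have hj i : (`|k ord0 i - p ord0 i| < q)%N.
  have [h1 h2] := hk i; rewrite -(ltr_nat R) natr_absz ger0_norm ?subr_ge0//.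
have ht : (index y (J k) < m)%N by rewrite -(cardJ k) index_mem.
apply/imfsetP; exists ([ffun i => Ordinal (hj i)], Ordinal ht) => //.
rewrite /pt /= (_ : \row_i _ = k) ?nth_index//.
apply/rowP => i; rewrite mxE ffunE /= gez0_abs ?subr_ge0 ?(hk i).1//.
exact: (subrKC (p ord0 i) (k ord0 i)).
Qed.

(** The numbers of cells per axis, contained in or met by a cube of radius [r], can be taken within
    2 of [2 r / N]. As [2 r (1 / r) = 2], the count divided by the volume lies between
    [m (1 / N - 1 / r)^n] and [m (1 / N + 1 / r)^n]. *)
Lemma grid_density : uniform_density L (m%:R / N ^+ n)%:E.
Proof.
apply: uniform_density_squeeze => e e0.
have [del del0 hdel] : exists2 del : R, 0 < del & forall t, `|t| < del ->
    `|m%:R * (N^-1 + t) ^+ n - m%:R / N ^+ n| < e.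
  have cf : (fun t : R => m%:R * (N^-1 + t) ^+ n) t @[t --> 0] --> (m%:R * (N^-1 + 0) ^+ n : R).
    apply: cvgM; first exact: cvg_cst.
    apply: (cvg_comp (fun t : R => N^-1 + t) (fun t : R => t ^+ n) _ (@exprn_continuous _ n _)).
    by apply: cvgD; [exact: cvg_cst|exact: cvg_id].
  move/cvgrPdist_lt : cf => /(_ _ e0)[del /= del0 hd]; exists del => // t td.
  by rewrite distrC; have := hd t; rewrite /= sub0r normrN addr0 exprVn; apply.
(* [r > N] keeps [2 r / N - 2] nonnegative, and [r > 1 / del] brings [1 / r] within the continuity
   radius. *)
exists (Num.max N del^-1) => r x; rewrite gt_max => /andP[rN rdel].
have r0 : 0 < r by exact: lt_trans rN.
have rt : r^-1 < del by rewrite invf_plt ?posrE.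
have p0 : 0 <= (2 * r) ^+ n by rewrite exprn_ge0// mulr_ge0// ltW.
have rN2 : 2 <= 2 * r / N by rewrite ler_pdivlMr// ler_pM2l// ltW.
have hE t : (N^-1 + t) ^+ n * (2 * r) ^+ n = (2 * r / N + t * (2 * r)) ^+ n.
  by rewrite -exprMn; congr (_ ^+ _); ring.
have rr : r^-1 * (2 * r) = 2 by field; rewrite gt_eqF.
have r10 : 0 <= 2 * r / N - 1 by lra.
rewrite cube_density_ge// cube_density_le//; apply/andP; split.
  have /truncn_itv/andP[q1 q2] := r10.
  apply: le_trans (grid_counting_ge x q1); rewrite lee_fin natrM natrX [leRHS]mulrC.
  apply: (@le_trans _ _ (m%:R * (N^-1 - r^-1) ^+ n * (2 * r) ^+ n)).
    apply: ler_wpM2r => //; have := hdel (- r^-1); rewrite normrN gtr0_norm ?invr_gt0// => /(_ rt).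
    by rewrite ltr_norml => /andP[? ?]; lra.
  rewrite -mulrA hE mulNr rr; apply: ler_wpM2l => //.
  move: q2; rewrite -natr1 => q2; rewrite lerXn2r ?nnegrE//; lra.
have r20 : 0 <= 2 * r / N by lra.
have /truncn_itv/andP[q1 q2] := r20.
have q3 : 2 * r / N + 1 <= (Num.truncn (2 * r / N)).+2%:R by rewrite -natr1; lra.
apply: le_trans (grid_counting_le x q3) _; rewrite lee_fin natrM natrX mulrC.
apply: (@le_trans _ _ (m%:R * (N^-1 + r^-1) ^+ n * (2 * r) ^+ n)); last first.
  apply: ler_wpM2r => //; have := hdel r^-1; rewrite gtr0_norm ?invr_gt0// => /(_ rt).
  by rewrite ltr_norml => /andP[? ?]; lra.
rewrite -[leRHS]mulrA hE rr; apply: ler_wpM2l => //.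
move: q1 {q2 q3}; move: (Num.truncn _) => w q1; have w0 := ler0n R w.
have -> : w.+2%:R = w%:R + 2 :> R by rewrite -addn2 natrD.
by rewrite lerXn2r ?nnegrE//; lra.
Qed.

End grid_density.

(** * Unconditionally convergent sums *)

(** The limit is written as the supremum of the nondecreasing sequence [x k - 2 w 2^-k], which lies
    below every [x k + 2 w 2^-k]. Such a formula is measurable when [x] and [w] depend on a
    parameter, as in the completeness proof. *)
Lemma geometric_cauchy_limit (R : realType) (x : nat -> R) (w : R) : 0 <= w ->
  (forall k, `|x k.+1 - x k| <= w * 2^-1 ^+ k) ->
  forall k, `|fine (esups (fun k => (x k - 2 * w * 2^-1 ^+ k)%:E) 0%N) - x k| <= 2 * w * 2^-1 ^+ k.
Proof.
move=> w0 hx k; pose y k := x k - 2 * w * 2^-1 ^+ k; pose z k := x k + 2 * w * 2^-1 ^+ k.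
have hS j : 2 * w * 2^-1 ^+ j.+1 = w * 2^-1 ^+ j :> R by rewrite exprS; field.
have yz i : y i <= z i.
  by rewrite lerD2l (le_trans (y := 0))// ?oppr_le0 ?mulr_ge0 ?exprn_ge0.
have yle i j : (i <= j)%N -> y i <= y j.
  move: i j; apply/nondecreasing_seqP => i; rewrite /y hS.
  by have := hx i; rewrite ler_norml => /andP[h1 h2]; lra.
have zge i j : (i <= j)%N -> z j <= z i.
  move: i j; apply/nonincreasing_seqP => i; rewrite /z hS.
  by have := hx i; rewrite ler_norml => /andP[h1 h2]; lra.
have yz2 i j : y i <= z j.
  apply: le_trans (yle _ _ (leq_maxl i j)) _; apply: le_trans (yz _) _.
  by apply: zge; exact: leq_maxr.
set E := esups _ _.
have E1 j : ((y j)%:E <= E)%E by apply: ereal_sup_ubound; exists j.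
have E2 j : (E <= (z j)%:E)%E.
  by apply: ge_ereal_sup => _ [i _ <-]; rewrite lee_fin; exact: yz2.
have := E1 k; have := E2 k; have := E1 0%N; have := E2 0%N.
case: E {E1 E2} => [l||]//= _ _; rewrite !lee_fin => h1 h2.
by rewrite ler_norml; apply/andP; split; move: h1 h2; rewrite /y /z; lra.
Qed.

Lemma ReB (R : realType) (z w : R[i]) : Re (z - w) = Re z - Re w.
Proof. by case: z w => [? ?] []. Qed.

Lemma ImB (R : realType) (z w : R[i]) : Im (z - w) = Im z - Im w.
Proof. by case: z w => [? ?] []. Qed.

Section L2_completeness.
Context (R : realType) (n : nat).
Local Notation leb := (@lebesgue_rV R n).
Implicit Types f g : 'rV[R]_n -> R[i].

Lemma in_L2B f g : in_Lp 2 f -> in_Lp 2 g -> in_Lp 2 (fun t => f t - g t).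
Proof.
move=> fi gi; have := in_L2D fi (in_L2_scale (-1) gi).
by rewrite (_ : (fun t => _) = (fun t => f t - g t))//; apply/funext => t; rewrite mulN1r.
Qed.

Lemma cmeas_normc_sqr f : cmeas f -> measurable_fun setT (fun t => (normc (f t) ^+ 2)%:E).
Proof. by move=> mf; apply/measurable_EFinP; apply: measurable_funX; exact: measurable_normc. Qed.

(** A weighted triangle inequality for squares: with moduli [x] and [y], the right-hand side exceeds
    [(x + y)^2] by [eta^-1 (eta x - y)^2]. A small [eta] keeps the main term almost unchanged. *)
Lemma sqr_normcB_le (p q : R[i]) (eta : R) : 0 < eta ->
  normc (p - q) ^+ 2 <= (1 + eta) * normc p ^+ 2 + (1 + eta^-1) * normc q ^+ 2.
Proof.
move=> e0; have : normc (p - q) <= normc p + normc q.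
  have nN : normc (- q) = normc q by case: (q) => a b /=; rewrite !sqrrN.
  by apply: le_trans (ler_normcD _ _) _; rewrite nN.
have := normc_ge0 (p - q); have := normc_ge0 p; have := normc_ge0 q.
move: (normc p) (normc q) (normc (p - q)) => x y s y0 x0 s0 sxy.
apply: (@le_trans _ _ ((x + y) ^+ 2)); first by rewrite lerXn2r ?nnegrE ?addr_ge0.
rewrite -subr_ge0 (_ : _ - _ = eta^-1 * (eta * x - y) ^+ 2).
  by rewrite mulr_ge0 ?sqr_ge0// invr_ge0 ltW.
by field; rewrite gt_eqF.
Qed.

Lemma L2norm_sqrB_le f g (eta : R) : 0 < eta -> in_Lp 2 f -> in_Lp 2 g ->
  (L2norm (fun t => (f t - g t)%R) ^+ 2 <=
   (1 + eta)%:E * L2norm f ^+ 2 + (1 + eta^-1)%:E * L2norm g ^+ 2)%E.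
Proof.
move=> e0 fi gi; have [mf _] := fi; have [mg _] := gi; have [mfg _] := in_L2B fi gi.
have ei : 0 <= 1 + eta^-1 by rewrite addr_ge0// invr_ge0 ltW.
have ep : 0 <= 1 + eta by rewrite addr_ge0// ltW.
have nn (h : 'rV[R]_n -> R[i]) t : (0 <= (normc (h t) ^+ 2)%:E)%E by rewrite lee_fin sqr_ge0.
rewrite !L2norm_sqr -!ge0_integralZl//; try by [exact: cmeas_normc_sqr|move=> t _; exact: nn].
have m1 (r : R) (h : 'rV[R]_n -> R[i]) : cmeas h -> measurable_fun setT (fun t => (r%:E * (normc (h t) ^+ 2)%:E)%E).
  by move=> mh; apply: measurable_funeM; exact: cmeas_normc_sqr.
rewrite -ge0_integralD//; try by [exact: m1|move=> t _; apply: mule_ge0 => //; exact: nn].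
apply: ge0_le_integral => //.
- by move=> t _; exact: (nn (fun t => f t - g t)).
- exact: (cmeas_normc_sqr mfg).
- by apply: emeasurable_funD; exact: m1.
- by move=> t _; rewrite -!EFinM -EFinD lee_fin; exact: sqr_normcB_le.
Qed.

Lemma geometric_sum4_le (k : nat) : (\sum_(0 <= i < k) (4^-1 ^+ i : R)%:E <= 2%:E)%E.
Proof.
rewrite sumEFin lee_fin.
suff : \sum_(0 <= i < k) 4^-1 ^+ i <= 2 - 2 * 4^-1 ^+ k :> R.
  by move=> /le_trans; apply; rewrite gerBl mulr_ge0// exprn_ge0// invr_ge0.
elim: k => [|k IH]; first by rewrite big_nil expr0; lra.
rewrite big_nat_recr//= exprS.
have : 0 <= 4^-1 ^+ k :> R by rewrite exprn_ge0// invr_ge0.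
by move: IH; move: (4^-1 ^+ k : R) (\sum_(0 <= i < k) _) => p q; lra.
Qed.

(* The increments are dominated pointwise by [sqrt (W t) 2^-k], where [W] weighs
   the k-th increment by [4^k] and is integrable. *)
Lemma L2_complete (f : nat -> 'rV[R]_n -> R[i]) : (forall k, in_Lp 2 (f k)) ->
  (forall k, (L2norm (fun t => (f k.+1 t - f k t)%R) ^+ 2 <= (16^-1 ^+ k)%:E)%E) ->
  exists2 g, in_Lp 2 g & exists2 C, 0 <= C & forall k,
    (L2norm (fun t => (g t - f k t)%R) ^+ 2 <= (C * 4^-1 ^+ k)%:E)%E.
Proof.
move=> f2 hf; pose h k t := f k.+1 t - f k t.
have h2 k : in_Lp 2 (h k) by exact: in_L2B.
have mf k : cmeas (f k) by case: (f2 k).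
have mh k : cmeas (h k) by case: (h2 k).
pose q k t : \bar R := ((4 ^+ k)%:E * (normc (h k t) ^+ 2)%:E)%E.
have q0 k t : (0 <= q k t)%E by rewrite /q -EFinM lee_fin mulr_ge0 ?sqr_ge0// exprn_ge0.
have mq k : measurable_fun setT (q k) by apply: measurable_funeM; exact: cmeas_normc_sqr.
pose W t : \bar R := (\sum_(k <oo) q k t)%E.
have W0 t : (0 <= W t)%E by exact: nneseries_ge0.
have mW : measurable_fun setT W.
  exact: (@ge0_emeasurable_sum _ _ _ setT q predT (fun k t _ _ => q0 k t) (fun k _ => mq k)).
have IW : (\int[leb]_t W t <= 2%:E)%E.
  rewrite integral_nneseries//; apply: lime_le.
    by apply: is_cvg_nneseries => k _ _; exact: integral_ge0.
  apply: nearW => k; apply: le_trans (geometric_sum4_le k).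
  apply: lee_sum => i _; rewrite ge0_integralZl ?lee_fin ?exprn_ge0//; last 2 first.
  - exact: cmeas_normc_sqr.
  - by move=> t _; rewrite lee_fin sqr_ge0.
  rewrite -L2norm_sqr; apply: (@le_trans _ _ ((4 ^+ i)%:E * (16^-1 ^+ i)%:E)%E).
    by apply: lee_wpmul2l; [rewrite lee_fin exprn_ge0|exact: hf].
  rewrite -EFinM lee_fin -exprMn le_eqVlt; apply/orP; left; apply/eqP; congr (_ ^+ _); by field.
have iW : leb.-integrable setT W.
  apply/integrableP; split => //; under eq_integral do rewrite gee0_abs//.
  exact: le_lt_trans IW (ltry _).
pose w t : R := Num.sqrt (fine (W t)).
have w0 t : 0 <= w t by exact: sqrtr_ge0.
have mw : measurable_fun setT w.
  by apply: (measurableT_comp (continuous_measurable_fun (@sqrt_continuous R))); apply: (measurableT_comp (f := fine)).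
have hw t k : W t \is a fin_num -> normc (h k t) <= w t * 2^-1 ^+ k.
  move=> Wf; rewrite -(@ler_pXn2r _ 2)// ?nnegrE ?normc_ge0//; last first.
    by rewrite mulr_ge0 ?w0// exprn_ge0// invr_ge0.
  rewrite exprMn sqr_sqrtr ?fine_ge0// -exprM mulnC exprM.
  have : (q k t <= W t)%E.
    apply: le_trans (nneseries_lim_ge k.+1 (fun i _ _ => q0 i t)).
    by rewrite big_nat_recr//= leeDr// sume_ge0.
  rewrite -(fineK Wf) /q -EFinM lee_fin => hq.
  have -> : (2^-1 ^+ 2 : R) = 4^-1 by field.
  by rewrite exprVn ler_pdivlMr ?exprn_gt0// mulrC.
(* An explicit measurable candidate for the limit; its value on the null set where [W t] is infinite
   is immaterial. *)
pose lim0 (x : nat -> R) (t : 'rV[R]_n) : R := fine (esups (fun k => (x k - 2 * w t * 2^-1 ^+ k)%:E) 0%N).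
have mlim (x : nat -> 'rV[R]_n -> R) : (forall k, measurable_fun setT (x k)) ->
    measurable_fun setT (fun t => lim0 (x ^~ t) t).
  move=> mx; apply: (measurableT_comp (f := fine)) => //.
  apply: (@measurable_fun_esups _ _ _ setT (fun k t => (x k t - 2 * w t * 2^-1 ^+ k)%:E)) => k.
  apply/measurable_EFinP; apply: measurable_funB => //; apply: measurable_funM => //.
  exact: measurable_funM.
pose g t : R[i] := Complex (lim0 (fun k => Re (f k t)) t) (lim0 (fun k => Im (f k t)) t).
have mg : cmeas g by split; apply: mlim => k; case: (mf k).
have gf t k : W t \is a fin_num -> ((normc (g t - f k t) ^+ 2)%:E <= (8 * 4^-1 ^+ k)%:E * W t)%E.
  move=> Wf.
  have hRe j : `|Re (f j.+1 t) - Re (f j t)| <= w t * 2^-1 ^+ j.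
    by rewrite -ReB; apply: le_trans (ler_Re_normc _) (hw t j Wf).
  have hIm j : `|Im (f j.+1 t) - Im (f j t)| <= w t * 2^-1 ^+ j.
    by rewrite -ImB; apply: le_trans (ler_Im_normc _) (hw t j Wf).
  have := geometric_cauchy_limit (w0 t) hIm k; have := geometric_cauchy_limit (w0 t) hRe k.
  rewrite sqr_normc ReB ImB -[Re (g t)]/(lim0 (fun k => Re (f k t)) t) -[Im (g t)]/(lim0 (fun k => Im (f k t)) t).
  rewrite -/(lim0 (fun k => Re (f k t)) t) -/(lim0 (fun k => Im (f k t)) t).
  rewrite -(fineK Wf) -EFinM lee_fin -[fine (W t)]sqr_sqrtr ?fine_ge0// -/(w t).
  move: (lim0 _ t - Re (f k t)) (lim0 _ t - Im (f k t)) => p p' b1 b2.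
  have e2 : (2 * w t * 2^-1 ^+ k) ^+ 2 = 4 * 4^-1 ^+ k * w t ^+ 2.
    have -> : (4^-1 : R) = 2^-1 ^+ 2 by field.
    by rewrite -[(2^-1 ^+ 2) ^+ k]exprM mulnC exprM; move: (2^-1 ^+ k) (w t) => x y; ring.
  have c0 : 0 <= 2 * w t * 2^-1 ^+ k by apply: le_trans b1.
  have s1 : p ^+ 2 <= 4 * 4^-1 ^+ k * w t ^+ 2 by rewrite -e2 -[leLHS]real_normK ?num_real// lerXn2r ?nnegrE.
  have s2 : p' ^+ 2 <= 4 * 4^-1 ^+ k * w t ^+ 2 by rewrite -e2 -[leLHS]real_normK ?num_real// lerXn2r ?nnegrE.
  by move: s1 s2; move: (4^-1 ^+ k) (w t ^+ 2) => c w2; lra.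
have mgf k : cmeas (fun t => g t - f k t).
  rewrite (_ : (fun t => g t - f k t) = (fun t => g t + -1 * f k t)).
    by apply: cmeasD => //; have [] := in_L2_scale (-1) (f2 k).
  by apply/funext => t; rewrite mulN1r.
(* The pointwise factor 8 is the square of [2 w 2^-k] counted for the real and the imaginary part;
   the integral of [W], at most 2, makes it 16. *)
have gf2 k : (L2norm (fun t => (g t - f k t)%R) ^+ 2 <= (16 * 4^-1 ^+ k)%:E)%E.
  have c0 : 0 <= 8 * 4^-1 ^+ k :> R by rewrite mulr_ge0// exprn_ge0// invr_ge0.
  rewrite L2norm_sqr; apply: (@le_trans _ _ (\int[leb]_t ((8 * 4^-1 ^+ k)%:E * W t))%E).
    apply: ae_ge0_le_integral => //.
    - by move=> t _; rewrite lee_fin sqr_ge0.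
    - exact: cmeas_normc_sqr.
    - by move=> t _; apply: mule_ge0.
    - exact: measurable_funeM.
    by apply: filterS (integrable_ae measurableT iW) => t Wf _; exact: gf (Wf I).
  rewrite ge0_integralZl//; apply: (le_trans (@lee_wpmul2l R _ _ _ _ IW)); first by rewrite lee_fin.
  by rewrite -EFinM lee_fin; lra.
exists g; last by exists 16.
have g0 : in_Lp 2 (fun t => g t - f 0%N t).
  apply/in_L2P; split => //; rewrite -L2norm_sqr; exact: le_lt_trans (gf2 0%N) (ltry _).
have := in_L2D g0 (f2 0%N); rewrite (_ : (fun t => _) = g)//.
by apply/funext => t; rewrite subrK.
Qed.

End L2_completeness.

Lemma L2norm_lt (R : realType) n (f : 'rV[R]_n -> R[i]) (e : R) : 0 < e ->
  (L2norm f ^+ 2 < (e ^+ 2)%:E)%E -> (L2norm f < e%:E)%E.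
Proof.
move=> e0; have : (0 <= L2norm f)%E by exact: Lnorm_ge0.
case: (L2norm f) => [r||].
- rewrite expe2 -EFinM !lte_fin lee_fin -expr2 => r0.
  by rewrite ltr_pXn2r// nnegrE// ltW.
- by rewrite expe2 mulyy.
- by rewrite leeNy_eq.
Qed.

Lemma sum_fsetU (T : choiceType) (V : nmodType) (A C : {fset T}) (f : T -> V) :
  (forall l, l \in C -> l \notin A) ->
  \sum_(l <- (A `|` C)%fset) f l = \sum_(l <- A) f l + \sum_(l <- C) f l.
Proof.
move=> AC; rewrite -big_cat; apply: perm_big; apply: uniq_perm; first exact: fset_uniq.
  by rewrite cat_uniq !fset_uniq andbT /=; apply/hasPn => l /AC.
by move=> l; rewrite mem_cat in_fsetU.
Qed.

Lemma sum_fsetD (T : choiceType) (V : nmodType) (A F : {fset T}) (f : T -> V) :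
  (A `<=` F)%fset -> \sum_(l <- F) f l = \sum_(l <- A) f l + \sum_(l <- (F `\` A)%fset) f l.
Proof.
move=> /fsubsetP AF; have FE : F = (A `|` (F `\` A))%fset.
  apply/fsetP => l; rewrite in_fsetU in_fsetD.
  by case: (boolP (l \in A)) => //= /AF.
by rewrite [in LHS]FE sum_fsetU// => l; rewrite in_fsetD => /andP[].
Qed.

Section unconditional_sums.
Context (R : realType) (n : nat) (T : choiceType) (S : set T).
Variables (u : T -> 'rV[R]_n -> R[i]) (a : T -> R).
Hypothesis u2 : forall l, in_Lp 2 (u l).
Hypothesis a_ge0 : forall l, 0 <= a l.

Let sum2 (F : {fset T}) : in_Lp 2 (fun t => \sum_(l <- F) u l t).
Proof. exact: in_L2_sum. Qed.

(** Some finite sum comes within [e] of the total; a finite set disjoint from it can then add at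
    most [e]. *)
Lemma esum_tail (e : R) : (\esum_(l in S) (a l)%:E < +oo)%E -> 0 < e ->
  exists G : {fset T}, [set` G] `<=` S /\ forall F : {fset T}, [set` F] `<=` S ->
    (forall l, l \in F -> l \notin G) -> \sum_(l <- F) a l <= e.
Proof.
move=> aS e0; have fS : (\esum_(l in S) (a l)%:E)%E \is a fin_num.
  by rewrite ge0_fin_numE// esum_ge0// => l _; rewrite lee_fin.
have lt1 : (\esum_(l in S) (a l)%:E - e%:E < \esum_(l in S) (a l)%:E)%E.
  by rewrite -(fineK fS) -EFinB lte_fin gtrBl.
have [G GS hG] := esum_approx lt1.
exists G; split => // F FS FG.
have : (\sum_(l <- (G `|` F)%fset) (a l)%:E <= \esum_(l in S) (a l)%:E)%E.
  by apply: fset_le_esum => l /=; rewrite in_fsetU => /orP[/GS|/FS].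
move: hG; rewrite -(fineK fS) !sumEFin sum_fsetU// -EFinB lte_fin lee_fin; lra.
Qed.

(** Cauchy criterion for the net of finite sums: off [G k] every finite sum of [a] is at most
    [16^-k]. Partial sums along the increasing sets [Fs k] therefore converge, and every larger
    finite set stays close to them. *)
Lemma L2_has_sum_exists : (\esum_(l in S) (a l)%:E < +oo)%E ->
  (forall F : {fset T}, [set` F] `<=` S ->
    (L2norm (fun t => (\sum_(l <- F) u l t)%R) ^+ 2 <= (\sum_(l <- F) a l)%:E)%E) ->
  exists g, L2_has_sum S u g.
Proof.
move=> aS ua; have p16 k : 0 < 16^-1 ^+ k :> R by rewrite exprn_gt0// invr_gt0.
have [G hG] := choice (fun k => esum_tail aS (p16 k)).
pose Fs := fix Fs k := if k is j.+1 then (Fs j `|` G k)%fset else G 0%N.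
have GF k l : l \in G k -> l \in Fs k by case: k => [//|k] lG; rewrite in_fsetU lG orbT.
have FS k : [set` Fs k] `<=` S.
  elim: k => [|k IH]; first exact: (hG 0%N).1.
  by move=> l /=; rewrite in_fsetU => /orP[/IH//|/((hG k.+1).1)].
pose f k t := \sum_(l <- Fs k) u l t.
have dif k (F : {fset T}) : (Fs k `<=` F)%fset -> [set` F] `<=` S ->
    (L2norm (fun t => (\sum_(l <- F) u l t - f k t)%R) ^+ 2 <= (16^-1 ^+ k)%:E)%E.
  move=> kF FS'; rewrite (_ : (fun t => _) = (fun t => \sum_(l <- (F `\` Fs k)%fset) u l t)).
    have DS : [set` (F `\` Fs k)%fset] `<=` S by move=> l /=; rewrite in_fsetD => /andP[_ /FS'].
    apply: le_trans (ua _ DS) _; rewrite lee_fin; apply: (hG k).2 => // l.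
    by rewrite in_fsetD => /andP[+ _]; apply: contra; exact: GF.
  by apply/funext => t; rewrite (sum_fsetD _ kF) addrAC subrr add0r.
have hf k : (L2norm (fun t => (f k.+1 t - f k t)%R) ^+ 2 <= (16^-1 ^+ k)%:E)%E.
  by apply: dif; [exact: fsubsetUl|exact: FS].
have [g g2 [C C0 hC]] := L2_complete (fun k => sum2 (Fs k)) hf.
exists g; split => // e e0.
(* Ensures [(2 C + 2) 4^-k < e^2], through [k <= 4^k]; both errors below acquire a factor 2 from
   [L2norm_sqrB_le] with weight 1. *)
pose k := (Num.truncn ((2 * C + 2) / e ^+ 2)).+1.
have e20 : 0 < e ^+ 2 by rewrite exprn_gt0.
have k4 (j : nat) : j%:R <= 4 ^+ j :> R.
  have e4 : 4 ^+ j = (4 ^ j)%N%:R :> R by rewrite natrX.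
  by rewrite e4 ler_nat ltnW// ltn_expl.
have hk : (2 * C + 2) * 4^-1 ^+ k < e ^+ 2.
  rewrite exprVn ltr_pdivrMr ?exprn_gt0// [ltRHS]mulrC -ltr_pdivrMr//.
  exact: lt_le_trans (truncnS_gt _) (k4 k).
have h16 : 16^-1 ^+ k <= 4^-1 ^+ k :> R.
  by rewrite lerXn2r ?nnegrE ?invr_ge0// lef_pV2 ?posrE// ler_nat.
exists (Fs k) => // F kF FS'; apply: L2norm_lt => //.
have kF' : (Fs k `<=` F)%fset by apply/fsubsetP => l /kF.
rewrite (_ : (fun t => _) = (fun t => (g t - f k t) - (\sum_(l <- F) u l t - f k t))); last first.
  by apply/funext => t; rewrite opprB addrA subrK.
apply: le_lt_trans (L2norm_sqrB_le ltr01 (in_L2B g2 (sum2 _)) (in_L2B (sum2 _) (sum2 _))) _.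
apply: (@le_lt_trans _ _ ((1 + 1)%:E * (C * 4^-1 ^+ k)%:E + (1 + 1^-1)%:E * (16^-1 ^+ k)%:E)%E).
  apply: leeD; apply: lee_wpmul2l.
  - by rewrite lee_fin addr_ge0.
  - exact: hC.
  - by rewrite lee_fin addr_ge0// invr_ge0.
  - exact: dif.
by rewrite -!EFinM -EFinD lte_fin invr1; move: hk h16; lra.
Qed.

(** The bound holds for finite sums close to [g]. Adjoining to [F1] the set [F0] given by
    convergence only enlarges the sum of [a], and a small weight [eta] makes the passage to [g] cost
    at most [e]. *)
Lemma L2_has_sum_lower_bound (A : R) g : L2_has_sum S u g ->
  (forall F : {fset T}, [set` F] `<=` S ->
    ((A * \sum_(l <- F) a l)%:E <= L2norm (fun t => (\sum_(l <- F) u l t)%R) ^+ 2)%E) ->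
  (A%:E * (\esum_(l in S) (a l)%:E) <= L2norm g ^+ 2)%E.
Proof.
move=> [g2 hg] hA; have e0 : (0 <= \esum_(l in S) (a l)%:E)%E by apply: esum_ge0 => l _; rewrite lee_fin.
(* A nonpositive [A] occurs in the final application when [delta >= 1]. *)
have [A0|A0] := leP A 0.
  by apply: le_trans (L2norm_sqr_ge0 g); apply: mule_le0_ge0.
have gf := L2norm_sqr_fin_num g2; rewrite -(fineK gf).
have G0 : 0 <= fine (L2norm g ^+ 2)%E by rewrite fine_ge0// L2norm_sqr_ge0.
rewrite muleC -lee_pdivlMr// -EFinM; apply: esum_le_fset => F1 F1S.
rewrite sumEFin lee_fin ler_pdivlMr// mulrC; apply/ler_addgt0Pr => e e0'.
(* The total error will be [eta Gn + eta^2 + eta], which is at most [eta (Gn + 2)]. *)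
set Gn := fine _ in G0 *; pose eta := Num.min 1 (e / (Gn + 2)).
have G2 : 0 < Gn + 2 by rewrite ltr_wpDl.
have eta0 : 0 < eta by rewrite lt_min ltr01 divr_gt0.
have eta1 : eta <= 1 by rewrite ge_min lexx.
have etae : eta * (Gn + 2) <= e by rewrite -ler_pdivlMr// ge_min lexx orbT.
have [F0 F0S hF0] := hg eta eta0.
pose F := (F0 `|` F1)%fset.
have FS : [set` F] `<=` S by move=> l /=; rewrite in_fsetU => /orP[/F0S|/F1S].
have F0F : [set` F0] `<=` [set` F] by move=> l /= lF; rewrite in_fsetU lF.
have := hF0 F F0F FS; set y := L2norm _ => ye.
have y0 : (0 <= y)%E by exact: Lnorm_ge0.
have y2 : (y ^+ 2 <= (eta ^+ 2)%:E)%E.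
  move: y ye y0 => [r||]//; rewrite lte_fin lee_fin => h1 h2.
  by rewrite expe2 -EFinM lee_fin -expr2; apply: lerXn2r; rewrite ?nnegrE//; exact: ltW.
have := hA F FS; rewrite (_ : (fun t => _) = (fun t => g t - (g t - \sum_(l <- F) u l t))); last first.
  by apply/funext => t; rewrite opprB addrC subrK.
move=> /le_trans/(_ (L2norm_sqrB_le eta0 g2 (in_L2B g2 (sum2 _)))).
rewrite -/y -(fineK gf) -/Gn => h.
have ei : 0 <= 1 + eta^-1 by rewrite addr_ge0// invr_ge0 ltW.
have {}h : A * \sum_(l <- F) a l <= (1 + eta) * Gn + (1 + eta^-1) * eta ^+ 2.
  rewrite -lee_fin EFinD !EFinM; apply: (le_trans h); rewrite -EFinM leeD2l//.
  by rewrite -EFinM; apply: lee_wpmul2l; rewrite ?lee_fin.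
have hF : A * \sum_(l <- F1) a l <= A * \sum_(l <- F) a l.
  rewrite ler_pM2l// (sum_fsetD a (_ : (F1 `<=` F)%fset)) ?fsubsetUr// lerDl.
  by apply: sumr_ge0 => l _; exact: a_ge0.
apply: (le_trans hF); apply: (le_trans h).
have -> : (1 + eta^-1) * eta ^+ 2 = eta ^+ 2 + eta by field; rewrite gt_eqF.
have : eta ^+ 2 <= eta by rewrite expr2 ler_piMl// ltW.
by move: etae; lra.
Qed.

End unconditional_sums.

(** * Selection of a subset *)

Section block_lower_bound.
Context (R : realType) (T K : choiceType) (G : T -> T -> R[i]) (kap : T -> K) (F : {fset T}).
Variables (b : T -> R[i]) (A tau : R).
Hypothesis G_sym : forall l m, normc (G l m) = normc (G m l).
Hypothesis diag : forall k, A * \sum_(l <- F | kap l == k) normc (b l) ^+ 2 <=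
  Re (\sum_(l <- F | kap l == k) \sum_(m <- F | kap m == k) b l * conjc (b m) * G l m).
Hypothesis off : forall l, l \in F -> \sum_(m <- F | kap m != kap l) normc (G l m) <= tau.

Let t l m := b l * conjc (b m) * G l m.

(** Schur's test: [|b l| |b m|] is at most half the sum of the squares, and by symmetry of [|G|]
    both halves are controlled by the row sums, at most [tau]. *)
Let off_bound : normc (\sum_(l <- F) \sum_(m <- F | kap m != kap l) t l m) <=
  tau * \sum_(l <- F) normc (b l) ^+ 2.
Proof.
pose g l m := if kap m != kap l then normc (G l m) else 0.
have gC l m : g l m = g m l by rewrite /g eq_sym G_sym.
have g_ge0 l m : 0 <= g l m by rewrite /g; case: ifP => // _; exact: normc_ge0.
have hg : \sum_(l <- F) \sum_(m <- F) normc (b l) ^+ 2 * g l m <= tau * \sum_(l <- F) normc (b l) ^+ 2.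
  rewrite mulr_sumr big_seq [leRHS]big_seq; apply: ler_sum => l lF.
  rewrite -mulr_sumr mulrC ler_wpM2r ?sqr_ge0//; apply: le_trans (off lF).
  by rewrite /g -big_mkcond.
apply: (@le_trans _ _ (\sum_(l <- F) \sum_(m <- F) (normc (b l) ^+ 2 * g l m + normc (b m) ^+ 2 * g l m) / 2)).
  apply: (le_trans (ler_normc_sum _ _ _)); apply: ler_sum => l _.
  apply: (le_trans (ler_normc_sum _ _ _)); rewrite big_mkcond; apply: ler_sum => m _.
  have := g_ge0 l m; rewrite /g /t; case: ifP => _ g0; last by rewrite !mulr0 addr0 mul0r.
  rewrite Normc.normcM Normc.normcM normcJ.
  move: g0; move: (normc (G l m)) (normc (b l)) (normc (b m)) => g1 p q g0.
  by have := mulr_ge0 g0 (sqr_ge0 (p - q)); lra.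
under eq_bigr do rewrite -mulr_suml big_split; rewrite -mulr_suml big_split /=.
rewrite [X in _ + X]exchange_big /=.
under [X in _ + X]eq_bigr do under eq_bigr do rewrite gC.
by rewrite ler_pdivrMr//; lra.
Qed.

(** Pairs with equal label [kap] form the diagonal blocks, bounded below by [diag]; the remaining
    pairs are an error controlled by [off_bound]. *)
Lemma block_lower_bound : (A - tau) * \sum_(l <- F) normc (b l) ^+ 2 <=
  Re (\sum_(l <- F) \sum_(m <- F) b l * conjc (b m) * G l m).
Proof.
have -> : \sum_(l <- F) \sum_(m <- F) b l * conjc (b m) * G l m =
    \sum_(l <- F) \sum_(m <- F | kap m == kap l) t l m +
    \sum_(l <- F) \sum_(m <- F | kap m != kap l) t l m.
  by rewrite -big_split; apply: eq_bigr => l _; exact: (bigID (fun m => kap m == kap l)).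
rewrite ReD mulrBl; apply: lerD.
  rewrite (partition_big_imfset _ kap) [in leRHS](partition_big_imfset _ kap) mulr_sumr Re_sum.
  apply: ler_sum => k _. apply: le_trans (diag k) _.
  rewrite le_eqVlt; apply/orP; left; apply/eqP; congr (Re _).
  by apply: eq_bigr => l /eqP ->.
have := ler_Re_normc (\sum_(l <- F) \sum_(m <- F | kap m != kap l) t l m).
by move=> /ler_normlP[h _]; rewrite lerNl; exact: le_trans h off_bound.
Qed.

End block_lower_bound.

Lemma bernoulli_le (R : realFieldType) (x : R) n : 0 <= x <= 1 -> 1 - n%:R * x <= (1 - x) ^+ n.
Proof.
move=> /andP[x0 x1]; elim: n => [|n IH]; first by rewrite expr0 mul0r subr0.
rewrite exprS -natr1; have x1' : 0 <= 1 - x by rewrite subr_ge0.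
apply: le_trans (ler_wpM2l x1' IH); have := mulr_ge0 (mulr_ge0 x0 x0) (ler0n R n).
by move: (n%:R : R) => k; lra.
Qed.

(* With a = D (p + q) / (2 p), Bernoulli's inequality leaves room for n M / N up
   to (p - q) / (p + q). *)
Lemma density_loss (R : realFieldType) (p q D M : R) (n : nat) : 0 < q < p -> 0 < D -> 0 < M ->
  exists2 a, 0 < a < D & forall r0 : R, exists2 N, M + 2 * `|r0| < N &
    q * D * N ^+ n <= p * a * (N - M) ^+ n.
Proof.
move=> /andP[q0 qp] D0 M0; have p0 : 0 < p by exact: lt_trans qp.
have pq0 : 0 < p - q by rewrite subr_gt0.
have spq : 0 < p + q by rewrite addr_gt0.
exists (D * (p + q) / (2 * p)).
  rewrite divr_gt0 ?mulr_gt0//= ltr_pdivrMr ?mulr_gt0// -subr_gt0.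
  by have -> : D * (2 * p) - D * (p + q) = D * (p - q) by [ring|]; rewrite mulr_gt0.
move=> r0; pose K := n%:R * M * (p + q) / (p - q).
have K0 : 0 <= K.
  apply: divr_ge0; last exact: ltW.
  by apply: mulr_ge0; [apply: mulr_ge0; [exact: ler0n|exact: ltW]|exact: ltW].
pose N := M + 2 * `|r0| + 1 + K; have r00 := normr_ge0 r0.
exists N; first by rewrite /N; lra.
have N0 : 0 < N by rewrite /N; lra.
have MN : M / N <= 1 by rewrite ler_pdivrMr// /N; lra.
have x0 : 0 <= M / N <= 1 by rewrite MN andbT; apply: divr_ge0; exact: ltW.
have -> : N - M = N * (1 - M / N) by field; rewrite gt_eqF.
rewrite exprMn mulrCA -subr_ge0 [q * D * _]mulrC -mulrBr; apply: mulr_ge0; first by rewrite exprn_ge0// ltW.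
have pa : p * (D * (p + q) / (2 * p)) = D * (p + q) / 2 by field; rewrite gt_eqF.
rewrite pa subr_ge0; apply: (@le_trans _ _ (D * (p + q) / 2 * (1 - n%:R * (M / N)))); last first.
  by apply: ler_wpM2l; [rewrite divr_ge0// mulr_ge0// ltW|exact: bernoulli_le].
have hx : n%:R * (M / N) * (p + q) <= p - q.
  rewrite mulrA -[leLHS]mulrAC -[_ * (p + q) / N]/(_ / N) ler_pdivrMr//.
  have -> : n%:R * M * (p + q) = K * (p - q) by rewrite /K divfK// gt_eqF.
  by rewrite mulrC ler_pM2l// /N; lra.
have := mulr_ge0 (ltW D0) (_ : 0 <= p - q - n%:R * (M / N) * (p + q)).
rewrite subr_ge0 => /(_ hx); move: (n%:R * (M / N)) => z; lra.
Qed.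

Lemma sum_fset_sub (T : choiceType) (V : nmodType) (F J : {fset T}) (f : T -> V) : (F `<=` J)%fset ->
  \sum_(l <- J) (if l \in F then f l else 0) = \sum_(l <- F) f l.
Proof.
move=> /fsubsetP FJ; rewrite -big_mkcond big_fset_condE.
rewrite (_ : [fset i in J | i \in F]%fset = F)//; apply/fsetP => l; rewrite !inE.
by apply/andP/idP => [[]//|lF]; split => //; exact: FJ.
Qed.

Section selection.
Context (R : realType) (d : nat) (phi : 'rV[R]_d -> R[i]).
Hypothesis hphi : feichtinger phi.
Variables (L : set 'rV[R]_(d + d)) (B : R).
Hypothesis hB : bessel_bound phi L B.
Hypothesis B_gt0 : 0 < B.
Variables (c : R -> R) (eps delta s D : R).
Hypothesis hc : finite_restricted_invertibility c.
Hypothesis heps : 0 < eps < 1.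
Hypothesis hdelta : 0 < delta.
Hypothesis phis : (L2norm phi ^+ 2 = s%:E)%E.
Hypothesis s_gt0 : 0 < s.
Hypothesis LD : lower_density L = D%:E.
Hypothesis D_gt0 : 0 < D.
Local Notation atom l := (tfshift l phi).
Local Notation n := (d + d)%N.
Local Notation gram F b :=
  (Re (\sum_(l <- F) \sum_(m <- F) b l * conjc (b m) * L2inner (atom l) (atom m))).

Let phi2 : in_Lp 2 phi. Proof. by case: hphi. Qed.

(** The gap [c eps * delta] is positive, so continuity of [c] at [eps] leaves room to the left of
    [eps]. *)
Lemma nearby_parameter : exists2 e, 0 < e < eps & c eps * (1 - delta) < c e.
Proof.
case: hc => c01 ccont _ _; have /andP[e0 e1] := heps.
have /andP[ce0 _] := c01 _ heps.
have lt0 : c eps * (1 - delta) < c eps by rewrite mulrBr mulr1 gtrBl mulr_gt0.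
have /cvgrPdist_lt : {for eps, continuous c} by apply: ccont; rewrite in_itv.
move=> /(_ (c eps - c eps * (1 - delta))); rewrite subr_gt0 => /(_ lt0)[r /= r0 hr].
pose t := Num.min (eps / 2) (r / 2).
have t0 : 0 < t by rewrite lt_min !divr_gt0.
have [te tr] : t <= eps / 2 /\ t <= r / 2 by rewrite /t !ge_min !lexx orbT.
exists (eps - t); first by apply/andP; split; lra.
have := hr (eps - t); rewrite /= opprB addrCA subrr addr0 gtr0_norm// => /(_ (_ : t < r)).
have tr' : t < r by lra.
by move=> /(_ tr'); rewrite ltr_norml => /andP[_ ?]; lra.
Qed.

(** The size depends on the guaranteed density [a] only, so it is the same for every centre [z]. The
    bound covers all subsets of [J], by extending coefficients by 0, because the finite sets tested
    later meet a cell in an arbitrary subset of its chosen points. *)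
Lemma local_selection (e a r : R) z : 0 < e < 1 -> 0 < a -> 0 < r ->
  (a%:E <= cube_density L r z)%E ->
  exists J : {fset 'rV[R]_n}, [/\ [set` J] `<=` L `&` cube z r,
    #|` J| = `|Num.ceil ((1 - e) * s / B * (a * (2 * r) ^+ n))|%N &
    forall (F : {fset 'rV[R]_n}) b, (F `<=` J)%fset ->
      c e * s * (\sum_(l <- F) normc (b l) ^+ 2) <= gram F b].
Proof.
move=> he a0 r0; rewrite cube_density_ge// => /counting_ge_fset[F FL hF].
have ar0 : 0 < a * (2 * r) ^+ n by rewrite mulr_gt0// exprn_gt0// mulr_gt0.
have F0 : (0 < #|` F|)%N by rewrite -(ltr_nat R); exact: lt_le_trans hF.
have FL' : [set` F] `<=` L by move=> l /FL[].
have [J [JF J1 J2]] := gabor_restricted_invertibility phi2 hB B_gt0 hc he phis s_gt0 FL' F0.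
set q := (1 - e) * s / B * (a * (2 * r) ^+ n).
have eB : 0 <= (1 - e) * s / B.
  by rewrite divr_ge0 ?mulr_ge0 ?ltW// subr_gt0; case/andP: he.
have q0 : 0 <= q by rewrite mulr_ge0// ltW.
have qJ : q <= (#|` J|)%:R by apply: le_trans J1; exact: ler_wpM2l.
(* The cardinal of [J] is an integer at least [q], hence at least its ceiling. *)
have mJ : (`|Num.ceil q| <= #|` J|)%N.
  have /andP[q1 q2] := ceil_itv q.
  have c0 : 0 <= Num.ceil q by rewrite -(ler_int R); exact: le_trans q0 q2.
  rewrite -lez_nat gez0_abs// -ltzD1 -ltrBlDr -(ltr_int R); apply: lt_le_trans q1 _.
  by rewrite -pmulrn.
exists [fset x in take `|Num.ceil q|%N J]%fset; split.
- by move=> x; rewrite /= !inE => /mem_take xJ; apply: FL; exact: (fsubsetP JF).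
- by rewrite card_fseq undup_id ?take_uniq ?fset_uniq// size_take_min (minn_idPl mJ).
move=> F' b F'J; have F'J' : (F' `<=` J)%fset.
  by apply: fsubset_trans F'J _; apply/fsubsetP => x; rewrite !inE => /mem_take.
have := J2 (fun l => if l \in F' then b l else 0); congr (_ * _ <= Re _).
  rewrite -(sum_fset_sub (fun l => normc (b l) ^+ 2) F'J'); apply: eq_bigr => l _.
  by case: ifP => // _; rewrite Normc.normc0 expr0n.
rewrite -(sum_fset_sub _ F'J'); apply: eq_bigr => l _; case: ifP => lF; last first.
  by rewrite big1// => m _; rewrite !mul0r.
rewrite -(sum_fset_sub _ F'J'); apply: eq_bigr => m _; case: ifP => // _.
by rewrite conjc0 mulr0 mul0r.
Qed.

End selection.

Section separated_selection.
Context (R : realType) (d : nat) (phi : 'rV[R]_d -> R[i]).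
Hypothesis hphi : feichtinger phi.
Variables (L : set 'rV[R]_(d + d)) (B : R).
Hypothesis hB : bessel_bound phi L B.
Hypothesis B_gt0 : 0 < B.
Variables (c : R -> R) (eps delta s D : R).
Hypothesis hc : finite_restricted_invertibility c.
Hypothesis heps : 0 < eps < 1.
Hypothesis hdelta : 0 < delta.
Hypothesis phis : (L2norm phi ^+ 2 = s%:E)%E.
Hypothesis s_gt0 : 0 < s.
Hypothesis LD : lower_density L = D%:E.
Hypothesis D_gt0 : 0 < D.
Local Notation atom l := (tfshift l phi).
Local Notation n := (d + d)%N.
Local Notation gram F b :=
  (Re (\sum_(l <- F) \sum_(m <- F) b l * conjc (b m) * L2inner (atom l) (atom m))).

Let phi2 : in_Lp 2 phi. Proof. by case: hphi. Qed.

Lemma exists_selection : exists (L' : set 'rV[R]_n) (D' : R), [/\ L' `<=` L,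
  uniform_density L' D'%:E, (1 - eps) / B * s * D <= D' &
  forall (F : {fset 'rV[R]_n}) b, [set` F] `<=` L' ->
    c eps * (1 - delta) * s * (\sum_(l <- F) normc (b l) ^+ 2) <= gram F b].
Proof.
have [e /andP[e0 ee] hce] := nearby_parameter hc heps hdelta.
have e1 : eps < 1 by case/andP: heps.
have he : 0 < e < 1 by rewrite e0 (lt_trans ee e1).
have phi0 : (0 < L2norm phi ^+ 2)%E by rewrite phis lte_fin.
have [C [rho [C0 rho0 hC]]] := card_cube_bound hphi hB phi0.
(* The slack between the lower bounds at [e] and at [eps], all of it spent on interactions between
   cells. *)
pose tau := s * (c e - c eps * (1 - delta)).
have tau0 : 0 < tau by rewrite mulr_gt0// subr_gt0.
have [M M0 hM] := gram_tail hphi C0 rho0 hC tau0.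
(* The extra 1 puts points of different cells strictly outside each other's cube of radius [M]. *)
have M1 : 0 < M + 1 by rewrite addr_gt0.
have pq : 0 < 1 - eps < 1 - e by apply/andP; split; lra.
have [a /andP[a0 aD] hN] := density_loss n pq D_gt0 M1.
have [r0 hr0] : exists r0, forall r x, r0 < r -> (a%:E < cube_density L r x)%E.
  by apply: lower_density_gt; rewrite LD lte_fin.
have [N N1 N2] := hN r0.
(* Half the side of the shrunken cell; [z k] below is the centre of the cell of index [k]. *)
pose r := (N - (M + 1)) / 2.
have r0a := normr_ge0 r0; have r0b := ler_norm r0.
have r0r : r0 < r by rewrite /r; lra.
have rpos : 0 < r by rewrite /r; lra.
have N0 : 0 < N by lra.
have Nn : 0 < N ^+ n by rewrite exprn_gt0.
pose z (k : 'rV[int]_n) : 'rV[R]_n := \row_i (N * ((k ord0 i)%:~R + 2^-1)).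
have [J hJ] := choice (fun k => local_selection hphi hB B_gt0 hc phis s_gt0 he a0 rpos (ltW (hr0 r (z k) r0r))).
have Jz k x i : x \in J k -> N * ((k ord0 i)%:~R + 2^-1) - r <= x ord0 i <= N * ((k ord0 i)%:~R + 2^-1) + r.
  by move=> xk; have [JL _ _] := hJ k; have [_ /(_ i)] := JL x xk; rewrite mxE.
have Jcell k x : x \in J k -> forall i, N * (k ord0 i)%:~R < x ord0 i < N * (k ord0 i + 1)%:~R.
  move=> xk i; have /andP[] := Jz k x i xk; rewrite intrD mulr1z /r => h1 h2.
  by apply/andP; split; lra.
set q := (1 - e) * s / B * (a * (2 * r) ^+ n) in hJ.
have cardJ k : #|` J k| = `|Num.ceil q|%N by have [_ -> _] := hJ k.
exists (\bigcup_k [set` J k]), (`|Num.ceil q|%:R / N ^+ n); split.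
- by move=> x [k _ /= xk]; have [JL _ _] := hJ k; exact: (JL x xk).1.
- exact: (grid_density N0 cardJ Jcell).
- rewrite ler_pdivlMr//; have /andP[_ q2] := ceil_itv q.
  apply: (@le_trans _ _ q).
    (* Both sides are rewritten so that only the inequality supplied by [density_loss] remains. *)
    have -> : (1 - eps) / B * s * D * N ^+ n = s / B * ((1 - eps) * D * N ^+ n) by ring.
    have -> : q = s / B * ((1 - e) * a * (N - (M + 1)) ^+ n).
      have -> : N - (M + 1) = 2 * r by rewrite /r; field.
      by rewrite /q; ring.
    by apply: ler_wpM2l => //; rewrite divr_ge0// ltW.
  by apply: (le_trans q2); rewrite natr_absz ler_int ler_norm.
move=> F b FL.
(* The cell of a point; the default 0 is not met on [F], whose points all lie in some [J k]. *)
pose kap x := xget 0 [set k | x \in J k].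
have kapP x : x \in F -> x \in J (kap x).
  by move=> /FL[k _ /= xk]; exact: (@xgetI _ 0 [set k | x \in J k] k xk).
have -> : c eps * (1 - delta) * s = c e * s - tau by rewrite /tau; ring.
apply: (block_lower_bound (kap := kap) (G := fun l m => L2inner (atom l) (atom m))).
- by move=> l m; rewrite (L2inner_conj (in_L2_tfshift m phi2) (in_L2_tfshift l phi2)) normcJ.
- move=> k; rewrite big_fset_condE [in leRHS]big_fset_condE.
  under [in leRHS]eq_bigr do rewrite big_fset_condE.
  have [_ _ hk] := hJ k; apply: hk; apply/fsubsetP => x; rewrite !inE => /andP[xF /eqP <-].
  exact: kapP.
move=> l lF; rewrite big_fset_condE; apply: hM.
  move=> m; rewrite /= !inE => /andP[/kapP mJ _].
  by have [JL _ _] := hJ (kap m); exact: (JL m mJ).1.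
move=> m; rewrite !inE => /andP[mF /eqP kml] hcube.
(* In a coordinate where the cell indices differ, the two points are at least [N - 2 r = M + 1]
   apart. *)
have [i ki] : exists i, kap m ord0 i <> kap l ord0 i.
  by apply/existsNP => h; apply: kml; apply/rowP => i; exact: h.
have /andP[m1 m2] := Jz _ _ i (kapP m mF); have /andP[l1 l2] := Jz _ _ i (kapP l lF).
have /andP[c1 c2] := hcube i.
move: (kap m ord0 i) (kap l ord0 i) ki m1 m2 l1 l2 => km kl ki m1 m2 l1 l2.
have NM : N - 2 * r = M + 1 by rewrite /r; field.
have [h|h|//] := ltgtP km kl.
  have : N * (km%:~R + 1) <= N * kl%:~R.
    by rewrite ler_pM2l// -[1](mulr1z) -intrD ler_int lezD1.
  by lra.
have : N * (kl%:~R + 1) <= N * km%:~R.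
  by rewrite ler_pM2l// -[1](mulr1z) -intrD ler_int lezD1.
by lra.
Qed.

End separated_selection.

(** * Degenerate cases and finiteness of the density *)

Section degenerate_cases.
Context (R : realType).

Lemma uniform_density_set0 n : uniform_density (set0 : set 'rV[R]_n) (0 : R)%:E.
Proof.
apply: uniform_density_squeeze => e e0; exists 0 => r x r0.
have p0 : 0 <= (2 * r) ^+ n by rewrite exprn_ge0// mulr_ge0// ltW.
rewrite cube_density_ge// cube_density_le// set0I; apply/andP; split.
  apply: le_trans (_ : ((#|` (fset0 : {fset 'rV[R]_n})|)%:R%:E <= _)%E).
    by rewrite cardfs0 lee_fin sub0r mulNr oppr_le0 mulr_ge0// ltW.
  by apply: fset_le_counting => y; rewrite /= inE.
apply: (@le_trans _ _ ((#|` (fset0 : {fset 'rV[R]_n})|)%:R%:E)).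
  by apply: counting_le_fset => y [].
by rewrite cardfs0 lee_fin add0r mulr_ge0// ltW.
Qed.

Lemma L2_has_sum_set0 n (T : choiceType) (u : T -> 'rV[R]_n -> R[i]) :
  L2_has_sum set0 u (fun=> 0).
Proof.
split; first exact: in_L2_0.
move=> e e0; exists fset0 => [l|F _ F0]; first by rewrite /= inE.
have -> : F = fset0 by apply/fsetP => l; rewrite inE; apply/negP => /F0.
apply: L2norm_lt => //; rewrite L2norm_sqr.
under eq_integral do rewrite big_seq_fset0 subrr Normc.normc0 expr0n.
by rewrite integral0 lte_fin exprn_gt0.
Qed.

Lemma lower_density_nonempty n (L : set 'rV[R]_n) : (0 < lower_density L)%E -> L !=set0.
Proof.
move=> /lower_density_gt[r0 hr]; apply/set0P/negP => /eqP L0.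
pose r := `|r0| + 1; have r0r : r0 < r by rewrite ltr_pwDr// ler_norm.
have rp : 0 < r by rewrite ltr_wpDl.
have := hr r 0 r0r; rewrite ltNge => /negP; apply.
rewrite cube_density_le// L0 set0I mul0r.
apply: (@le_trans _ _ ((#|` (fset0 : {fset 'rV[R]_n})|)%:R%:E)); last by rewrite cardfs0.
by apply: counting_le_fset => y [].
Qed.

(** An infinite density would contradict relative separation: for [r >= rho] the bound
    [C (2 (r + rho))^n] is at most [C 2^n (2 r)^n]. *)
Lemma lower_density_lty n (L : set 'rV[R]_n) (C rho : R) : 0 <= C -> 0 <= rho ->
  (forall (F : {fset 'rV[R]_n}) y r, 0 <= r -> [set` F] `<=` L -> [set` F] `<=` cube y r ->
    (#|` F|)%:R <= C * (2 * (r + rho)) ^+ n) ->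
  (lower_density L < +oo)%E.
Proof.
move=> C0 rho0 hC; rewrite ltNge; apply/negP => hoo.
have [r0 hr] : exists r0, forall r x, r0 < r -> ((C * 2 ^+ n + 1)%:E < cube_density L r x)%E.
  by apply: lower_density_gt; apply: lt_le_trans hoo; exact: ltry.
pose r := `|r0| + rho + 1; have ra := normr_ge0 r0; have rb := ler_norm r0.
have r0r : r0 < r by rewrite /r; lra.
have rp : 0 < r by rewrite /r; lra.
have rrho : rho <= r by rewrite /r; lra.
have := ltW (hr r 0 r0r); rewrite cube_density_ge// => /counting_ge_fset[F FL hF].
have := hC F 0 r (ltW rp) (fun l lF => (FL l lF).1) (fun l lF => (FL l lF).2).
move=> /(le_trans hF); apply/negP; rewrite -ltNge.
have p0 : 0 < (2 * r) ^+ n by rewrite exprn_gt0// mulr_gt0.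
apply: (@le_lt_trans _ _ (C * (2 ^+ n * (2 * r) ^+ n))); last first.
  by rewrite mulrA [ltRHS]mulrDl mul1r ltrDl.
apply: ler_wpM2l => //; rewrite -exprMn; apply: lerXn2r; rewrite ?nnegrE.
- by rewrite mulr_ge0// addr_ge0// ltW.
- by rewrite !mulr_ge0// ltW.
- by rewrite ler_pM2l//; lra.
Qed.

(** The Bessel inequality is tested on an atom of the system itself: the single term of index [l]
    gives [s^2 <= B s]. *)
Lemma bessel_bound_gt0 d (phi : 'rV[R]_d -> R[i]) L (B s : R) : in_Lp 2 phi ->
  bessel_bound phi L B -> L !=set0 -> (L2norm phi ^+ 2 = s%:E)%E -> 0 < s -> 0 < B.
Proof.
move=> phi2 hB [l Ll] phis s0; have [mphi _] := phi2.
have := hB _ (in_L2_tfshift l phi2); rewrite L2norm_tfshift// phis.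
have lL : [set` [fset l]%fset] `<=` L by move=> m /=; rewrite inE => /eqP ->.
move=> /(le_trans (fset_le_esum (fun m => (normc (L2inner (tfshift l phi) (tfshift m phi)) ^+ 2)%:E) lL)).
rewrite big_seq_fset1 L2inner_self L2norm_tfshift// phis /fine normc_real (ger0_norm (ltW s0)) -EFinM lee_fin => h.
by rewrite -(pmulr_lgt0 _ s0); apply: lt_le_trans h; rewrite exprn_gt0.
Qed.

End degenerate_cases.

Theorem theorem2p8 (R : realType) (d : nat) (c : R -> R)
  (hc : finite_restricted_invertibility c)
  (eps delta : R) (heps : 0 < eps < 1) (hdelta : 0 < delta)
  (phi : 'rV[R]_d -> R[i]) (hphi : feichtinger phi)
  (L : set 'rV[R]_(d + d)) (hdiscrete : L `<=` isolated L)
  (hdensity : (0 < lower_density L)%E)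
  (B : R) (hB : bessel_bound phi L B) :
  exists (L' : set 'rV[R]_(d + d)) (D : \bar R),
    [/\ L' `<=` L,
        uniform_density L' D,
        (((1 - eps) / B)%:E * L2norm phi ^+ 2 <= D / lower_density L)%E &
        forall b : 'rV[R]_(d + d) -> R[i], square_summable L b ->
          exists2 g : 'rV[R]_d -> R[i],
            L2_has_sum L' (fun l t => b l * tfshift l phi t) g &
            ((c eps * (1 - delta))%:E * L2norm phi ^+ 2 *
               (\esum_(l in L') (Normc.normc (b l) ^+ 2)%:E) <= L2norm g ^+ 2)%E].
Proof.
have phi2 : in_Lp 2 phi by case: hphi.
have phis := esym (fineK (L2norm_sqr_fin_num phi2)).
have s_ge0 : 0 <= fine (L2norm phi ^+ 2)%E by rewrite fine_ge0// L2norm_sqr_ge0.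
move: (fine _) phis s_ge0 => s phis; rewrite le_eqVlt => /orP[/eqP s0|s_gt0].
  (* Here [phi] has norm 0, so both inequalities have left-hand side 0 and the empty set, of density
     0, suffices. *)
  exists set0, (0 : R)%:E; split => //; first exact: uniform_density_set0.
    by rewrite phis -s0 mule0 mul0e.
  move=> b _; exists (fun=> 0); first exact: L2_has_sum_set0.
  by rewrite phis -s0 mule0 mul0e L2norm_sqr_ge0.
have B_gt0 := bessel_bound_gt0 phi2 hB (lower_density_nonempty hdensity) phis s_gt0.
have [C [rho [C0 rho0 hC]]] : exists C rho : R, _ :=
  card_cube_bound hphi hB (eq_ind_r (fun x => (0 < x)%E) (s_gt0 : (0 < s%:E)%E) phis).
have LD : lower_density L = (fine (lower_density L))%:E.
  by rewrite fineK// gt0_fin_numE//; exact: lower_density_lty C0 rho0 hC.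
have D_gt0 : 0 < fine (lower_density L) by rewrite -lte_fin -LD.
move: (fine _) LD D_gt0 => D LD D_gt0.
have [L' [D' [L'L uD hD hlow]]] :=
  exists_selection hphi hB B_gt0 hc heps hdelta phis s_gt0 LD D_gt0.
exists L', D'%:E; split => //.
  by rewrite phis LD inver gt_eqF// -!EFinM lee_fin ler_pdivlMr.
move=> b hb; have u2 l : in_Lp 2 (fun t => b l * tfshift l phi t).
  by apply: in_L2_scale; exact: in_L2_tfshift.
have atom2 l : in_Lp 2 (tfshift l phi) by exact: in_L2_tfshift.
have [g hg] : exists g, L2_has_sum L' (fun l t => b l * tfshift l phi t) g.
  (* Convergence rests on the upper bound [bessel_synthesis], hence the weights [B |b l|^2]; the
     lower bound at the end uses the weights [|b l|^2]. *)
  apply: (L2_has_sum_exists (a := fun l => B * normc (b l) ^+ 2)) => //.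
  - by move=> l; rewrite mulr_ge0 ?sqr_ge0// ltW.
  - apply: (@le_lt_trans _ _ (B%:E * \esum_(l in L) (normc (b l) ^+ 2)%:E)%E).
      apply: esum_le_fset => F FL'; under eq_bigr do rewrite EFinM.
      rewrite -ge0_sume_distrr => [|l _]; last by rewrite lee_fin sqr_ge0.
      apply: lee_wpmul2l; first by rewrite lee_fin ltW.
      by apply: (fset_le_esum (fun l => (normc (b l) ^+ 2)%:E)) => l /FL' /L'L.
    by rewrite lte_mul_pinfty// lee_fin ltW.
  move=> F FL'; rewrite L2norm_lincomb// lee_fin -mulr_sumr.
  exact: (bessel_synthesis phi2 hB B_gt0 b (subset_trans FL' L'L)).
exists g => //; rewrite phis -EFinM.
apply: (L2_has_sum_lower_bound u2 _ hg) => [l|F FL']; first exact: sqr_ge0.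
by rewrite L2norm_lincomb// lee_fin; exact: hlow.
Qed.
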